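(* Assume that $A$, $F$, $q$, $\phi$ satisfy conditions (a), (b), (c) of the Hypothesis in the context, and let $V$ be the value functional. If $V\in C^1(\Lambda)$ and $A^*\partial_xV\in C^0(\Lambda)$, then $V$ is a classical solution of the PHJB equation, i.e. pointwise $$\begin{cases}\partial_tV(\gamma_t)+(A^*\partial_xV(\gamma_t),\gamma_t(t))_H+\mathbf{H}(\gamma_t,\partial_xV(\gamma_t))=0, & t\in[0,T),\ \gamma_t\in\Lambda_t,\\ V(\gamma_T)=\phi(\gamma_T), & \gamma_T\in\Lambda_T.\end{cases}$$
   Context: **Path spaces.** $H$ is a real separable Hilbert space with inner product $(\cdot,\cdot)_H$ and norm $|\cdot|$; $T>0$ is fixed; $A$ generates a $C_0$-semigroup $\{e^{tA}\}_{t\ge0}$ of bounded linear operators on $H$, and $A^*$ is its adjoint. For $t\in[0,T]$, $\hat\Lambda_t=D([0,t];H)$ is the set of càdlàg functions $[0,t]\to H$ and $\Lambda_t=C([0,t];H)$. Put $\hat\Lambda^t=\bigcup_{s\in[t,T]}\hat\Lambda_s$, $\hat\Lambda=\hat\Lambda^0$, $\Lambda^t=\bigcup_{s\in[t,T]}\Lambda_s$, $\Lambda=\Lambda^0$. An element with subscript $t$, such as $\gamma_t$, is a path on $[0,t]$; $\gamma_t(s)$ is its value at $s$. For $x\in H$ and $t\le\bar t\le T$: $\gamma_t^x$ is the path on $[0,t]$ equal to $\gamma_t$ on $[0,t)$ with $\gamma_t^x(t)=\gamma_t(t)+x$; $\gamma_{t,\bar t}$ is the path on $[0,\bar t]$ equal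 to $\gamma_t$ on $[0,t)$ and to $\gamma_t(t)$ on $[t,\bar t]$; $\gamma_{t,\bar t,A}$ is the path on $[0,\bar t]$ equal to $\gamma_t$ on $[0,t)$ and to $e^{(s-t)A}\gamma_t(t)$ at $s\in[t,\bar t]$. Set $\|\gamma_t\|_0=\sup_{0\le s\le t}|\gamma_t(s)|$ and $d_\infty(\gamma_t,\eta_s)=|t-s|+\|\gamma_{t,T,A}-\eta_{s,T,A}\|_0$. **Derivatives.** For $f$ on paths in $\hat\Lambda$: $\partial_xf(\gamma_t)=B\in H$ if $\lim_{|h|\to0}|f(\gamma_t^h)-f(\gamma_t)-(B,h)_H|/|h|=0$; $\partial_tf(\gamma_t)=\lim_{l\downarrow0}\frac1l[f(\gamma_{t,t+l})-f(\gamma_t)]$ for $t<T$. $C^0(\hat\Lambda^t)$, $C^0(\Lambda^t)$ denote functionals continuous under $d_\infty$. $f\in C^1(\hat\Lambda^t)$ if $f\in C^0(\hat\Lambda^t)$ and $\partial_tf,\partial_xf$ exist and are continuous. $f\in C^1(\Lambda^t)$ if $f$ is the restriction to $\Lambda^t$ of some $\hat f\in C^1(\hat\Lambda^t)$; then $\partial_tf,\partial_xf$ on $\Lambda^t$ denote the restrictions of $\partial_t\hat f,\partial_x\hat f$. ''$A^*\partial_xf\in C^0(\Lambda^t)$'' means that $\partial_xf$ takes values in the domain of $A^*$ and $\gamma\mapsto A^*\partial_xf(\gamma)$ is $d_\infty$-continuous on $\Lambda^t$. **Hypothesis.** $(U,d)$ is a metric space; $F:\Lambda\times U\to H$, $q:\Lambda\times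 U\to\mathbb R$, $\phi:\Lambda_T\to\mathbb R$. (a) $\{e^{tA}\}$ is a $C_0$ contraction semigroup. (b) For every $\gamma_t\in\Lambda$, $F(\gamma_t,\cdot)$ and $q(\gamma_t,\cdot)$ are continuous in $u$. (c) There is $L>0$ such that for all $\gamma_t,\eta_s\in\Lambda$, $\zeta_T,\zeta_T'\in\Lambda_T$, $u\in U$: $|F(\gamma_t,u)|^2\le L^2(1+\|\gamma_t\|_0^2)$, $|F(\gamma_t,u)-F(\eta_s,u)|\le Ld_\infty(\gamma_t,\eta_s)$, $|q(\gamma_t,u)-q(\eta_s,u)|\le Ld_\infty(\gamma_t,\eta_s)$, $|q(\gamma_t,u)|\le L(1+\|\gamma_t\|_0)$, $|\phi(\zeta_T)-\phi(\zeta'_T)|\le L\|\zeta_T-\zeta_T'\|_0$, $|\phi(\zeta_T)|\le L(1+\|\zeta_T\|_0)$. **Control problem.** $\mathcal U[t,T]$ is the set of measurable $u:[t,T]\to U$. For $\gamma_t\in\Lambda_t$, $u\in\mathcal U[t,T]$, $X^{\gamma_t,u}:[0,T]\to H$ is the unique continuous function (mild solution) with $X(s)=\gamma_t(s)$ for $s\in[0,t)$ and $X(s)=e^{(s-t)A}\gamma_t(t)+\int_t^se^{(s-\sigma)A}F(X_\sigma,u(\sigma))\,d\sigma$ for $s\in[t,T]$, where $X_\sigma=X|_{[0,\sigma]}$. The cost is $J(\gamma_t,u)=\int_t^Tq(X^{\gamma_t,u}_\sigma,u(\sigma))d\sigma+\phi(X_T^{\gamma_t,u})$ and the value functional is $V(\gamma_t)=\inf_{u\in\mathcal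 U[t,T]}J(\gamma_t,u)$, $\gamma_t\in\Lambda$. **Hamiltonian.** $\mathbf H(\gamma_t,p)=\inf_{u\in U}[(p,F(\gamma_t,u))_H+q(\gamma_t,u)]$, $(\gamma_t,p)\in\Lambda\times H$. *)

(* Defs.v *)
From HB Require Import structures.
From mathcomp Require Import all_boot all_order all_algebra.
From mathcomp Require Import all_classical all_reals all_analysis.

Set Implicit Arguments.
Unset Strict Implicit.
Unset Printing Implicit Defensive.

Import Order.TTheory GRing.Theory Num.Theory.
Import numFieldNormedType.Exports.

Local Open Scope classical_set_scope.
Local Open Scope ring_scope.

Section semigroup.
Context {R : realType} {H : completeNormedModType R}.
(* Only the operators [S t] with [0 <= t] are meaningful. *)
Implicit Types (S : R -> {linear H -> H}) (ip : {dot H for idfun}).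

Definition C0_semigroup S : Prop :=
  [/\ forall t, 0 <= t -> continuous (S t),
      forall x, S 0 x = x,
      forall s t x, 0 <= s -> 0 <= t -> S (s + t) x = S s (S t x)
    & forall x, S t x @[t --> 0^'+] --> x].

Definition contraction_semigroup S : Prop :=
  C0_semigroup S /\ forall t x, 0 <= t -> `|S t x| <= `|x|.

(* The unbounded operator (A, domA) is the infinitesimal generator of S; the
   equivalence makes domA the full domain of the generator. *)
Definition generates (domA : set H) (A : H -> H) S : Prop :=
  forall x y, (domA x /\ A x = y) <->
    h^-1 *: (S h x - x) @[h --> 0^'+] --> y.

Definition is_adjoint ip (domA : set H) (A : H -> H) (y z : H) : Prop :=
  forall x, domA x -> ip (A x) y = ip x z.

Definition adjoint_dom ip domA A : set H :=
  [set y | exists z, is_adjoint ip domA A y z].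

(* z is unique when domA is dense, as it is for a generator. *)
Definition adjoint ip domA A (y : H) : H :=
  xget 0 [set z | is_adjoint ip domA A y z].

End semigroup.

Section bochner.
Context {R : realType}.

(* Stated with the sigma-algebra [<<s open >>] itself because a [metricType]
   is not pointed, hence not canonically a [measurableType]. *)
Definition borel_measurable {E : topologicalType} (D : set R) (f : R -> E) :=
  forall B : set E, <<s @open E >> B -> measurable (D `&` f @^-1` B).

Context {H : completeNormedModType R}.

(* A list [:: (A_1, c_1); ..; (A_n, c_n)] stands for the simple function
   sum_i 1_(A_i) c_i; the A_i need not be disjoint. *)
Definition simple_fun (s : seq (set R * H)) (x : R) : H :=
  \sum_(p <- s) (\1_(p.1) x : R) *: p.2.

Definition simple_integral (D : set R) (s : seq (set R * H)) : H :=
  \sum_(p <- s) fine (lebesgue_measure (p.1 `&` D)) *: p.2.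

(* Bochner integral over a set D of finite Lebesgue measure. Borel
   measurability of f amounts to strong measurability as H is separable
   wherever this is used. *)
Definition is_bochner_integral (D : set R) (f : R -> H) (v : H) : Prop :=
  borel_measurable D f /\
  exists s : nat -> seq (set R * H),
    [/\ forall n p, p \in s n -> measurable p.1,
        (\int[lebesgue_measure]_(x in D) (`|f x - simple_fun (s n) x|)%:E)%E
          @[n --> \oo] --> 0%E
      & simple_integral D (s n) @[n --> \oo] --> v].

Definition bochner_integrable D f : Prop := exists v, is_bochner_integral D f v.

Definition bochner_integral D f : H := xget 0 [set v | is_bochner_integral D f v].

End bochner.

(* A path gamma_t is a pair (t, gamma). So that equality is equality of paths
   on [0, t], paths are required ([path_on]) to vanish outside [0, t], and are
   built with [mkpath]. *)
Record hpath (R : realType) (H : completeNormedModType R) :=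
  Path { ptime : R ; pfun :> R -> H }.
Arguments Path {R H}.
Arguments ptime {R H}.

Section paths.
Context {R : realType} {H : completeNormedModType R}.
Implicit Types (g : hpath H) (T : R).

Definition mkpath (t : R) (f : R -> H) : hpath H :=
  Path t (fun s => if 0 <= s <= t then f s else 0).

Definition path_on T g : Prop :=
  0 <= ptime g <= T /\ forall s, ~~ (0 <= s <= ptime g) -> g s = 0.

Definition cadlag (t : R) (f : R -> H) : Prop :=
  (forall s, 0 <= s < t -> f r @[r --> s^'+] --> f s) /\
  (forall s, 0 < s <= t -> cvg (f r @[r --> s^'-])).

(* hat Lambda *)
Definition cadlag_paths T : set (hpath H) :=
  [set g | path_on T g /\ cadlag (ptime g) g].

(* Lambda *)
Definition cont_paths T : set (hpath H) :=
  [set g | path_on T g /\ {within `[0, ptime g], continuous g}].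

(* Lambda_t *)
Definition cont_paths_at T (t : R) : set (hpath H) :=
  cont_paths T `&` [set g | ptime g = t].

Definition supnorm (t : R) (f : R -> H) : R := sup [set `|f s| | s in `[0, t]].

Definition pnorm g : R := supnorm (ptime g) g.

(* gamma_t^x *)
Definition vbump g (x : H) : hpath H :=
  mkpath (ptime g) (fun s => if s < ptime g then g s else g (ptime g) + x).

(* gamma_(t, t') *)
Definition flat_ext g (t' : R) : hpath H :=
  mkpath t' (fun s => if s < ptime g then g s else g (ptime g)).

Variable S : R -> {linear H -> H}.

(* gamma_(t, t', A) *)
Definition semigroup_ext g (t' : R) : hpath H :=
  mkpath t'
    (fun s => if s < ptime g then g s else S (s - ptime g) (g (ptime g))).

Definition dinf T g g' : R :=
  `|ptime g - ptime g'| +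
  supnorm T (fun s => semigroup_ext g T s - semigroup_ext g' T s).

Definition dinf_continuous T {E : normedZmodType R} (D : set (hpath H))
    (f : hpath H -> E) : Prop :=
  forall g, D g -> forall e, 0 < e -> exists2 d, 0 < d &
    forall g', D g' -> dinf T g g' < d -> `|f g - f g'| < e.

Variable ip : {dot H for idfun}.

Definition is_dpath_x (f : hpath H -> R) g (B : H) : Prop :=
  `|f (vbump g h) - f g - ip B h| / `|h| @[h --> 0^'] --> (0 : R).

Definition dpath_x (f : hpath H -> R) g : H :=
  xget 0 [set B | is_dpath_x f g B].

Definition dpath_t_quot (f : hpath H -> R) g (l : R) : R :=
  l^-1 * (f (flat_ext g (ptime g + l)) - f g).

Definition dpath_t (f : hpath H -> R) g : R :=
  lim (dpath_t_quot f g l @[l --> 0^'+]).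

(* C^1(hat Lambda). The time derivative is defined for t < T only, so its
   existence and continuity are required there. *)
Definition C1_cadlag T (f : hpath H -> R) : Prop :=
  let before_T := cadlag_paths T `&` [set g | ptime g < T] in
  [/\ dinf_continuous T (cadlag_paths T) f,
      forall g, before_T g -> cvg (dpath_t_quot f g l @[l --> 0^'+]),
      dinf_continuous T before_T (dpath_t f),
      forall g, cadlag_paths T g -> exists B, is_dpath_x f g B
    & dinf_continuous T (cadlag_paths T) (dpath_x f)].

End paths.

Section control.
Context {R : realType} {H : completeNormedModType R} {U : metricType R}.
Variables (S : R -> {linear H -> H}) (ip : {dot H for idfun}) (T : R).
Variables (F : hpath H -> U -> H) (q : hpath H -> U -> R) (phi : hpath H -> R).

Definition coef_continuous : Prop :=
  forall g, cont_paths T g -> continuous (F g) /\ continuous (q g).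

Definition coef_bounds : Prop :=
  exists2 L : R, 0 < L &
    (forall g g' u, cont_paths T g -> cont_paths T g' ->
      [/\ `|F g u| ^+ 2 <= L ^+ 2 * (1 + pnorm g ^+ 2),
          `|F g u - F g' u| <= L * dinf S T g g',
          `|q g u - q g' u| <= L * dinf S T g g'
        & `|q g u| <= L * (1 + pnorm g)]) /\
    (forall z z', cont_paths_at T T z -> cont_paths_at T T z' ->
      `|phi z - phi z'| <= L * supnorm T (fun s => z s - z' s) /\
      `|phi z| <= L * (1 + pnorm z)).

Definition controls (t : R) : set (R -> U) :=
  [set u | borel_measurable `[t, T] u].

Definition is_mild_solution (g : hpath H) (u : R -> U) (X : R -> H) : Prop :=
  let t := ptime g in
  [/\ {within `[0, T], continuous X},
      forall s, 0 <= s < t -> X s = g s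
    & forall s, t <= s <= T ->
        let f r := S (s - r) (F (mkpath r X) (u r)) in
        bochner_integrable `[t, s] f /\
        X s = S (s - t) (g t) + bochner_integral `[t, s] f].

(* The mild solution exists and is unique on [0, T] under the standing
   assumptions; only its values on [0, T] are ever used. *)
Definition mild_solution (g : hpath H) (u : R -> U) : R -> H :=
  xget (fun=> 0) [set X | is_mild_solution g u X].

Definition cost (g : hpath H) (u : R -> U) : R :=
  let X := mild_solution g u in
  \int[lebesgue_measure]_(r in `[ptime g, T]) q (mkpath r X) (u r)
  + phi (mkpath T X).

Definition value (g : hpath H) : R :=
  inf [set cost g u | u in controls (ptime g)].

Definition hamiltonian (g : hpath H) (p : H) : R :=
  inf [set ip p (F g u) + q g u | u in [set: U]].

End control.

(* Main.v *)
Require Import Defs.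
From HB Require Import structures.
From mathcomp Require Import all_boot all_order all_algebra.
From mathcomp Require Import all_classical all_reals all_analysis.
From mathcomp Require Import measurable_realfun ring lra.

Set Implicit Arguments.
Unset Strict Implicit.
Unset Printing Implicit Defensive.

Import Order.TTheory GRing.Theory Num.Theory.
Import numFieldNormedType.Exports.

Local Open Scope classical_set_scope.
Local Open Scope ring_scope.


(** The equation comes from comparing, on a short interval [[t, t + D]], two
    descriptions of the value [V] along the mild solution [X] that starts from
    the path [g] and follows a control [u].

    The dynamic programming principle ([dynamic_programming_le] and
    [dynamic_programming_ge]) says that [V g] is the infimum over [u] of the
    running cost on [[t, t + D]] plus the value at time [t + D].  It rests on
    existence, uniqueness and the flow property of mild solutions, which are
    obtained by Picard iteration in an exponentially weighted norm.

    The expansion [first_order_expansion] says that the increment of [V] from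
    [g] to the path of [X] at time [t + D] is
      [D * (dt V g + (A^* dx V g, g t)) + \int (F (X_r, u r), dx V g) dr],
    with an error at most [eta * D] that is uniform in [u].  Putting a constant
    control into the first inequality and a nearly optimal one into the second,
    dividing by [D], and using that [F] and [q] are Lipschitz while the
    solutions stay at distance [O(D)] of [g] uniformly in [u], gives the two
    inequalities of the equation ([hjb_equation]).

    The expansion is where the unbounded operator [A] matters: [V] is only
    continuous in the path, so [X] must be approximated by step paths of
    vanishing mesh, but [X] has no first-order increments, and [A^* dx V] makes
    sense on continuous paths only.  Both obstacles disappear when [X] is
    replaced by [Y s = k^-1 * \int_0^k S r (X s) dr].  This path is Lipschitz on
    [[t, T]] and continuous, so that [dx V] at its restrictions lies in the domain
    of [A^*]; and since orbit integrals lie in the domain of [A], the identity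
    [(S h z - z, p) = (\int_0^h S r z dr, A^* p)] turns the increments due to the
    semigroup into first-order terms ([averaged_increment]).  For a fixed [k] the
    step approximations of [Y] are treated by mean value inequalities in the time
    and space directions ([step_increment]) and by compactness of the set of
    restrictions of [Y] ([lipschitz_expansion]); then [k] goes to [0].

    Bochner integrals are handled through their scalar products with fixed
    vectors ([bint_ip]), which reduces most of their properties to those of
    Lebesgue integrals. *)

(** * Inner products *)

Section inner_product.
Context {R : realType} {H : completeNormedModType R} (ip : {dot H for idfun}).
Hypothesis ip_norm : forall x : H, ip x x = `|x| ^+ 2.

Lemma ipC x y : ip x y = ip y x.
Proof. by rewrite hermC /= expr0 mul1r. Qed.

Lemma ipDl x y z : ip (x + y) z = ip x z + ip y z.
Proof. by rewrite linearDl. Qed.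

Lemma ipBl x y z : ip (x - y) z = ip x z - ip y z.
Proof. by rewrite linearBl. Qed.

Lemma ipBr x y z : ip z (x - y) = ip z x - ip z y.
Proof. by rewrite linearBr. Qed.

Lemma ipZl a x y : ip (a *: x) y = a * ip x y.
Proof. by rewrite linearZl_LR. Qed.

Lemma ipZr a x y : ip y (a *: x) = a * ip y x.
Proof. by rewrite ipC ipZl ipC. Qed.

Lemma ip0l x : ip 0 x = 0.
Proof. by rewrite linear0l. Qed.

Lemma ip_le x y : `|ip x y| <= `|x| * `|y|.
Proof.
have [->|y0] := eqVneq y 0; first by rewrite normr0 mulr0 ipC ip0l normr0.
have ny : 0 < `|y| ^+ 2 by rewrite exprn_gt0 // normr_gt0.
have := sqr_ge0 `|x - (ip x y / `|y| ^+ 2) *: y|.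
rewrite -ip_norm ipBl !ipBr !ipZl !ipZr !ip_norm (ipC y x).
set n := `|y| ^+ 2; set i := ip x y => h.
have {h} : 0 <= `|x| ^+ 2 - i ^+ 2 / n.
  suff -> : `|x| ^+ 2 - i ^+ 2 / n =
    `|x| ^+ 2 - i / n * i - (i / n * i - i / n * (i / n * n)) by [].
  by rewrite divfK ?gt_eqF//; ring.
rewrite subr_ge0 ler_pdivrMr// => h.
by rewrite -(ler_pXn2r (n := 2)) ?nnegrE ?mulr_ge0// exprMn real_normK ?num_real.
Qed.

Lemma ip_inj x y : (forall z, ip x z = ip y z) -> x = y.
Proof.
move=> h; apply/eqP; rewrite -subr_eq0 -normr_eq0 -sqrf_eq0.
by rewrite -ip_norm ipBl h subrr.
Qed.

Lemma continuous_ip y : continuous (fun x : H => ip x y).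
Proof.
move=> x; apply/(@cvgrPdist_le _ R) => e e0.
have d0 : 0 < e / (`|y| + 1) by rewrite divr_gt0.
near=> z; rewrite -ipBl (le_trans (ip_le _ _))//.
have : `|x - z| <= e / (`|y| + 1).
  by near: z; exact: (@cvgr_dist_le _ _ _ (nbhs x) _ id).
rewrite ler_pdivlMr// => h; apply: le_trans h.
by rewrite ler_wpM2l// lerDl.
Unshelve. all: by end_near. Qed.

End inner_product.

(** * Continuity on intervals, with explicit moduli *)

Section continuous_on.
Context {R : realType} {E : normedModType R}.

(** An explicit form of continuity relative to [D]; all the moduli below are
    extracted in this form. *)
Definition cont_at_on (D : set R) (f : R -> E) (s : R) : Prop :=
  forall e, 0 < e -> exists2 d, 0 < d &
    forall r, D r -> `|r - s| < d -> `|f r - f s| < e.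

Lemma within_contP (D : set R) (f : R -> E) :
  {within D, continuous f} <-> (forall s, D s -> cont_at_on D f s).
Proof.
split=> [cf s Ds e e0|cf].
  have /cvgrPdist_lt /(_ _ e0) := (subspace_continuousP _ _).1 cf _ Ds.
  rewrite near_withinE => -[d /= d0 h].
  exists d => // r Dr rs; rewrite distrC; apply: h => //=.
  by rewrite distrC.
apply/subspace_continuousP => s Ds.
apply/cvgrPdist_lt => e e0.
have [d d0 h] := cf s Ds e e0.
rewrite near_withinE; exists d => //= r /= rs Dr.
by rewrite distrC; apply: h => //; rewrite distrC.
Qed.

End continuous_on.

Lemma within_eq {R : realType} {E : normedModType R} (D : set R) (f g : R -> E) :
  (forall r, D r -> f r = g r) -> {within D, continuous f} ->
  {within D, continuous g}.
Proof.
move=> fg /within_contP cf; apply/within_contP => s Ds e e0.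
have [d d0 hd] := cf s Ds e e0; exists d => // r Dr.
by rewrite -!fg//; exact: hd.
Qed.

(** * Borel measurability *)

Section borel.
Context {R : realType}.

(** The sets with measurable trace of preimage form a sigma-algebra, so the
    open generators suffice. *)
Lemma borel_open {E : topologicalType} (D : set R) (f : R -> E) :
  measurable D -> (forall B, open B -> measurable (D `&` f @^-1` B)) ->
  borel_measurable D f.
Proof.
move=> mD h B sB; apply: (sB [set B | measurable (D `&` f @^-1` B)]).
split => //; split => /=.
- by rewrite preimage_set0 setI0; exact: measurable0.
- move=> A mA; have -> : D `&` f @^-1` (setT `\` A) = D `\` (D `&` f @^-1` A).
    by apply/seteqP; split=> x /= [? ?]; split => //; tauto.
  exact: measurableD.
- move=> A mA; rewrite preimage_bigcup setI_bigcupr.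
  exact: bigcup_measurable.
Qed.

Lemma borel_openP {E : topologicalType} (D : set R) (f : R -> E) B :
  borel_measurable D f -> open B -> measurable (D `&` f @^-1` B).
Proof. by move=> bf oB; apply: bf; exact: sub_sigma_algebra. Qed.

Lemma borel_comp {E E' : topologicalType} (D : set R) (f : R -> E)
    (h : E -> E') :
  measurable D -> borel_measurable D f -> continuous h ->
  borel_measurable D (h \o f).
Proof.
move=> mD bf ch; apply: borel_open => // B oB; rewrite comp_preimage.
by apply: borel_openP => //; exact: open_comp.
Qed.

Lemma borel_subset {E : topologicalType} (D D' : set R) (f : R -> E) :
  measurable D' -> D' `<=` D -> borel_measurable D f -> borel_measurable D' f.
Proof.
move=> mD' sD bf B sB; rewrite -(setIidl sD) -setIA.
by apply: measurableI => //; exact: bf.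
Qed.

Lemma borel_eq {E : topologicalType} (D : set R) (f g : R -> E) :
  {in D, f =1 g} -> borel_measurable D f -> borel_measurable D g.
Proof.
move=> fg bf B sB; have <- : D `&` f @^-1` B = D `&` g @^-1` B; last exact: bf.
by apply/seteqP; split => x /= [Dx]; rewrite fg ?inE.
Qed.

Lemma borel_setU {E : topologicalType} (D D' : set R) (f : R -> E) :
  borel_measurable D f -> borel_measurable D' f ->
  borel_measurable (D `|` D') f.
Proof.
move=> bf bf' B sB; rewrite setIUl.
by apply: measurableU; [exact: bf|exact: bf'].
Qed.

Lemma borel_cst {E : topologicalType} (D : set R) (c : E) :
  measurable D -> borel_measurable D (fun=> c).
Proof.
move=> mD; apply: borel_open => // B _; rewrite preimage_cst.
by case: ifPn => _; rewrite ?setIT ?setI0.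
Qed.

Lemma borel_real (D : set R) (f : R -> R) :
  measurable D -> borel_measurable D f -> measurable_fun D f.
Proof.
move=> mD bf; apply: (measurability _ (measurable_realfun.RGenOpens.measurableE R)).
move=> _ [_ [a [b ->] <-]]; apply: borel_openP => //; exact: interval_open.
Qed.

Lemma borel_normr {E : normedModType R} (D : set R) (f : R -> E) :
  measurable D -> borel_measurable D f -> measurable_fun D (fun x => `|f x|).
Proof.
move=> mD bf; apply: borel_real => //.
by apply: (@borel_comp _ _ _ f (fun y : E => `|y|)) => //; exact: norm_continuous.
Qed.

(** A sum of two Borel functions with values in a general [E] need not be Borel,
    but adding a constant on a measurable set only translates open sets. *)
Lemma borel_add_indic {E : normedModType R} (D A : set R) (f : R -> E) (c : E) :
  measurable D -> measurable A -> borel_measurable D f ->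
  borel_measurable D (fun x => f x + (\1_A x : R) *: c).
Proof.
move=> mD mA bf; apply: borel_open => // B oB.
have -> : D `&` (fun x => f x + (\1_A x : R) *: c) @^-1` B =
    (A `&` (D `&` f @^-1` ((fun y => y + c) @^-1` B))) `|`
    ((D `&` f @^-1` B) `\` A).
  apply/seteqP; split => x /=.
    rewrite indicE; case: (pselect (A x)) => Ax.
      by rewrite mem_set // scale1r; tauto.
    by rewrite memNset // scale0r addr0; tauto.
  rewrite indicE => -[[Ax]|[[Dx Bx] Ax]].
    by rewrite mem_set // scale1r.
  by rewrite memNset // scale0r addr0.
have oB' : open ((fun y : E => y + c) @^-1` B).
  apply: open_comp => // y _; apply: cvgD; [exact: cvg_id|exact: cvg_cst].
by apply: measurableU; [apply: measurableI => //|apply: measurableD => //];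
  exact: borel_openP.
Qed.

(** A point lies in the open set [B] exactly when the approximations eventually
    stay in some [B]-deep set [deep m], the points at distance at least
    [1 / (m + 1)] from the complement of [B]. *)
Lemma borel_limit {E : normedModType R} (D : set R) (fn : nat -> R -> E)
    (f : R -> E) :
  measurable D -> (forall n, borel_measurable D (fn n)) ->
  (forall x, D x -> forall e, 0 < e ->
     exists N, forall n, (N <= n)%N -> `|fn n x - f x| < e) ->
  borel_measurable D f.
Proof.
move=> mD bfn cv; apply: borel_open => // B oB.
pose deep m := [set y : E | forall z, `|y - z| < m.+1%:R^-1 -> B z].
have odeep m : open (~` deep m).
  rewrite openE => y /= /existsNP [z /not_implyP [yz Bz]].
  rewrite /interior; apply/nbhs_ballP; exists (m.+1%:R^-1 - `|y - z|) => /=.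
    by rewrite subr_gt0.
  move=> y'; rewrite -ball_normE /= => yy' /(_ z) dz; apply: Bz; apply: dz.
  rewrite -(subrK y y') -addrA (le_lt_trans (ler_normD _ _))// distrC.
  by move: yy'; rewrite ltrBrDr.
have -> : D `&` f @^-1` B =
    \bigcup_m \bigcup_N \bigcap_n (D `&` fn (N + n)%N @^-1` (deep m)).
  apply/seteqP; split => x /=.
    move=> [Dx Bfx]; have := oB; rewrite openE => /(_ _ Bfx).
    rewrite /interior => /nbhs_ballP [e /= e0 eB].
    have e20 : 0 < e / 2 by rewrite divr_gt0.
    have [m me] : exists m, m.+1%:R^-1 < e / 2.
      have [m _ h] := near_infty_natSinv_lt (PosNum e20).
      by exists m; apply: (h m) => /=.
    have [N hN] := cv x Dx _ e20.
    exists m => //; exists N => // n _; split => // z fz; apply: eB.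
    rewrite -ball_normE /= (splitr e) -(subrK (fn (N + n)%N x) (f x)) -addrA.
    rewrite (le_lt_trans (ler_normD _ _))// ltrD//; last exact: lt_trans me.
    by rewrite distrC; apply: hN; rewrite leq_addr.
  move=> [m _ [N _ h]]; have [Dx _] := h 0%N I; split => //.
  have m0 : 0 < m.+1%:R^-1 :> R by rewrite invr_gt0.
  have [N' hN'] := cv x Dx _ m0.
  have [_] := h N' I; apply; apply: hN'; exact: leq_addl.
apply: bigcup_measurable => m _; apply: bigcup_measurable => N _.
apply: bigcapT_measurable => n.
have -> : D `&` fn (N + n)%N @^-1` deep m =
    D `\` (D `&` fn (N + n)%N @^-1` (~` deep m)).
  apply/seteqP; split => x /= [Dx h]; split => //; first by move=> [_ []].
  by apply: contrapT => h'; apply: h.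
by apply: measurableD => //; exact: borel_openP.
Qed.

(** The first argument of [G] is frozen on the cells of a regular grid; this
    leaves countably many functions [G rho], each of them Borel. *)
Lemma borel_diag {E : normedModType R} (a b : R) (G : R -> R -> E) :
  (forall rho, a <= rho <= b -> borel_measurable `[a, b] (G rho)) ->
  (forall r, a <= r <= b -> cont_at_on `[a, b] (G ^~ r) r) ->
  borel_measurable `[a, b] (fun r => G r r).
Proof.
move=> bG cG; have mD : measurable (`[a, b] : set R) by exact: measurable_itv.
pose cell n r := Num.truncn ((r - a) * n.+1%:R).
pose node n k : R := a + k%:R / n.+1%:R.
have cellP n r : a <= r -> node n (cell n r) <= r < node n (cell n r).+1.
  move=> ar; have /andP[] : (cell n r)%:R <= (r - a) * n.+1%:R < (cell n r).+1%:R.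
    by rewrite /cell truncn_itv // mulr_ge0 // subr_ge0.
  rewrite -ler_pdivrMr // -ltr_pdivlMr // => h1 h2.
  by rewrite /node -lerBrDl h1 -ltrBlDl h2.
have node_ge n k : a <= node n k by rewrite lerDl divr_ge0.
apply: (@borel_limit _ _ (fun n r => G (node n (cell n r)) r)) => //.
  move=> n; apply: borel_open => // B oB.
  pose Q k := if node n k <= b then
    `[node n k, node n k.+1[%classic `&` (`[a, b] `&` G (node n k) @^-1` B)
    else set0.
  have -> : `[a, b] `&` (fun r => G (node n (cell n r)) r) @^-1` B =
      \bigcup_k Q k.
    apply/seteqP; split => r.
      move=> /= [] rab Br; exists (cell n r) => //.
      have /andP[ar rb] : a <= r <= b by move: rab; rewrite in_itv.
      have /andP[h1 h2] := cellP n r ar.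
      rewrite /Q (le_trans h1 rb); split; first by rewrite /= in_itv /= h1 h2.
      by split.
    move=> [k _]; rewrite /Q; case: ifP => // kb [/= kr [rab Br]]; split => //.
    suff -> : cell n r = k by [].
    have /andP[ar rb] : a <= r <= b by move: rab; rewrite in_itv.
    move: kr; rewrite in_itv /= => /andP[k1 k2].
    have ltnode i j : node n i < node n j -> (i < j)%N.
      by rewrite ltrD2l ltr_pM2r ?invr_gt0// ltr_nat.
    have /andP[h1 h2] := cellP n r ar.
    apply/eqP; rewrite eqn_leq -(ltnS (cell n r)) -(ltnS k).
    apply/andP; split; apply: ltnode.
      exact: le_lt_trans k2.
    exact: le_lt_trans h2.
  apply: bigcup_measurable => k _; rewrite /Q; case: ifPn => // kb.
  apply: measurableI; first exact: measurable_itv.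
  have bGk : borel_measurable `[a, b] (G (node n k)).
    by apply: bG; rewrite node_ge kb.
  exact: (borel_openP bGk oB).
move=> r /=; rewrite in_itv /= => rab e e0.
have [d d0 hd] := cG r rab e e0.
have [N _ hN] := near_infty_natSinv_lt (PosNum d0).
exists N => n Nn; have /andP[ar rb] := rab.
have /andP[h1 h2] := cellP n r ar.
apply: hd => /=.
  by rewrite in_itv /= node_ge (le_trans h1 rb).
rewrite distrC ger0_norm ?subr_ge0//; have /= hn := hN n Nn.
apply: le_lt_trans hn.
apply: ltW; rewrite ltrBlDr (lt_le_trans h2)// /node -(natr1 (cell n r)) mulrDl.
by rewrite mul1r addrA addrC.
Qed.

Lemma borel_cont {E : normedModType R} (a b : R) (f : R -> E) :
  (forall r, a <= r <= b -> cont_at_on `[a, b] f r) ->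
  borel_measurable `[a, b] f.
Proof.
move=> cf; apply: (@borel_diag _ a b (fun r _ => f r)) => // rho _.
by apply: borel_cst; exact: measurable_itv.
Qed.

End borel.

(** * Scalar integrals over compact intervals *)

Section scalar_integral.
Context {R : realType}.
Implicit Types (a b c M : R) (g : R -> R).
Local Notation mu := (@lebesgue_measure R).

(** Every integrand met below is bounded on a compact interval, which makes
    integrability automatic. *)
Definition bounded_mfun a b g : Prop :=
  measurable_fun `[a, b] g /\ exists M, forall r, a <= r <= b -> `|g r| <= M.

Lemma mu_itv_fin a b : (mu `[a, b] < +oo)%E.
Proof.
by rewrite lebesgue_measure_itv /=; case: ifPn => // _; rewrite -EFinB ltry.
Qed.

Lemma fine_mu_itv a b : a <= b -> fine (mu `[a, b]) = b - a.
Proof.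
rewrite lebesgue_measure_itv /= lte_fin le_eqVlt => /predU1P[->|->] //.
by rewrite ltxx subrr.
Qed.

Lemma bounded_integrable a b g :
  bounded_mfun a b g -> mu.-integrable `[a, b] (EFin \o g).
Proof.
move=> [mg [M gM]]; apply: measurable_bounded_integrable => //.
- exact: mu_itv_fin.
- exists M; split; first exact: num_real.
  move=> x Mx r /=; rewrite in_itv /= => rab.
  exact: le_trans (gM _ rab) (ltW Mx).
Qed.

Lemma bounded_mfunD a b g h :
  bounded_mfun a b g -> bounded_mfun a b h ->
  bounded_mfun a b (fun r => g r + h r).
Proof.
move=> [mg [M gM]] [mh [N hN]]; split; first exact: measurable_funD.
exists (M + N) => r rab; apply: le_trans (ler_normD _ _) _.
by rewrite lerD ?gM ?hN.
Qed.

Lemma bounded_mfunZ a b k g :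
  bounded_mfun a b g -> bounded_mfun a b (fun r => k * g r).
Proof.
move=> [mg [M gM]]; split; first exact: measurable_funM.
by exists (`|k| * M) => r rab; rewrite normrM ler_wpM2l// gM.
Qed.

Lemma bounded_mfun_cst a b k : bounded_mfun a b (fun=> k).
Proof. by split; [exact: measurable_cst|exists `|k|]. Qed.

Lemma bounded_mfun_norm a b g :
  bounded_mfun a b g -> bounded_mfun a b (fun r => `|g r|).
Proof.
move=> [mg [M gM]]; split; first exact: measurableT_comp.
by exists M => r rab; rewrite normr_id gM.
Qed.

Lemma bounded_mfunB a b g h :
  bounded_mfun a b g -> bounded_mfun a b h ->
  bounded_mfun a b (fun r => g r - h r).
Proof.
move=> bg bh; have := bounded_mfunD bg (bounded_mfunZ (-1) bh).
by under eq_fun do rewrite mulN1r.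
Qed.

Lemma bounded_mfunS a b c d g :
  a <= c -> d <= b -> bounded_mfun a b g -> bounded_mfun c d g.
Proof.
move=> ac db [mg [M gM]]; split.
  apply: measurable_funS mg; first exact: measurable_itv.
  by apply: subset_itv; rewrite bnd_simp.
exists M => r /andP[cr rd]; apply: gM.
by rewrite (le_trans ac cr) (le_trans rd db).
Qed.

Lemma Rint_le a b g h :
  bounded_mfun a b g -> bounded_mfun a b h ->
  (forall r, a <= r <= b -> g r <= h r) ->
  \int[mu]_(r in `[a, b]) g r <= \int[mu]_(r in `[a, b]) h r.
Proof.
move=> bg bh gh; apply: le_Rintegral => //; exact: bounded_integrable.
Qed.

Lemma Rint_cst a b k : a <= b -> \int[mu]_(r in `[a, b]) k = k * (b - a).
Proof.
by move=> ab; rewrite Rintegral_cst ?fine_mu_itv//; exact: measurable_itv.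
Qed.

Lemma Rint_norm_le a b g h :
  bounded_mfun a b g -> bounded_mfun a b h ->
  (forall r, a <= r <= b -> `|g r| <= h r) ->
  `|\int[mu]_(r in `[a, b]) g r| <= \int[mu]_(r in `[a, b]) h r.
Proof.
move=> bg bh gh; apply: le_trans (le_normr_Rintegral _ (bounded_integrable bg)) _ => //.
by apply: Rint_le => //; exact: bounded_mfun_norm.
Qed.

Lemma Rint_norm_le_cst a b g M : a <= b -> bounded_mfun a b g ->
  (forall r, a <= r <= b -> `|g r| <= M) ->
  `|\int[mu]_(r in `[a, b]) g r| <= M * (b - a).
Proof.
move=> ab bg gM; rewrite -Rint_cst//; apply: Rint_norm_le => //.
exact: bounded_mfun_cst.
Qed.

Lemma RintD a b g h : bounded_mfun a b g -> bounded_mfun a b h ->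
  \int[mu]_(r in `[a, b]) (g r + h r) =
  \int[mu]_(r in `[a, b]) g r + \int[mu]_(r in `[a, b]) h r.
Proof. by move=> bg bh; apply: RintegralD => //; exact: bounded_integrable. Qed.

Lemma RintB a b g h : bounded_mfun a b g -> bounded_mfun a b h ->
  \int[mu]_(r in `[a, b]) (g r - h r) =
  \int[mu]_(r in `[a, b]) g r - \int[mu]_(r in `[a, b]) h r.
Proof. by move=> bg bh; apply: RintegralB => //; exact: bounded_integrable. Qed.

Lemma RintZ a b k g : bounded_mfun a b g ->
  \int[mu]_(r in `[a, b]) (k * g r) = k * \int[mu]_(r in `[a, b]) g r.
Proof. by move=> bg; apply: RintegralZl => //; exact: bounded_integrable. Qed.

Lemma Rint_eq a b g h : (forall r, a <= r <= b -> g r = h r) ->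
  \int[mu]_(r in `[a, b]) g r = \int[mu]_(r in `[a, b]) h r.
Proof.
move=> gh; apply: eq_Rintegral => r; rewrite inE /= in_itv /=; exact: gh.
Qed.

Lemma Rint_split a b c g : a <= c <= b -> bounded_mfun a b g ->
  \int[mu]_(r in `[a, b]) g r =
  \int[mu]_(r in `[a, c]) g r + \int[mu]_(r in `[c, b]) g r.
Proof.
move=> /andP[ac cb] bg; have ig := bounded_integrable bg.
rewrite -(@Rintegral_itv_obnd_cbnd _ c); last first.
  by apply: integrableS ig => //; apply: subset_itvr; rewrite bnd_simp.
rewrite -(@Rintegral_itvB _ g (BLeft a) (BRight b) c)// ?bnd_simp//.
by rewrite addrC subrK.
Qed.

Lemma Rint_eq_oc a b g h : bounded_mfun a b g -> bounded_mfun a b h ->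
  (forall r, a < r <= b -> g r = h r) ->
  \int[mu]_(r in `[a, b]) g r = \int[mu]_(r in `[a, b]) h r.
Proof.
move=> bg bh gh; rewrite -!(@Rintegral_itv_obnd_cbnd _ a).
- by apply: eq_Rintegral => r; rewrite inE /= in_itv /=; exact: gh.
- apply: integrableS (bounded_integrable bh) => //.
  by apply: subset_itvr; rewrite bnd_simp.
- apply: integrableS (bounded_integrable bg) => //.
  by apply: subset_itvr; rewrite bnd_simp.
Qed.

Lemma Rint_point a g : \int[mu]_(r in `[a, a]) g r = 0.
Proof. by rewrite set_itv1 Rintegral_set1. Qed.

End scalar_integral.

(** Translation is a substitution, at least for continuous integrands. *)
Lemma Rint_shift {R : realType} (a b k : R) (g : R -> R) : a <= b ->
  {within `[a + k, b + k], continuous g} ->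
  \int[lebesgue_measure]_(r in `[a, b]) g (r + k) =
  \int[lebesgue_measure]_(r in `[a + k, b + k]) g r.
Proof.
move=> ab cg.
have dF (x : R) : is_derive x (1 : R) (fun x : R => x + k) 1.
  have -> : (fun x : R => x + k) = (id + cst k) by [].
  by apply: is_derive_eq; rewrite addr0.
have F'E : derive1 (fun x : R => x + k) = cst 1.
  by apply/funext => x; rewrite derive1E; exact: derive_val.
have cF : continuous (fun x : R => x + k).
  by move=> x; apply: cvgD; [exact: cvg_id|exact: cvg_cst].
rewrite /Rintegral (integration_by_substitution_increasing ab (F := fun x => x + k))//.
- by congr fine; apply: eq_integral => x _ /=; rewrite F'E /= mulr1.
- by move=> x y _ _ xy; rewrite ltrD2r.
- by rewrite F'E => x _; exact: cvg_cst.
- by rewrite F'E; exact: is_cvg_cst.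
- by rewrite F'E; exact: is_cvg_cst.
- split.
  + by move=> x _; exact: ex_derive.
  + by apply: cvg_at_right_filter; exact: cF.
  + by apply: cvg_at_left_filter; exact: cF.
Qed.

Lemma cauchy_seq_cvg {R : realType} {H : completeNormedModType R}
    (v : nat -> H) (e : nat -> R) :
  (forall n m, (n <= m)%N -> `|v n - v m| <= e n) -> e n @[n --> \oo] --> 0 ->
  cvg (v n @[n --> \oo]).
Proof.
move=> hv /cvgrPdist_lt e0; apply/cauchy_cvgP/cauchyP => eps eps0.
have [N _ /(_ N (leqnn _)) /=] := e0 _ eps0.
rewrite sub0r normrN => eN; exists (v N); exists N => // m /= Nm.
rewrite -ball_normE /=; apply: le_lt_trans (hv _ _ Nm) _.
exact: le_lt_trans (ler_norm _) eN.
Qed.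

Lemma le_add_eps {R : realType} (x y : R) :
  (forall e, 0 < e -> x <= y + e) -> x <= y.
Proof. by move=> h; apply/ler_addgt0Pr. Qed.


(** * Bochner integrals of bounded functions over compact intervals *)

Section bochner_theory.
Context {R : realType} {H : completeNormedModType R} (ip : {dot H for idfun}).
Hypothesis ip_norm : forall x : H, ip x x = `|x| ^+ 2.
Hypothesis H_separable : exists2 Q : set H, countable Q & dense Q.
Implicit Types (a b c M : R) (f : R -> H).
Local Notation mu := (@lebesgue_measure R).

Definition bounded_borel a b f : Prop :=
  borel_measurable `[a, b] f /\ exists M, forall r, a <= r <= b -> `|f r| <= M.

Lemma bounded_borel_ip a b f y : bounded_borel a b f ->
  bounded_mfun a b (fun r => ip (f r) y).
Proof.
move=> [bf [M fM]]; split.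
  apply: borel_real; first exact: measurable_itv.
  exact: (borel_comp (measurable_itv _) bf (@continuous_ip _ _ _ ip_norm y)).
exists (M * `|y|) => r rab; apply: le_trans (ip_le ip_norm _ _) _.
by rewrite ler_wpM2r// fM.
Qed.

Lemma bounded_borel_norm a b f : bounded_borel a b f ->
  bounded_mfun a b (fun r => `|f r|).
Proof.
move=> [bf [M fM]]; split; first exact: borel_normr.
by exists M => r rab; rewrite normr_id fM.
Qed.

Lemma simple_fun_cons p s (x : R) :
  simple_fun (p :: s) x = (\1_(p.1) x : R) *: p.2 + simple_fun s x :> H.
Proof. by rewrite /simple_fun big_cons. Qed.

Definition measurable_seq (s : seq (set R * H)) :=
  forall p, p \in s -> measurable p.1.

Lemma measurable_seq_cons p s :
  measurable_seq (p :: s) -> measurable p.1 /\ measurable_seq s.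
Proof.
move=> ms; split=> [|q qs]; first by apply: ms; rewrite inE eqxx.
by apply: ms; rewrite inE qs orbT.
Qed.

Lemma simple_fun_bounded s : exists M, forall x : R, `|simple_fun s x : H| <= M.
Proof.
elim: s => [|p s [M hM]].
  by exists 0 => x; rewrite /simple_fun big_nil normr0.
exists (`|p.2| + M) => x; rewrite simple_fun_cons.
apply: le_trans (ler_normD _ _) _; rewrite lerD// normrZ ler_piMl//.
by rewrite indicE; case: (_ \in _); rewrite ?normr1 ?normr0.
Qed.

Lemma bounded_borel_subsimple a b f s : bounded_borel a b f -> measurable_seq s ->
  bounded_borel a b (fun x => f x - simple_fun s x).
Proof.
move=> [bf [M fM]] ms; split.
  elim: s ms => [_|p s IH /measurable_seq_cons[mp ms]].
    by apply: borel_eq bf => x _; rewrite /simple_fun big_nil subr0.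
  have := borel_add_indic (- p.2) (measurable_itv _) mp (IH ms).
  apply: borel_eq => x _.
  by rewrite simple_fun_cons scalerN opprD addrA [in LHS]addrAC.
have [N hN] := simple_fun_bounded s; exists (M + N) => r rab.
by rewrite (le_trans (ler_normB _ _))// lerD ?fM.
Qed.

Lemma bounded_borel0 a b : bounded_borel a b (fun=> 0).
Proof.
split; first exact: borel_cst.
by exists 0 => r _; rewrite normr0.
Qed.

Lemma bounded_borel_simple a b s : measurable_seq s ->
  bounded_borel a b (simple_fun s).
Proof.
move=> ms; split; last first.
  by have [M hM] := simple_fun_bounded s; exists M => r _.
have [+ _] := bounded_borel_subsimple (bounded_borel0 a b) ms.
have cN : continuous (fun x : H => - x) by move=> x; exact: opp_continuous.
move=> /(borel_comp (measurable_itv _)) => /(_ _ _ cN).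
by apply: borel_eq => x _ /=; rewrite sub0r opprK.
Qed.

Lemma simple_integral_ip a b s y : measurable_seq s ->
  ip (simple_integral `[a, b] s) y = \int[mu]_(x in `[a, b]) ip (simple_fun s x) y.
Proof.
elim: s => [_|p s IH mps].
  rewrite /simple_integral big_nil ip0l.
  rewrite (_ : (fun x => _) = fun=> 0 :> R); last first.
    by apply/funext => x; rewrite /simple_fun big_nil ip0l.
  by rewrite Rintegral_cst ?mul0r//; exact: measurable_itv.
have [mp ms] := measurable_seq_cons mps.
rewrite /simple_integral big_cons ipDl ipZl -/(simple_integral _ _) IH//.
under [RHS]eq_Rintegral do rewrite simple_fun_cons ipDl ipZl mulrC.
have b1 : bounded_mfun a b (fun x => \1_(p.1) x : R).
  split; first exact: measurable_indic.
  exists 1 => r _; rewrite indicE; case: (_ \in _); rewrite ?normr1 ?normr0//.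
rewrite RintD//; last 2 first.
- exact: bounded_mfunZ.
- by apply: bounded_borel_ip; exact: bounded_borel_simple.
rewrite RintZ// mulrC; congr (_ * _ + _).
by rewrite /Rintegral integral_indic//; exact: measurable_itv.
Qed.

(** In a separable space the values of [f] are within [eta] of countably many
    points; the finitely many first ones serve outside a set of small measure,
    where the bound on [f] takes over. *)
Lemma simple_approx a b f (e : R) : bounded_borel a b f -> 0 < e ->
  exists2 s, measurable_seq s &
    \int[mu]_(x in `[a, b]) `|f x - simple_fun s x| <= e.
Proof.
move=> [bf [M0 fM0]] e0.
pose M : R := `|M0|; have Mge0 : 0 <= M by exact: normr_ge0.
have fM r : a <= r <= b -> `|f r| <= M.
  by move=> /fM0 h; apply: le_trans h (ler_norm _).
have mD : measurable (`[a, b]%classic : set R) by exact: measurable_itv.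
have [Q /countable_injP [num numI] dQ] := H_separable.
pose q k := xget 0 [set x | Q x /\ num x = k] : H.
have qnum x : Q x -> q (num x) = x.
  move=> Qx; rewrite /q; case: xgetP => [y -> [Qy yx]|/(_ x)]; last by case.
  by apply: numI; rewrite ?inE.
pose L := fine (mu `[a, b]); have L0 : 0 <= L by exact: fine_ge0.
pose eta : R := e / (2 * (L + 1)).
have eta0 : 0 < eta by rewrite divr_gt0// mulr_gt0// ltr_wpDl.
pose B k := `[a, b] `&` f @^-1` (ball (q k) eta).
have mB k : measurable (B k) by apply: borel_openP => //; exact: ball_open.
have cover x : `[a, b]%classic x -> exists k, B k x.
  move=> Dx; have [y] := dQ _ (ex_intro _ _ (ballxx (f x) eta0)) (ball_open _ _).
  by move=> [fy Qy]; exists (num y); split => //=; rewrite qnum//; exact: ball_sym.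
pose rest N := `[a, b] `\` \big[setU/set0]_(k < N) B k.
have mrest N : measurable (rest N).
  by apply: measurableD => //; exact: bigsetU_measurable.
have rest0 : \bigcap_N rest N = set0.
  apply/seteqP; split => // x h; have [Dx _] := h 0%N I.
  have [k Bk] := cover x Dx; have [_] := h k.+1 I; apply.
  by rewrite big_ord_recr /=; right.
have : mu \o rest @ \oo --> mu (\bigcap_N rest N).
  apply: nonincreasing_cvg_mu => //.
  - rewrite /rest big_ord0 setD0; exact: mu_itv_fin.
  - by rewrite rest0.
  - move=> n m nm; apply/subsetPset; apply: setDS => //.
    exact: subset_bigsetU.
rewrite rest0 measure0 => cvE.
have /cvgrPdist_lt cv0 : fine \o (mu \o rest) @ \oo --> (0 : R) by exact: fine_cvg.
pose eta' : R := e / (2 * (M + 1)).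
have eta'0 : 0 < eta' by rewrite divr_gt0// mulr_gt0// ltr_wpDl.
have [N _ /(_ N (leqnn _)) /=] := cv0 _ eta'0.
rewrite sub0r normrN ger0_norm ?fine_ge0// => muN.
pose A := seqDU B.
have mA k : measurable (A k) by exact: seqDU_measurable.
pose s := [seq (A k, q k) | k <- iota 0 N].
have ms : measurable_seq s by move=> p /mapP [k _ ->]; exact: mA.
exists s => //.
have sE x : simple_fun s x = \sum_(k < N) (\1_(A k) x : R) *: q k.
  by rewrite /simple_fun big_map -{1}(subn0 N) big_mkord.
have fs x : a <= x <= b -> `|f x - simple_fun s x| <= eta + M * \1_(rest N) x.
  move=> xab; have Dx : `[a, b]%classic x by rewrite /= in_itv.
  case: (pselect ((\big[setU/set0]_(k < N) B k) x)) => Ux.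
    rewrite bigsetU_seqDU in Ux; move: Ux; rewrite -bigcup_mkord => -[k /= kN Akx].
    have -> : simple_fun s x = q k.
      rewrite sE (bigD1 (Ordinal kN)) //= big1 ?addr0.
        by rewrite indicE mem_set // scale1r.
      move=> j /eqP jk; rewrite indicE memNset ?scale0r// => Ajx.
      apply: jk; apply: val_inj => /=; apply: (trivIset_seqDU B) => //.
      by exists x.
    rewrite ler_wpDr ?mulr_ge0//; apply: ltW.
    by have [_ /=] := subset_seqDU Akx; rewrite -ball_normE /= distrC.
  have -> : simple_fun s x = 0.
    rewrite sE big1// => k _; rewrite indicE memNset ?scale0r// => Akx.
    by apply: Ux; rewrite bigsetU_seqDU -bigcup_mkord; exists k => /=.
  by rewrite subr0 indicE mem_set ?mulr1 ?ler_wpDl ?fM// ltW.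
have b1 : bounded_mfun a b (fun x => \1_(rest N) x : R).
  split; first exact: measurable_indic.
  by exists 1 => r _; rewrite indicE; case: (_ \in _); rewrite ?normr1 ?normr0.
have bM := bounded_mfunZ M b1; have be := bounded_mfun_cst a b eta.
apply: (@le_trans _ _ (\int[mu]_(x in `[a, b]) (eta + M * \1_(rest N) x))).
  apply: Rint_le fs; last exact: bounded_mfunD.
  by apply: bounded_borel_norm; apply: bounded_borel_subsimple => //; split => //; exists M.
have intc : \int[mu]_(x in `[a, b]) eta = eta * L by exact: Rintegral_cst.
rewrite (RintD be bM) (RintZ M b1) intc [X in M * X](_ : _ = fine (mu (rest N))).
  have h1 : eta * L <= e / 2.
    rewrite /eta mulrAC ler_pdivrMr ?mulr_gt0 ?ltr_wpDl//.
    by rewrite (_ : e / 2 * _ = e * L + e); [rewrite lerDl ltW|field].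
  have h2 : M * fine (mu (rest N)) <= e / 2.
    apply: le_trans (_ : M * eta' <= _); first by rewrite ler_wpM2l// ltW.
    rewrite /eta' mulrCA ler_pM2l// ler_pdivrMr ?mulr_gt0 ?ltr_wpDl//.
    by rewrite (_ : 2^-1 * _ = M + 1); [rewrite lerDl|field].
  by rewrite (splitr e); exact: lerD.
rewrite /Rintegral integral_indic; [|by []|exact: mrest].
by rewrite setIidl //; exact: subDsetl.
Qed.


Definition bint a b f : H := bochner_integral `[a, b] f.

(** Testing against [y] compares the integral of a simple approximation with a
    Lebesgue integral. Both the existence of the Bochner integral and its weak
    characterization follow from this estimate. *)
Lemma simple_integral_err a b f s y : bounded_borel a b f -> measurable_seq s ->
  `|ip (simple_integral `[a, b] s) y - \int[mu]_(x in `[a, b]) ip (f x) y| <=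
  \int[mu]_(x in `[a, b]) `|f x - simple_fun s x| * `|y|.
Proof.
move=> bf ms; rewrite simple_integral_ip // -RintB; last 2 first.
- by apply: bounded_borel_ip => //; exact: bounded_borel_simple.
- exact: bounded_borel_ip.
have bfs := bounded_borel_norm (bounded_borel_subsimple bf ms).
rewrite mulrC -RintZ//; apply: Rint_norm_le.
- apply: bounded_mfunB; last exact: bounded_borel_ip.
  by apply: bounded_borel_ip => //; exact: bounded_borel_simple.
- exact: bounded_mfunZ.
move=> r _; rewrite -ipBl; apply: le_trans (ip_le ip_norm _ _) _.
by rewrite distrC mulrC.
Qed.

(** Testing a vector against itself turns weak bounds into norm bounds. *)
Lemma le_of_ip (v : H) e : 0 <= e -> `|ip v v| <= e * `|v| -> `|v| <= e.
Proof.
move=> e0; rewrite ip_norm normrX normr_id expr2.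
have [->|v0] := eqVneq v 0; first by rewrite normr0.
by rewrite ler_pM2r ?normr_gt0.
Qed.

(** The integrals of two simple approximations are compared through the scalar
    integrals of [f], hence form a Cauchy sequence. *)
Lemma bochner_exists a b f : bounded_borel a b f ->
  exists v, is_bochner_integral `[a, b] f v.
Proof.
move=> bf.
have /choice [s sP] : forall n : nat, exists s, measurable_seq s /\
    \int[mu]_(x in `[a, b]) `|f x - simple_fun s x| <= n.+1%:R^-1.
  move=> n; have n0 : 0 < n.+1%:R^-1 :> R by rewrite invr_gt0.
  by have [s ms hs] := simple_approx bf n0; exists s.
have cn : (fun n : nat => n.+1%:R^-1 + n.+1%:R^-1 : R) @ \oo --> (0 : R).
  by rewrite -[X in _ --> X]addr0; apply: cvgD; exact: cvg_harmonic.
have cs : cvg (simple_integral `[a, b] (s n) @[n --> \oo]).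
  apply: (cauchy_seq_cvg _ cn) => n m nm.
  apply: le_of_ip; first by rewrite addr_ge0.
  set v := _ - _; rewrite {1}/v ipBl.
  rewrite -(subrK (\int[mu]_(x in `[a, b]) ip (f x) v) (ip (simple_integral _ (s n)) v)).
  rewrite -addrA (le_trans (ler_normD _ _))// mulrDl lerD//.
    apply: le_trans (simple_integral_err _ bf (sP n).1) _.
    by rewrite ler_wpM2r// (sP n).2.
  rewrite distrC; apply: le_trans (simple_integral_err _ bf (sP m).1) _.
  rewrite ler_wpM2r// (le_trans (sP m).2)// lef_pV2 ?posrE//.
  by rewrite ler_nat ltnS.
exists (lim (simple_integral `[a, b] (s n) @[n --> \oo])); split; first by case: bf.
exists s; split => //.
  by move=> n; exact: (sP n).1.
have E n : (\int[mu]_(x in `[a, b]) (`|f x - simple_fun (s n) x|)%:E)%E =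
    (\int[mu]_(x in `[a, b]) `|f x - simple_fun (s n) x|)%:E.
  rewrite /Rintegral fineK// integrable_fin_num//.
  apply: bounded_integrable; apply: bounded_borel_norm.
  exact: bounded_borel_subsimple (sP n).1.
under eq_fun do rewrite E.
apply: cvg_EFin; first exact: nearW.
apply: (@squeeze_cvgr _ _ _ _ (fun=> 0) (fun n => n.+1%:R^-1)).
- by apply: nearW => n; rewrite Rintegral_ge0 //= (sP n).2.
- exact: cvg_cst.
- exact: cvg_harmonic.
Qed.

(** The weak characterization of the integral, which also gives uniqueness. *)
Lemma is_bochner_ip a b f v y : bounded_borel a b f ->
  is_bochner_integral `[a, b] f v ->
  ip v y = \int[mu]_(x in `[a, b]) ip (f x) y.
Proof.
move=> bf [_ [s [ms s0 sv]]].
have /fine_cvg s0' : (\int[mu]_(x in `[a, b]) (`|f x - simple_fun (s n) x|)%:E)%E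
  @[n --> \oo] --> (0 : R)%:E by exact: s0.
have c1 : ip (simple_integral `[a, b] (s n)) y @[n --> \oo] --> ip v y.
  exact: (cvg_comp _ _ sv (@continuous_ip _ _ _ ip_norm y v)).
have c2 : ip (simple_integral `[a, b] (s n)) y @[n --> \oo] -->
    \int[mu]_(x in `[a, b]) ip (f x) y.
  apply/cvgrPdist_le => e e0.
  have d0 : 0 < e / (`|y| + 1) by rewrite divr_gt0// ltr_wpDl.
  have /cvgrPdist_le /(_ _ d0) := s0'.
  apply: filterS => n /=; rewrite sub0r normrN => h.
  rewrite distrC; apply: le_trans (simple_integral_err _ bf (ms n)) _.
  move: h; rewrite ler_pdivlMr ?ltr_wpDl// => h; apply: le_trans h.
  apply: le_trans (_ : _ <= `|fine (\int[mu]_(x in `[a, b])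
     (`|f x - simple_fun (s n) x|)%:E)%E| * `|y|) _.
    by rewrite ler_wpM2r// ler_norm.
  by rewrite ler_wpM2l// lerDl.
exact: (cvg_unique _ c1 c2).
Qed.

Lemma bintP a b f : bounded_borel a b f ->
  is_bochner_integral `[a, b] f (bint a b f).
Proof. by move=> /bochner_exists [v hv]; exact: (xgetPex 0 (ex_intro _ v hv)). Qed.

Lemma bochner_integrableP a b f : bounded_borel a b f ->
  bochner_integrable `[a, b] f.
Proof. by move=> bf; exists (bint a b f); exact: bintP. Qed.

Lemma bint_ip a b f y : bounded_borel a b f ->
  ip (bint a b f) y = \int[mu]_(x in `[a, b]) ip (f x) y.
Proof. by move=> bf; apply: is_bochner_ip => //; exact: bintP. Qed.

Lemma bint_norm_le a b f (g : R -> R) : bounded_borel a b f ->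
  bounded_mfun a b g -> (forall r, a <= r <= b -> `|f r| <= g r) ->
  `|bint a b f| <= \int[mu]_(x in `[a, b]) g x.
Proof.
move=> bf bg fg; set v := bint a b f.
have g0 : 0 <= \int[mu]_(x in `[a, b]) g x.
  apply: Rintegral_ge0 => x /=; rewrite in_itv /= => xab.
  exact: le_trans (fg _ xab).
apply: le_of_ip => //; rewrite [in ip _ _]/v bint_ip// mulrC -RintZ//.
apply: Rint_norm_le; [exact: bounded_borel_ip|exact: bounded_mfunZ|].
move=> r rab; apply: le_trans (ip_le ip_norm _ _) _.
by rewrite mulrC ler_wpM2l// fg.
Qed.

Lemma bint_norm_le_cst a b f M : a <= b -> bounded_borel a b f ->
  (forall r, a <= r <= b -> `|f r| <= M) -> `|bint a b f| <= M * (b - a).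
Proof.
move=> ab bf fM; rewrite -Rint_cst//; apply: bint_norm_le => //.
exact: bounded_mfun_cst.
Qed.

Lemma bint_eq a b f g : (forall r, a <= r <= b -> f r = g r) ->
  bounded_borel a b f -> bint a b f = bint a b g.
Proof.
move=> fg bf; have bg : bounded_borel a b g.
  case: bf => bf [M fM]; split.
    by apply: borel_eq bf => x; rewrite inE /= in_itv /=; exact: fg.
  by exists M => r rab; rewrite -fg// fM.
by apply: (ip_inj ip_norm) => y; rewrite !bint_ip//; apply: Rint_eq => r /fg ->.
Qed.

Lemma bint_eq_oc a b f g : bounded_borel a b f -> bounded_borel a b g ->
  (forall r, a < r <= b -> f r = g r) -> bint a b f = bint a b g.
Proof.
move=> bf bg fg; apply: (ip_inj ip_norm) => y; rewrite !bint_ip//.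
apply: Rint_eq_oc; [exact: bounded_borel_ip|exact: bounded_borel_ip|].
by move=> r /fg ->.
Qed.

Lemma bounded_borelS a b c d f : a <= c -> d <= b ->
  bounded_borel a b f -> bounded_borel c d f.
Proof.
move=> ac db [bf [M fM]]; split.
  apply: borel_subset bf; first exact: measurable_itv.
  by apply: subset_itv; rewrite bnd_simp.
by exists M => r /andP[cr rd]; apply: fM; rewrite (le_trans ac cr) (le_trans rd).
Qed.

Lemma bint_split a b c f : a <= c <= b -> bounded_borel a b f ->
  bint a b f = bint a c f + bint c b f.
Proof.
move=> acb bf; have /andP[ac cb] := acb.
apply: (ip_inj ip_norm) => y; rewrite ipDl !bint_ip//.
- by rewrite (Rint_split acb)//; exact: bounded_borel_ip.
- exact: bounded_borelS bf.
- exact: bounded_borelS bf.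
Qed.

Lemma bint_point a f : bounded_borel a a f -> bint a a f = 0.
Proof.
by move=> bf; apply: (ip_inj ip_norm) => y; rewrite bint_ip// Rint_point ip0l.
Qed.

Lemma bint_cst a b (c : H) : a <= b -> bint a b (fun=> c) = (b - a) *: c.
Proof.
move=> ab; apply: (ip_inj ip_norm) => y; rewrite bint_ip.
  by rewrite Rint_cst// ipZl mulrC.
by split; [exact: borel_cst|exists `|c|].
Qed.

Lemma bounded_borel_comp a b f (K : {linear H -> H}) :
  (forall x, `|K x| <= `|x|) -> bounded_borel a b f ->
  bounded_borel a b (fun r => K (f r)).
Proof.
move=> Kx [bf [M fM]]; split; last first.
  by exists M => r rab; apply: le_trans (Kx _) _; exact: fM.
have cK : continuous K.
  move=> x; apply/(@cvgrPdist_lt _ H) => e e0; apply/nbhs_ballP; exists e => //= y.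
  by rewrite -ball_normE /= -linearB; exact: le_lt_trans.
exact: (borel_comp (measurable_itv _) bf cK).
Qed.

Lemma simple_integral_comp a b s (K : {linear H -> H}) :
  K (simple_integral `[a, b] s) =
  simple_integral `[a, b] [seq (p.1, K p.2) | p <- s].
Proof.
rewrite /simple_integral big_map linear_sum /=.
by apply: eq_bigr => p _; rewrite linearZ_LR.
Qed.

Lemma simple_fun_comp s (K : {linear H -> H}) (x : R) :
  K (simple_fun s x) = simple_fun [seq (p.1, K p.2) | p <- s] x.
Proof.
rewrite /simple_fun big_map linear_sum /=.
by apply: eq_bigr => p _; rewrite linearZ_LR.
Qed.

(** In weak form this would require the adjoint of [K]; instead the integral is
    moved through [K] at the level of simple functions. *)
Lemma bint_comp a b f (K : {linear H -> H}) :
  (forall x, `|K x| <= `|x|) -> bounded_borel a b f ->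
  bint a b (fun r => K (f r)) = K (bint a b f).
Proof.
move=> Kx bf; have bKf := bounded_borel_comp Kx bf.
apply/eqP; rewrite -subr_eq0 -normr_le0; apply: le_add_eps => e e0.
have e20 : 0 < e / 2 by rewrite divr_gt0.
have [s ms hs] := simple_approx bf e20.
have err g s' : bounded_borel a b g -> measurable_seq s' ->
    \int[mu]_(x in `[a, b]) `|g x - simple_fun s' x| <= e / 2 ->
    `|bint a b g - simple_integral `[a, b] s'| <= e / 2.
  move=> bg ms' h; apply: le_of_ip; first exact: ltW.
  set v := (X in ip X); rewrite {1}/v ipBl bint_ip// distrC.
  apply: le_trans (simple_integral_err _ bg ms') _.
  by rewrite ler_wpM2r.
set s' := [seq (p.1, K p.2) | p <- s].
have ms' : measurable_seq s' by move=> p /mapP [p' /ms mp' ->].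
have h1 := err _ _ bf ms hs.
have h2 : `|bint a b (fun r => K (f r)) - simple_integral `[a, b] s'| <= e / 2.
  apply: err => //; apply: le_trans hs; apply: Rint_le.
  - by apply: bounded_borel_norm; exact: bounded_borel_subsimple.
  - by apply: bounded_borel_norm; exact: bounded_borel_subsimple.
  - by move=> r _; rewrite -simple_fun_comp -linearB.
rewrite add0r (splitr e).
rewrite -(subrK (simple_integral `[a, b] s') (bint a b (fun r => K (f r)))) -addrA.
rewrite (le_trans (ler_normD _ _))// lerD//.
by rewrite -simple_integral_comp -linearB (le_trans (Kx _))// distrC.
Qed.



Lemma bintB_le a b f g (h : R -> R) : bounded_borel a b f -> bounded_borel a b g ->
  bounded_mfun a b h -> (forall r, a <= r <= b -> `|f r - g r| <= h r) ->
  `|bint a b f - bint a b g| <= \int[mu]_(x in `[a, b]) h x.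
Proof.
move=> bf bg bh fg.
have h0 : 0 <= \int[mu]_(x in `[a, b]) h x.
  apply: Rintegral_ge0 => x /=; rewrite in_itv /= => xab.
  exact: le_trans (fg _ xab).
apply: le_of_ip => //; set v := (X in ip X); rewrite {1}/v ipBl !bint_ip//.
have [? ?] := (bounded_borel_ip v bf, bounded_borel_ip v bg).
rewrite -RintB// mulrC -RintZ//; apply: Rint_norm_le.
- exact: bounded_mfunB.
- exact: bounded_mfunZ.
move=> r rab; rewrite -ipBl (le_trans (ip_le ip_norm _ _))// mulrC.
by rewrite ler_wpM2l// fg.
Qed.

End bochner_theory.

(** * Contraction semigroups *)

Section semigroup_theory.
Context {R : realType} {H : completeNormedModType R} (ip : {dot H for idfun}).
Hypothesis ip_norm : forall x : H, ip x x = `|x| ^+ 2.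
Hypothesis H_separable : exists2 Q : set H, countable Q & dense Q.
Context (S : R -> {linear H -> H}).
Hypothesis hS : contraction_semigroup S.
Implicit Types (a b h k r s e : R) (x y z w : H).
Local Notation mu := (@lebesgue_measure R).

Lemma semigroup0 x : S 0 x = x. Proof. by case: hS => -[]. Qed.

Lemma semigroupD s t x : 0 <= s -> 0 <= t -> S (s + t) x = S s (S t x).
Proof. by case: hS => -[_ _ + _ _]; apply. Qed.

Lemma semigroupC s t x : 0 <= s -> 0 <= t -> S s (S t x) = S t (S s x).
Proof. by move=> s0 t0; rewrite -!semigroupD// addrC. Qed.

Lemma semigroup_le t x : 0 <= t -> `|S t x| <= `|x|.
Proof. by case: hS => _; apply. Qed.

Lemma semigroup_near0 x e : 0 < e ->
  exists2 d, 0 < d & forall t, 0 <= t < d -> `|S t x - x| < e.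
Proof.
move=> e0; case: hS => -[_ _ _ /(_ x) /cvgrPdist_lt /(_ _ e0)] + _.
rewrite near_withinE => -[d /= d0 h]; exists d => // t /andP[].
rewrite le_eqVlt => /predU1P[<- _|t0 td]; first by rewrite semigroup0 subrr normr0.
rewrite distrC; apply: h => //=.
by rewrite sub0r normrN gtr0_norm.
Qed.

Lemma orbit_lipschitz z r s : 0 <= r -> 0 <= s ->
  `|S s z - S r z| <= `|S `|s - r| z - z|.
Proof.
move=> r0 s0; wlog rs : r s r0 s0 / r <= s => [hw|].
  have [|/ltW sr] := leP r s; first exact: hw.
  by rewrite distrC (distrC s); exact: hw.
rewrite (ger0_norm (_ : 0 <= s - r)) ?subr_ge0//.
have -> : S s z = S r (S (s - r) z).
  by rewrite -semigroupD ?subr_ge0// addrC subrK.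
by rewrite -linearB; exact: semigroup_le.
Qed.

Lemma orbit_cont z r e : 0 <= r -> 0 < e -> exists2 d, 0 < d &
  forall s, 0 <= s -> `|s - r| < d -> `|S s z - S r z| < e.
Proof.
move=> r0 e0; have [d d0 hd] := semigroup_near0 z e0.
exists d => // s s0 sr; apply: le_lt_trans (orbit_lipschitz _ r0 s0) _.
by apply: hd; rewrite normr_ge0.
Qed.

Lemma orbit_cont_at_on a b z r : 0 <= a -> a <= r <= b ->
  cont_at_on `[a, b] (fun r => S r z) r.
Proof.
move=> a0 /andP[ar rb] e e0; have [d d0 hd] := orbit_cont z (le_trans a0 ar) e0.
exists d => // s; rewrite /= in_itv /= => /andP[sa _]; apply: hd.
exact: le_trans sa.
Qed.

Lemma orbit_bounded_borel a b z : 0 <= a -> bounded_borel a b (fun r => S r z).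
Proof.
move=> a0; split; first by apply: borel_cont => r; exact: orbit_cont_at_on.
by exists `|z| => r /andP[ar _]; apply: semigroup_le; exact: le_trans ar.
Qed.

(** Freezing the time in the semigroup leaves a continuous function of [f r]. *)
Lemma convolution_bounded_borel a b s (f : R -> H) : b <= s ->
  bounded_borel a b f -> bounded_borel a b (fun r => S (s - r) (f r)).
Proof.
move=> bs [bf [M fM]]; split; last first.
  exists M => r rab; have /andP[_ rb] := rab.
  apply: le_trans (fM _ rab); apply: semigroup_le.
  by rewrite subr_ge0 (le_trans rb).
apply: (borel_diag (G := fun rho r => S (s - rho) (f r))).
  move=> rho /andP[_ rhob]; have srho : 0 <= s - rho.
    by rewrite subr_ge0 (le_trans rhob).
  have cS : continuous (S (s - rho)) by case: hS => -[+ _ _ _ _]; apply.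
  exact: (borel_comp (measurable_itv _) bf cS).
move=> r /andP[_ rb] e e0; have sr : 0 <= s - r by rewrite subr_ge0 (le_trans rb).
have [d d0 hd] := orbit_cont (f r) sr e0.
exists d => // r'; rewrite /= in_itv /= => /andP[_ r'b] rr'; apply: hd.
  by rewrite subr_ge0 (le_trans r'b).
by rewrite opprB addrC addrA subrK distrC.
Qed.

Definition orbit_int h z : H := bint 0 h (fun r => S r z).



Lemma orbit_int_near h z w e : 0 <= h ->
  (forall r, 0 <= r <= h -> `|S r z - w| <= e) ->
  `|orbit_int h z - h *: w| <= h * e.
Proof.
move=> h0 he; have -> : h *: w = bint 0 h (fun=> w).
  by rewrite (bint_cst ip_norm H_separable)// subr0.
apply: le_trans (_ : _ <= \int[mu]_(r in `[0, h]) e) _; last first.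
  by rewrite Rint_cst// subr0 mulrC.
apply: (bintB_le ip_norm H_separable) => //.
- by apply: orbit_bounded_borel.
- by split; [exact: borel_cst|exists `|w|].
- exact: bounded_mfun_cst.
Qed.

Lemma orbit_int_le h z : 0 <= h -> `|orbit_int h z| <= h * `|z|.
Proof.
move=> h0; have := @orbit_int_near h z 0 `|z| h0.
rewrite scaler0 subr0; apply => r /andP[r0 _]; rewrite subr0.
exact: semigroup_le.
Qed.

Lemma orbit_intB h x y : orbit_int h (x - y) = orbit_int h x - orbit_int h y.
Proof.
apply: (ip_inj ip_norm) => z; rewrite ipBl.
have bo w : bounded_borel 0 h (fun r => S r w) by exact: orbit_bounded_borel.
rewrite /orbit_int (bint_ip ip_norm H_separable z (bo (x - y))).
rewrite (bint_ip ip_norm H_separable z (bo x)).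
rewrite (bint_ip ip_norm H_separable z (bo y)).
rewrite -RintB; last 2 first.
- exact: bounded_borel_ip.
- exact: bounded_borel_ip.
by apply: Rint_eq => r _; rewrite linearB ipBl.
Qed.

Lemma orbit_intC h k z : 0 <= k -> S k (orbit_int h z) = orbit_int h (S k z).
Proof.
move=> k0; rewrite /orbit_int -(bint_comp ip_norm H_separable).
- apply: (bint_eq ip_norm H_separable) => [r /andP[r0 _]|].
    by rewrite semigroupC.
  apply: bounded_borel_comp; first by move=> x; exact: semigroup_le.
  exact: orbit_bounded_borel.
- by move=> x; exact: semigroup_le.
- exact: orbit_bounded_borel.
Qed.

Lemma orbit_int_shift h k z : 0 <= h -> 0 <= k ->
  S k (orbit_int h z) = orbit_int (h + k) z - orbit_int k z.
Proof.
move=> h0 k0; have bo a b : 0 <= a -> bounded_borel a b (fun r => S r z).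
  exact: orbit_bounded_borel.
have -> : orbit_int (h + k) z - orbit_int k z = bint k (h + k) (fun r => S r z).
  rewrite /orbit_int (bint_split ip_norm H_separable (c := k)).
  - by rewrite addrC addKr.
  - by rewrite k0 lerDr.
  - exact: bo.
rewrite (orbit_intC h z k0); apply: (ip_inj ip_norm) => y.
rewrite !(bint_ip ip_norm H_separable); [|exact: orbit_bounded_borel|exact: bo].
rewrite -{2}(add0r k) -(Rint_shift (k := k) (g := fun r => ip (S r z) y))//.
  apply: Rint_eq => r /andP[r0 _]; by rewrite semigroupD.
rewrite add0r; apply/within_contP => r /=; rewrite in_itv /= => rab e e0.
have y0 : 0 < e / (`|y| + 1) by rewrite divr_gt0// ltr_wpDl.
have [d d0 hd] := @orbit_cont_at_on k (h + k) z r k0 rab _ y0.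
exists d => // s ss /(hd _ ss); rewrite ltr_pdivlMr ?ltr_wpDl//.
move=> lt_e; rewrite -ipBl (le_lt_trans (ip_le ip_norm _ _))//.
by apply: le_lt_trans lt_e; rewrite ler_wpM2l// lerDl.
Qed.

Opaque orbit_int.

(** Both sides are the integral of the orbit over [[0, h + k]] minus those over
    [[0, h]] and [[0, k]]. This symmetry differentiates orbit integrals and bounds
    the increments of averaged orbits. *)
Lemma orbit_int_swap h k z : 0 <= h -> 0 <= k ->
  S k (orbit_int h z) - orbit_int h z = S h (orbit_int k z) - orbit_int k z.
Proof.
move=> h0 k0.
rewrite (orbit_int_shift z h0 k0).
rewrite (orbit_int_shift z k0 h0).
by rewrite (addrC k h) addrAC.
Qed.

(** Averaging over [[0, e]] smooths: the averages lie in the domain of the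
    generator, and the increments of an averaged orbit are of first order. *)
Definition average e z : H := e^-1 *: orbit_int e z.

Lemma average_near e z w d : 0 < e ->
  (forall r, 0 <= r <= e -> `|S r z - w| <= d) -> `|average e z - w| <= d.
Proof.
move=> e0 hd; have -> : average e z - w = e^-1 *: (orbit_int e z - e *: w).
  by rewrite scalerBr scalerA mulVf ?gt_eqF// scale1r.
rewrite normrZ normfV gtr0_norm// ler_pdivrMl//.
exact: orbit_int_near (ltW e0) hd.
Qed.

Lemma average_le e z : 0 < e -> `|average e z| <= `|z|.
Proof.
move=> e0; have := @average_near e z 0 `|z| e0.
rewrite subr0; apply => r /andP[r0 _]; rewrite subr0; exact: semigroup_le.
Qed.

Lemma averageB e x y : average e (x - y) = average e x - average e y.
Proof. by rewrite /average orbit_intB scalerBr. Qed.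

Lemma averageD e x y : average e (x + y) = average e x + average e y.
Proof.
have E := averageB e (x + y) y; rewrite addrK in E.
by rewrite E subrK.
Qed.

Lemma averageC e k z : 0 <= k -> S k (average e z) = average e (S k z).
Proof. by move=> k0; rewrite /average linearZ_LR orbit_intC. Qed.

Lemma average_increment e h z : 0 < e -> 0 <= h ->
  `|average e (S h z - z)| <= 2 * h / e * `|z|.
Proof.
move=> e0 h0; rewrite averageB -(averageC e z h0) /average linearZ_LR -scalerBr.
rewrite (orbit_int_swap z (ltW e0) h0) normrZ normfV gtr0_norm// [leRHS]mulrAC mulrC.
rewrite ler_pM2r ?invr_gt0//; apply: le_trans (ler_normB _ _) _.
rewrite -mulrA mulr2n mulrDl !mul1r lerD//; last exact: orbit_int_le.
by apply: le_trans (semigroup_le _ (ltW e0)) _; exact: orbit_int_le.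
Qed.

Lemma average_near0 z d : 0 < d -> exists2 r0, 0 < r0 &
  forall e, 0 < e < r0 -> `|average e z - z| <= d.
Proof.
move=> d0; have [r0 r00 hr] := semigroup_near0 z d0.
exists r0 => // e /andP[e0 er]; apply: average_near => // r /andP[? re].
by apply/ltW/hr; rewrite (le_lt_trans re er) andbT.
Qed.

Context (domA : set H) (A : H -> H).
Hypothesis AS : generates domA A S.

(** By [orbit_int_swap] the difference quotient at [k] of the orbit integral is
    [S h m - m] for the average [m] of the orbit over [[0, k]], which tends to
    [z]. *)
Lemma orbit_int_generator h z : 0 <= h ->
  domA (orbit_int h z) /\ A (orbit_int h z) = S h z - z.
Proof.
move=> h0; apply/AS; apply/cvgrPdist_le => e e0.
have e20 : 0 < e / 2 by rewrite divr_gt0.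
have [r0 r00 hr] := average_near0 z e20.
near=> k.
have k0 : 0 < k by near: k; exact: nbhs_right_gt.
have kr : k < r0 by near: k; exact: nbhs_right_lt.
rewrite (orbit_int_swap z h0 (ltW k0)) scalerBr -linearZ_LR -/(average k z).
have kk : `|average k z - z| <= e / 2 by apply: hr; rewrite k0.
have -> : S h z - z - (S h (average k z) - average k z) =
    S h (z - average k z) + (average k z - z).
  by rewrite [S h (z - _)]linearB opprB addrACA [RHS]addrACA (addrC (- z)).
rewrite (splitr e) (le_trans (ler_normD _ _))// lerD//.
by rewrite (le_trans (semigroup_le _ h0))// distrC.
Unshelve. all: by end_near. Qed.

Local Notation adj := (adjoint ip domA A).

Lemma adjointP p : adjoint_dom ip domA A p -> is_adjoint ip domA A p (adj p).
Proof. by move=> [q hq]; exact: (xgetPex 0 (ex_intro _ q hq)). Qed.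

(** The generator is applied to an orbit integral, which lies in its domain for
    every [z]; this is what gives a meaning to [A z] tested against [p]. *)
Lemma adjoint_increment p h z : adjoint_dom ip domA A p -> 0 <= h ->
  ip (S h z - z) p = ip (orbit_int h z) (adj p).
Proof.
move=> /adjointP hp h0; have [dz Az] := orbit_int_generator z h0.
by rewrite -Az hp.
Qed.

Lemma adjoint_increment_le p h z : adjoint_dom ip domA A p -> 0 <= h ->
  `|ip (S h z - z) p| <= h * (`|z| * `|adj p|).
Proof.
move=> hp h0; rewrite adjoint_increment// (le_trans (ip_le ip_norm _ _))//.
by rewrite mulrA ler_wpM2r// orbit_int_le.
Qed.

Lemma adjoint_average_le p e z : adjoint_dom ip domA A p -> 0 < e ->
  `|ip (average e z - z) p| <= e * (`|z| * `|adj p|).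
Proof.
move=> hp e0; set M := `|z| * _.
have -> : average e z - z = e^-1 *: (orbit_int e z - e *: z).
  by rewrite scalerBr scalerA mulVf ?gt_eqF// scale1r.
rewrite ipZl ipBl ipZl (bint_ip ip_norm H_separable); last first.
  exact: orbit_bounded_borel.
have bo : bounded_mfun 0 e (fun r => ip (S r z) p).
  by apply: bounded_borel_ip => //; exact: orbit_bounded_borel.
have E : e * ip z p = \int[mu]_(r in `[0, e]) ip z p.
  by rewrite Rint_cst ?(ltW e0)// subr0 mulrC.
have bc : bounded_mfun 0 e (fun=> ip z p) by exact: bounded_mfun_cst.
rewrite E -(RintB bo bc) normrM normfV (gtr0_norm e0) ler_pdivrMl//.
apply: le_trans (Rint_norm_le_cst (M := e * M) (ltW e0) _ _) _.
- exact: bounded_mfunB.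
- move=> r /andP[r0 re]; rewrite -ipBl (le_trans (adjoint_increment_le _ hp r0))//.
  by rewrite ler_wpM2r// mulr_ge0.
- by rewrite subr0 mulrC.
Qed.

End semigroup_theory.

(** * Functions with a right derivative *)

(** Continuous induction: the inequality, with slope [K + kap], propagates to
    the right of the largest point up to which it holds. *)
Lemma right_mean_value {R : realType} (f : R -> R) (a b K : R) : a <= b ->
  (forall x, a <= x <= b -> cont_at_on `[a, b] f x) ->
  (forall x, a <= x < b -> forall kap, 0 < kap -> exists2 d, 0 < d &
     forall h, 0 < h < d -> f (x + h) - f x <= (K + kap) * h) ->
  f b - f a <= K * (b - a).
Proof.
move=> ab cf df; apply: le_add_eps => eps eps0.
pose kap := eps / (b - a + 1).
have kap0 : 0 < kap by rewrite divr_gt0// ltr_wpDl// subr_ge0.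
suff h : f b - f a <= (K + kap) * (b - a).
  apply: le_trans h _; rewrite mulrDl lerD2l /kap mulrAC ler_pdivrMr.
    by rewrite ler_pM2l// lerDl.
  by rewrite ltr_wpDl// subr_ge0.
pose good x := forall y, a <= y <= x -> f y - f a <= (K + kap) * (y - a).
pose E := [set x | a <= x <= b /\ good x].
have Ea : E a.
  split; first by rewrite lexx.
  by move=> y; rewrite -eq_le => /eqP <-; rewrite !subrr mulr0.
have supE : has_sup E.
  by split; [exists a|exists b => x [/andP[]]].
pose c := sup E.
have ac : a <= c by apply: ub_le_sup => //; case: supE.
have cb : c <= b by apply: ge_sup; [exists a|move=> x [/andP[]]].
have lt_good y : a <= y -> y < c -> f y - f a <= (K + kap) * (y - a).
  move=> ay yc; have d0 : 0 < c - y by rewrite subr_gt0.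
  have [x [_ gx] cx] := sup_adherent d0 supE.
  by apply: gx; rewrite ay ltW//; move: cx; rewrite -/c opprB addrC subrK.
have Ec : E c.
  split; first by rewrite ac.
  move=> y /andP[ay]; rewrite le_eqVlt => /predU1P[->|]; last exact: lt_good.
  have [<-|ac'] := eqVneq a c; first by rewrite !subrr mulr0.
  have {}ac' : a < c by rewrite lt_neqAle ac'.
  apply: le_add_eps => e e0; have e20 : 0 < e / 2 by rewrite divr_gt0.
  have acb : a <= c <= b by rewrite ac.
  have [d d0 hd] := cf c acb _ e20.
  pose d' := e / 2 / (`|K + kap| + 1).
  have d'0 : 0 < d' by rewrite divr_gt0// ltr_wpDl.
  pose m := Num.min d (Num.min d' (c - a)).
  have m0 : 0 < m by rewrite !lt_min d0 d'0 subr_gt0.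
  have [md md' mc] : [/\ m <= d, m <= d' & m <= c - a].
    by split; rewrite !ge_min lexx ?orbT.
  pose z := c - m / 2; have m20 : 0 < m / 2 by rewrite divr_gt0.
  have m2 : m / 2 < m by rewrite ltr_pdivrMr// ltr_pMr// ltr1n.
  have zc : z < c by rewrite ltrBlDr ltrDl.
  have az : a <= z by move: m2 mc; rewrite /z; lra.
  have cz : `|z - c| = m / 2.
    by rewrite distrC /z opprB addrC subrK gtr0_norm.
  have fz : `|f z - f c| < e / 2.
    apply: hd; first by rewrite /= in_itv /= az (le_trans (ltW zc)).
    by rewrite cz (lt_le_trans m2).
  have gz := lt_good z az zc.
  have slope : (K + kap) * (z - a) <= (K + kap) * (c - a) + e / 2.
    rewrite -lerBlDl -mulrBr (le_trans (ler_norm _))// normrM opprB addrA subrK cz.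
    rewrite (le_trans (_ : _ <= (`|K + kap| + 1) * d'))//.
      by rewrite ler_pM ?lerDl// ?(ltW m20)// (le_trans (ltW m2)).
    by rewrite mulrC divfK// gt_eqF// ltr_wpDl.
  have := ler_norm (f c - f z); rewrite distrC => fcz.
  by move: fz gz slope fcz; lra.
have [cb'|bc] := ltP c b; last first.
  have <- : c = b by apply/eqP; rewrite eq_le cb.
  by case: Ec => _; apply; rewrite ac lexx.
have acb : a <= c < b by rewrite ac.
have [d d0 hd] := df c acb _ kap0.
pose m := Num.min d (b - c); have m0 : 0 < m by rewrite lt_min d0 subr_gt0.
have [md mb] : m <= d /\ m <= b - c by split; rewrite !ge_min lexx ?orbT.
pose z := c + m / 2; have m20 : 0 < m / 2 by rewrite divr_gt0.
have m2 : m / 2 < m by rewrite ltr_pdivrMr// ltr_pMr// ltr1n.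
have Ez : E z.
  split.
    rewrite (le_trans ac) ?lerDl ?(ltW m20)//= -lerBrDl.
    exact: le_trans (ltW m2) mb.
  move=> y /andP[ay yz]; have [yc|cy] := leP y c.
    by case: Ec => _; apply; rewrite ay.
  have h1 : f y - f c <= (K + kap) * (y - c).
    have := hd (y - c); rewrite (addrC c (y - c)) subrK; apply; rewrite subr_gt0 cy /=.
    rewrite ltrBlDl (le_lt_trans yz)// /z ltrD2l; exact: lt_le_trans m2 md.
  have h2 : f c - f a <= (K + kap) * (c - a).
    by case: Ec => _; apply; rewrite ac lexx.
  by move: h1 h2; lra.
have : z <= c by apply: ub_le_sup => //; case: supE.
by rewrite gerDl leNgt m20.
Qed.

Lemma right_mean_value_abs {R : realType} (f : R -> R) (a b k e : R) : a <= b ->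
  (forall x, a <= x <= b -> cont_at_on `[a, b] f x) ->
  (forall x, a <= x < b -> forall kap, 0 < kap -> exists2 d, 0 < d &
     forall h, 0 < h < d -> `|f (x + h) - f x - k * h| <= (e + kap) * h) ->
  `|f b - f a - k * (b - a)| <= e * (b - a).
Proof.
move=> ab cf df; rewrite ler_norml; apply/andP; split; last first.
  rewrite lerBlDr -mulrDl; apply: right_mean_value => // x xab kap kap0.
  have [d d0 hd] := df x xab kap kap0; exists d => // h /hd.
  by rewrite ler_norml => /andP[_]; rewrite lerBlDr -mulrDl addrAC.
rewrite lerNl; have -> : - (f b - f a - k * (b - a)) =
    (- f b - - f a) + k * (b - a) by ring.
rewrite -lerBrDr -mulrBl; apply: (@right_mean_value _ (fun x => - f x)) => //.
  move=> x xab e' e'0; have [d d0 hd] := cf x xab e' e'0.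
  by exists d => // y Dy /(hd y Dy); rewrite -opprD normrN.
move=> x xab kap kap0; have [d d0 hd] := df x xab kap kap0.
exists d => // h /hd; rewrite ler_norml => /andP[+ _].
by lra.
Qed.

(** * The path space and its metric *)

Section path_space.
Context {R : realType} {H : completeNormedModType R}.
Implicit Types (g : hpath H) (X : R -> H) (r s t T : R).

Lemma hpath_eq g g' : ptime g = ptime g' -> (forall s, g s = g' s) -> g = g'.
Proof.
by case: g g' => [t f] [t' f'] /= -> ff'; congr Path; exact/funext.
Qed.

Lemma mkpathE t X s : 0 <= s <= t -> mkpath t X s = X s.
Proof. by rewrite /mkpath /= => ->. Qed.

Lemma mkpathNE t X s : ~~ (0 <= s <= t) -> mkpath t X s = 0.
Proof. by rewrite /mkpath /= => /negbTE ->. Qed.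

Lemma mkpath_eq t X g : ptime g = t -> (forall s, 0 <= s <= t -> X s = g s) ->
  (forall s, ~~ (0 <= s <= t) -> g s = 0) -> mkpath t X = g.
Proof.
move=> gt Xg g0; apply: hpath_eq => // s; have [st|st] := boolP (0 <= s <= t).
  by rewrite mkpathE// Xg.
by rewrite mkpathNE// g0.
Qed.

Lemma mkpath_congr t X Y : (forall s, 0 <= s <= t -> X s = Y s) ->
  mkpath t X = mkpath t Y.
Proof.
move=> XY; apply: mkpath_eq => // s st; first by rewrite mkpathE// XY.
exact: mkpathNE.
Qed.

Lemma mkpath_path_on T t X : 0 <= t <= T -> path_on T (mkpath t X).
Proof. by move=> tT; split => // s; exact: mkpathNE. Qed.

Lemma flat_extE g t s : 0 <= s <= t ->
  flat_ext g t s = if s < ptime g then g s else g (ptime g).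
Proof. exact: mkpathE. Qed.

Lemma vbumpE g x s : 0 <= s <= ptime g ->
  vbump g x s = if s < ptime g then g s else g (ptime g) + x.
Proof. exact: mkpathE. Qed.

Lemma flat_ext_ext g s t : 0 <= ptime g <= s -> s <= t ->
  flat_ext (flat_ext g s) t = flat_ext g t.
Proof.
move=> /andP[g0 gs] st; apply: mkpath_eq => // r rt; last exact: mkpathNE.
rewrite -[ptime (flat_ext g s)]/s (flat_extE _ rt).
rewrite (flat_extE _ (_ : 0 <= s <= s)) ?lexx ?(le_trans g0)//.
rewrite [s < _]ltNge gs; case: ltP => rs.
  by rewrite flat_extE//; case/andP: rt => -> _; rewrite ltW.
by rewrite ltNge (le_trans gs rs).
Qed.

Lemma flat_ext_id T g : path_on T g -> flat_ext g (ptime g) = g.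
Proof.
move=> [_ g0]; apply: mkpath_eq => // s /andP[_].
by rewrite le_eqVlt => /predU1P[->|->]; rewrite ?ltxx.
Qed.

Lemma vbump_vbump g x y : 0 <= ptime g -> vbump (vbump g x) y = vbump g (x + y).
Proof.
move=> g0; apply: mkpath_eq => // s sg; last exact: mkpathNE.
rewrite -[ptime (vbump g x)]/(ptime g) !vbumpE// ?g0 ?lexx// ltxx -addrA.
by case: (s < _).
Qed.

Lemma vbump0 T g : path_on T g -> vbump g 0 = g.
Proof.
move=> [_ g0]; apply: mkpath_eq => // s /andP[_].
by rewrite le_eqVlt => /predU1P[->|->]; rewrite ?ltxx ?addr0.
Qed.

Lemma mkpath_cont T X t : {within `[0, T], continuous X} -> 0 <= t <= T ->
  cont_paths T (mkpath t X).
Proof.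
move=> /within_contP cX /andP[t0 tT]; split; first by apply: mkpath_path_on; rewrite t0.
apply/within_contP => s /=; rewrite in_itv /= => /andP[s0 st] e e0.
have sT : `[0, T]%classic s by rewrite /= in_itv /= s0 (le_trans st).
have [d d0 hd] := cX s sT e e0; exists d => // r; rewrite /= in_itv /= => /andP[r0 rt].
by rewrite r0 rt s0 st => /hd; apply; rewrite /= in_itv /= r0 (le_trans rt).
Qed.

(** * Paths with left limits *)

Lemma near_eq_at_right (f g : R -> H) (s d : R) (l : H) : 0 < d ->
  (forall r, s < r < s + d -> f r = g r) ->
  g r @[r --> s^'+] --> l -> f r @[r --> s^'+] --> l.
Proof.
move=> d0 fg gl; apply: cvg_trans gl; apply: near_eq_cvg; near=> r.
rewrite fg//; apply/andP; split; near: r; first exact: nbhs_right_gt.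
by apply: nbhs_right_lt; rewrite ltrDl.
Unshelve. all: by end_near. Qed.

Lemma near_eq_at_left (f g : R -> H) (s d : R) : 0 < d ->
  (forall r, s - d < r < s -> f r = g r) ->
  cvg (g r @[r --> s^'-]) -> cvg (f r @[r --> s^'-]).
Proof.
move=> d0 fg /cvg_ex[l gl]; apply/cvg_ex; exists l.
apply: cvg_trans gl; apply: near_eq_cvg; near=> r.
rewrite fg//; apply/andP; split; near: r; last exact: nbhs_left_lt.
by apply: nbhs_left_gt; rewrite ltrBlDr ltrDl.
Unshelve. all: by end_near. Qed.

Lemma cont_cadlag T g : cont_paths T g -> cadlag_paths T g.
Proof.
move=> [pg /within_contP cg]; split => //; split=> s /andP[s1 s2].
  apply/cvgrPdist_lt => e e0.
  have sg : `[0, ptime g]%classic s by rewrite /= in_itv /= s1 ltW.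
  have [d d0 hd] := cg s sg e e0; near=> r.
  have sr : s < r by near: r; exact: nbhs_right_gt.
  rewrite distrC; apply: hd.
    rewrite /= in_itv /= (le_trans s1 (ltW sr)) /=; near: r.
    exact: nbhs_right_le.
  rewrite gtr0_norm ?subr_gt0// ltrBlDl; near: r.
  by apply: nbhs_right_lt; rewrite ltrDl.
apply/cvg_ex; exists (g s); apply/cvgrPdist_lt => e e0.
have sg : `[0, ptime g]%classic s by rewrite /= in_itv /= ltW.
have [d d0 hd] := cg s sg e e0; near=> r.
have sr : r < s by near: r; exact: nbhs_left_lt.
rewrite distrC; apply: hd.
  rewrite /= in_itv /= (le_trans (ltW sr) s2) andbT; near: r.
  exact: nbhs_left_ge.
rewrite distrC gtr0_norm ?subr_gt0// ltrBlDr -ltrBlDl; near: r.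
by apply: nbhs_left_gt; rewrite ltrBlDr ltrDl.
Unshelve. all: by end_near. Qed.

Lemma cadlag_flat_ext T g t : cadlag_paths T g -> ptime g <= t <= T ->
  cadlag_paths T (flat_ext g t).
Proof.
move=> [[/andP[g0 gT] _] [cr cl]] /andP[gt tT]; have t0 := le_trans g0 gt.
split; first by apply: mkpath_path_on; rewrite t0.
split=> s /andP[s1 s2]; rewrite -[ptime _]/t in s2.
  have st : 0 <= s <= t by rewrite s1 ltW.
  have [sg|gs] := ltP s (ptime g).
    rewrite [X in _ --> X]flat_extE// sg.
    apply: (@near_eq_at_right _ g s (ptime g - s)); first by rewrite subr_gt0.
      move=> r /andP[sr rg]; rewrite (addrC s) subrK in rg.
      by rewrite flat_extE ?rg// (le_trans s1 (ltW sr)) (le_trans (ltW rg)).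
    by apply: cr; rewrite s1.
  rewrite [X in _ --> X]flat_extE// [s < _]ltNge gs.
  apply: (@near_eq_at_right _ (fun=> g (ptime g)) s (t - s)); last exact: cvg_cst.
    by rewrite subr_gt0.
  move=> r /andP[sr rt]; rewrite (addrC s) subrK in rt.
  by rewrite flat_extE ?(le_trans s1 (ltW sr)) ?(ltW rt)// ltNge (le_trans gs (ltW sr)).
have [sg|gs] := leP s (ptime g).
  apply: (@near_eq_at_left _ g s s) => //.
    move=> r; rewrite subrr => /andP[r0 rs].
    by rewrite flat_extE ?(ltW r0) ?(le_trans (ltW rs) s2)// (lt_le_trans rs sg).
  by apply: cl; rewrite s1.
apply: (@near_eq_at_left _ (fun=> g (ptime g)) s (s - ptime g)).
- by rewrite subr_gt0.
- move=> r; rewrite subKr => /andP[gr rs].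
  rewrite flat_extE ?(le_trans g0 (ltW gr)) ?(le_trans (ltW rs) s2)//.
  by rewrite ltNge (ltW gr).
- exact: is_cvg_cst.
Qed.

Lemma cadlag_vbump T g x : cadlag_paths T g -> cadlag_paths T (vbump g x).
Proof.
move=> [[gT _] [cr cl]]; split; first exact: mkpath_path_on.
split=> s /andP[s1 s2]; rewrite -[ptime _]/(ptime g) in s2.
  have sg : 0 <= s <= ptime g by rewrite s1 ltW.
  rewrite [X in _ --> X]vbumpE// s2.
  apply: (@near_eq_at_right _ g s (ptime g - s)); first by rewrite subr_gt0.
    move=> r /andP[sr rg]; rewrite (addrC s) subrK in rg.
    by rewrite vbumpE ?rg// (le_trans s1 (ltW sr)) (ltW rg).
  by apply: cr; rewrite s1.
apply: (@near_eq_at_left _ g s s) => //.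
  move=> r; rewrite subrr => /andP[r0 rs].
  by rewrite vbumpE ?(ltW r0) ?(le_trans (ltW rs) s2)// (lt_le_trans rs s2).
by apply: cl; rewrite s1.
Qed.

Lemma supnorm_le T (f : R -> H) M : 0 <= T ->
  (forall s, 0 <= s <= T -> `|f s| <= M) -> supnorm T f <= M.
Proof.
move=> T0 fM; apply: ge_sup.
  by exists `|f 0|, 0 => //=; rewrite in_itv /= lexx.
by move=> _ [s + <-]; rewrite /= in_itv /=; exact: fM.
Qed.

Lemma le_supnorm T (f : R -> H) M s : (forall r, 0 <= r <= T -> `|f r| <= M) ->
  0 <= s <= T -> `|f s| <= supnorm T f.
Proof.
move=> fM sT; apply: ub_le_sup; last by exists s => //=; rewrite in_itv.
by exists M => _ [r + <-]; rewrite /= in_itv /=; exact: fM.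
Qed.

Lemma pnorm_le g M : 0 <= ptime g -> (forall s, 0 <= s <= ptime g -> `|g s| <= M) ->
  pnorm g <= M.
Proof. exact: supnorm_le. Qed.

End path_space.

Section path_metric.
Context {R : realType} {H : completeNormedModType R} (S : R -> {linear H -> H}).
Hypothesis hS : contraction_semigroup S.
Context (T : R).
Hypothesis T0 : 0 <= T.
Implicit Types (g : hpath H) (X : R -> H) (r s t : R).
Local Notation dist := (dinf S T).

(** The supremum in [dinf] is that of a real set, hence meaningless when
    unbounded; this predicate guards the triangle inequality. *)
Definition bounded_path g : Prop :=
  0 <= ptime g /\ exists M, forall s, 0 <= s <= ptime g -> `|g s| <= M.

Lemma semigroup_extE g s : 0 <= s <= T -> semigroup_ext S g T s =
  if s < ptime g then g s else S (s - ptime g) (g (ptime g)).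
Proof. exact: mkpathE. Qed.

Lemma semigroup_ext_bounded g : bounded_path g ->
  exists M, forall s, 0 <= s <= T -> `|semigroup_ext S g T s| <= M.
Proof.
move=> [g0 [M gM]]; exists M => s sT; rewrite semigroup_extE//.
case: ltP => sg; first by apply: gM; case/andP: sT => -> _; rewrite ltW.
apply: le_trans (semigroup_le hS _ _) _; first by rewrite subr_ge0.
by apply: gM; rewrite g0 lexx.
Qed.

Lemma dinf_le g g' M :
  (forall s, 0 <= s <= T -> `|semigroup_ext S g T s - semigroup_ext S g' T s| <= M) ->
  dist g g' <= `|ptime g - ptime g'| + M.
Proof. by move=> h; rewrite lerD2l; exact: supnorm_le. Qed.


Lemma dinf_triangle g g' g'' :
  bounded_path g -> bounded_path g' -> bounded_path g'' ->
  dist g g'' <= dist g g' + dist g' g''.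
Proof.
move=> /semigroup_ext_bounded[M hM] /semigroup_ext_bounded[M' hM'].
move=> /semigroup_ext_bounded[M'' hM''].
rewrite /dinf addrACA lerD//.
  by rewrite (le_trans _ (ler_normD _ _))// addrA subrK.
apply: supnorm_le => // s sT.
rewrite -(subrK (semigroup_ext S g' T s) (semigroup_ext S g T s)) -addrA.
rewrite (le_trans (ler_normD _ _))// lerD//.
  apply: (@le_supnorm _ _ T (fun s => semigroup_ext S g T s - semigroup_ext S g' T s)
    (M + M')) => // r rT.
  by rewrite (le_trans (ler_normB _ _))// lerD ?hM ?hM'.
apply: (@le_supnorm _ _ T (fun s => semigroup_ext S g' T s - semigroup_ext S g'' T s)
  (M' + M'')) => // r rT.
by rewrite (le_trans (ler_normB _ _))// lerD ?hM' ?hM''.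
Qed.

Lemma dinf_same_time g g' M : ptime g = ptime g' -> 0 <= ptime g ->
  (forall s, 0 <= s <= ptime g -> `|g s - g' s| <= M) -> dist g g' <= M.
Proof.
move=> gg' g0 h; rewrite -[leRHS]add0r -(normr0 R) -(subrr (ptime g)) {2}gg'.
apply: dinf_le => s sT; rewrite !semigroup_extE// -gg'.
case: ltP => sg; first by apply: h; case/andP: sT => -> _; rewrite ltW.
rewrite -linearB (le_trans (semigroup_le hS _ _)) ?subr_ge0//.
by apply: h; rewrite g0 lexx.
Qed.

(** Up to time [s] the extensions agree, after time [t] they are images of the
    values at time [t] under a contraction. *)
Lemma dinf_two_times X s t M : 0 <= s <= t -> t <= T -> 0 <= M ->
  (forall r, s <= r <= t -> `|S (r - s) (X s) - X r| <= M) ->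
  dist (mkpath s X) (mkpath t X) <= t - s + M.
Proof.
move=> /andP[s0 st] tT M0 h.
have -> : t - s = `|ptime (mkpath s X) - ptime (mkpath t X)|.
  by rewrite distrC /= ger0_norm// subr_ge0.
apply: dinf_le => r rT; rewrite !semigroup_extE//= s0 (le_trans s0 st) !lexx /=.
have /andP[r0 _] := rT.
have [rs|sr] := ltP r s.
  by rewrite (lt_le_trans rs st) r0 (ltW rs) (ltW (lt_le_trans rs st)) subrr normr0.
have [rt|tr] := ltP r t; first by rewrite r0 (ltW rt) h// sr ltW.
have -> : r - s = (r - t) + (t - s) by rewrite addrA subrK.
rewrite (semigroupD hS) ?subr_ge0// -linearB.
rewrite (le_trans (semigroup_le hS _ _)) ?subr_ge0// h//.
by rewrite st lexx.
Qed.

Lemma dinf_sym g g' : dist g g' = dist g' g.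
Proof.
rewrite /dinf distrC; congr (_ + sup _).
by apply: eq_imagel => s _; rewrite distrC.
Qed.

(** Convergence of the semigroup at [0] is used at the single point [X s], the
    continuity of [X] taking care of the other ones. *)
Lemma dinf_path_cont X s e : {within `[0, T], continuous X} -> 0 <= s <= T ->
  0 < e -> exists2 d, 0 < d & forall t, 0 <= t <= T -> `|t - s| < d ->
  dist (mkpath s X) (mkpath t X) < e.
Proof.
move=> /within_contP cX sT e0; pose e' := e / 6.
have e'0 : 0 < e' by rewrite divr_gt0.
have Ds : `[0, T]%classic s by rewrite /= in_itv.
have [d1 d10 h1] := cX s Ds e' e'0.
have [d2 d20 h2] := semigroup_near0 hS (X s) e'0.
exists (Num.min e' (Num.min d1 d2)); first by rewrite !lt_min e'0 d10.
have hX r : 0 <= r <= T -> `|r - s| < d1 -> `|X r - X s| < e'.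
  by move=> rT; apply: h1; rewrite /= in_itv.
move=> t tT; rewrite !lt_min => /and3P[ts1 ts2 ts3].
have /andP[s0 sT'] := sT; have /andP[t0 tT'] := tT.
suff h a b : 0 <= a <= b -> b <= T -> `|b - a| <= `|t - s| ->
    (forall r, a <= r <= b -> `|X r - X s| < e') ->
    dist (mkpath a X) (mkpath b X) < e.
  have [st|/ltW ts] := leP s t.
    apply: h => //; first by rewrite s0.
    move=> r /andP[sr rt]; apply: hX; first by rewrite (le_trans s0 sr) (le_trans rt).
    apply: le_lt_trans ts2; rewrite !ger0_norm ?subr_ge0//; exact: lerB.
  rewrite dinf_sym; apply: h => //; [by rewrite t0|by rewrite distrC|].
  move=> r /andP[tr rs]; apply: hX; first by rewrite (le_trans t0 tr) (le_trans rs).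
  apply: le_lt_trans ts2; rewrite ![`|_ - s|]distrC !ger0_norm ?subr_ge0//.
  exact: lerB.
move=> /andP[a0 ab] bT ba hr.
have ba0 : 0 <= b - a by rewrite subr_ge0.
rewrite (ger0_norm ba0) in ba.
apply: le_lt_trans (dinf_two_times (M := 5 * e') _ bT _ _) _.
- by rewrite a0.
- by rewrite mulr_ge0 // ltW.
- move=> r /andP[ar rb].
  have ra0 : 0 <= r - a by rewrite subr_ge0.
  have n1 := hr r; rewrite ar rb in n1; have {}n1 := n1 isT.
  have n2 := hr a; rewrite lexx ab in n2; have {}n2 := n2 isT.
  have n3 : `|S (r - a) (X s) - X s| < e'.
    apply: h2; rewrite ra0 /= (le_lt_trans _ ts3)// (le_trans _ ba)//.
    exact: lerB.
  have n4 : `|S (r - a) (X a - X s)| < e'.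
    exact: le_lt_trans (semigroup_le hS _ ra0) n2.
  have -> : S (r - a) (X a) - X r = S (r - a) (X a - X s) +
      ((S (r - a) (X s) - X s) - (X r - X s)).
    by rewrite linearB opprB addrA [X in _ = X + _]addrA !subrK addrA subrK.
  rewrite (le_trans (ler_normD _ _))//.
  have := ler_normB (S (r - a) (X s) - X s) (X r - X s).
  by move: n1 n3 n4; lra.
- by move: ts1 ba; rewrite /e'; lra.
Qed.

Lemma mkpath_bounded X t : {within `[0, T], continuous X} -> 0 <= t <= T ->
  bounded_path (mkpath t X).
Proof.
move=> cX /andP[t0 tT]; split => //=.
have /compact_bounded[M [_ hM]] := continuous_compact cX (@segment_compact _ 0 T).
exists (M + 1) => s st; rewrite st; apply: (hM (M + 1)); first by rewrite ltrDl.
by exists s => //=; rewrite in_itv /=; case/andP: st => -> /le_trans; apply.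
Qed.

Lemma cont_bounded_path g : cont_paths T g -> bounded_path g.
Proof.
move=> [[/andP[g0 gT] _] cg]; split => //.
have /compact_bounded[M [_ hM]] := continuous_compact cg (@segment_compact _ 0 (ptime g)).
exists (M + 1) => s st; apply: (hM (M + 1)); first by rewrite ltrDl.
by exists s => //=; rewrite in_itv.
Qed.

End path_metric.

(** Compactness of the segment, for properties that hold at small scales. *)
Lemma uniform_on_segment {R : realType} (P : R -> R -> Prop) (a b : R) :
  (forall s, a <= s <= b -> exists2 d, 0 < d & forall s' e,
     a <= s' <= b -> `|s' - s| < d -> 0 < e < d -> P e s') ->
  exists2 d, 0 < d & forall e, 0 < e < d -> forall s, a <= s <= b -> P e s.
Proof.
move=> hP; have /compact_near_coveringP/near_covering_withinP := @segment_compact R a b.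
move=> /(_ _ (0 : R)^'+ P _) [|d /= d0 hd]; last first.
  exists d => // e /andP[e0 ed] s sab; apply: hd => //=.
  by rewrite sub0r normrN gtr0_norm.
move=> s /=; rewrite in_itv /= => sab; have [d d0 hd] := hP s sab.
exists (ball s d, [set e | 0 < e < d]) => /=.
  split; first exact: nbhsx_ballx.
    exists d => //= e; rewrite /= sub0r normrN => ed e0.
    by move: ed; rewrite gtr0_norm// e0.
move=> [s' e] /= [sd ed]; rewrite in_itv /= => s'ab; apply: hd => //.
by move: sd; rewrite -ball_normE /= distrC.
Qed.

(** * Increments of a functional along elementary changes of the path *)

Section increments.
Context {R : realType} {H : completeNormedModType R} (ip : {dot H for idfun}).
Hypothesis ip_norm : forall x : H, ip x x = `|x| ^+ 2.
Context (S : R -> {linear H -> H}).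
Hypothesis hS : contraction_semigroup S.
Context (T : R).
Hypothesis T0 : 0 <= T.
Context (f : hpath H -> R).
Hypothesis fC1 : C1_cadlag S ip T f.
Implicit Types (g W Z : hpath H) (x p : H) (s t h e c : R).

Local Notation Dx := (dpath_x ip f).
Local Notation Dt := (dpath_t f).

(** The derivative with an explicit modulus, at [x = 0] included. *)
Lemma dpath_xP g e : cadlag_paths T g -> 0 < e -> exists2 d, 0 < d &
  forall x, `|x| < d -> `|f (vbump g x) - f g - ip (Dx g) x| <= e * `|x|.
Proof.
move=> cg e0; have [_ _ _ /(_ g cg) hB _] := fC1.
have : is_dpath_x ip f g (Dx g).
  by have [B hB'] := hB; apply: (@xgetPex _ 0 [set B | is_dpath_x ip f g B]); exists B.
move=> /cvgrPdist_lt /(_ _ e0); rewrite near_withinE => /nbhs_ballP[d /= d0 hd].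
exists d => // x xd; have [->|x0] := eqVneq x 0.
  by rewrite (vbump0 cg.1) normr0 mulr0 subrr sub0r normrN ipC ip0l normr0.
have := hd x; rewrite -ball_normE /= !sub0r !normrN => /(_ xd x0).
rewrite normrM normfV !normr_id.
by rewrite ltr_pdivrMr ?normr_gt0// => /ltW.
Qed.

(** The mean value inequality in the direction [x]. *)
Lemma vbump_increment W x p e : cadlag_paths T W ->
  (forall th, 0 <= th <= 1 -> `|Dx (vbump W (th *: x)) - p| <= e) ->
  `|f (vbump W x) - f W - ip p x| <= e * `|x|.
Proof.
move=> cW hp; have [->|x0] := eqVneq x 0.
  by rewrite (vbump0 cW.1) normr0 mulr0 subrr sub0r normrN ipC ip0l normr0.
have nx0 : 0 < `|x| by rewrite normr_gt0.
have W0 : 0 <= ptime W by case: cW => -[/andP[]].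
pose phi (th : R) := f (vbump W (th *: x)).
have step th k : 0 < k -> exists2 d, 0 < d & forall h, `|h| < d ->
    `|phi (th + h) - phi th - h * ip (Dx (vbump W (th *: x))) x| <= k * `|h|.
  move=> k0; have kx : 0 < k / `|x| by rewrite divr_gt0.
  have [d d0 hd] := dpath_xP (cadlag_vbump (th *: x) cW) kx.
  exists (d / `|x|); first by rewrite divr_gt0.
  move=> h; rewrite ltr_pdivlMr// -normrZ => /hd.
  rewrite vbump_vbump// -scalerDl ipZr normrZ [leRHS]mulrCA divfK ?gt_eqF//.
  by rewrite [leRHS]mulrC.

have -> : f (vbump W x) - f W - ip p x = phi 1 - phi 0 - ip p x * (1 - 0).
  by rewrite /phi scale1r scale0r (vbump0 cW.1) subr0 mulr1.
rewrite [leRHS](_ : _ = e * `|x| * (1 - 0)); last by rewrite subr0 mulr1.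
apply: right_mean_value_abs => //.
  move=> th th01 e' e'0; set B := ip (Dx (vbump W (th *: x))) x.
  have [d d0 hd] := step th 1 ltr01; have B1 : 0 < `|B| + 1 by rewrite ltr_wpDl.
  exists (Num.min d (e' / (`|B| + 1))); first by rewrite lt_min d0 divr_gt0.
  move=> r _; rewrite lt_min => /andP[rd re].
  have := hd (r - th) rd; rewrite (addrC th) subrK mul1r -/B => h1.
  rewrite -(subrK ((r - th) * B) (phi r - phi th)).
  apply: le_lt_trans (ler_normD _ _) _; rewrite normrM.
  move: re; rewrite ltr_pdivlMr// mulrDr mulr1 => re.
  by apply: le_lt_trans re; rewrite addrC lerD2l.
move=> th /andP[th0 th1] kap kap0.
have [d d0 hd] := step th kap kap0; exists d => // h /andP[h0 hlt].
have h1 := hd h; rewrite gtr0_norm// in h1; have {}h1 := h1 hlt.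
set B := Dx (vbump W (th *: x)) in h1.
have -> : phi (th + h) - phi th - ip p x * h =
    (phi (th + h) - phi th - h * ip B x) + h * ip (B - p) x.
  by rewrite ipBl; ring.
apply: le_trans (ler_normD _ _) _; rewrite addrC mulrDl lerD//.
rewrite normrM gtr0_norm// mulrC ler_wpM2r ?(ltW h0)//.
apply: le_trans (ip_le ip_norm _ _) _; rewrite ler_wpM2r// hp// th0.
exact: ltW.
Qed.

Lemma flat_ext_dinf Z (s t e : R) : 0 <= ptime Z -> ptime Z <= s <= t -> t <= T ->
  0 <= e -> (forall r, 0 <= r <= t - s -> `|S r (Z (ptime Z)) - Z (ptime Z)| <= e) ->
  dinf S T (flat_ext Z s) (flat_ext Z t) <= t - s + e.
Proof.
move=> Z0 /andP[Zs st] tT e0 he; apply: dinf_two_times => //.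
  by rewrite (le_trans Z0 Zs).
move=> r /andP[sr rt]; rewrite ltNge Zs ltNge (le_trans Zs sr) /=.
by apply: he; rewrite subr_ge0 sr lerB.
Qed.

(** The mean value inequality in time: flat extensions compose, so that the time
    derivative at [flat_ext Z (s + l)] is the right derivative of [f] along the
    flat extensions of [Z]. *)
Lemma flat_ext_increment Z h c e : cadlag_paths T Z -> 0 <= h -> ptime Z + h < T ->
  (forall l, 0 <= l < h -> `|Dt (flat_ext Z (ptime Z + l)) - c| <= e) ->
  `|f (flat_ext Z (ptime Z + h)) - f Z - c * h| <= e * h.
Proof.
move=> cZ h0 hT hc; have [[/andP[Z0 ZT] _] _] := cZ; set s := ptime Z in Z0 ZT hT hc *.
have [fc dtc _ _ _] := fC1.
have cfl l : 0 <= l <= h -> cadlag_paths T (flat_ext Z (s + l)).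
  move=> /andP[l0 lh]; apply: cadlag_flat_ext => //.
  by rewrite lerDl l0 (le_trans _ (ltW hT))// lerD2l.
pose phi l := f (flat_ext Z (s + l)).
have -> : f (flat_ext Z (s + h)) - f Z - c * h = phi h - phi 0 - c * (h - 0).
  by rewrite /phi addr0 subr0 /s (flat_ext_id cZ.1).
rewrite [leRHS](_ : _ = e * (h - 0)); last by rewrite subr0.
apply: right_mean_value_abs => //.
  move=> l lh e' e'0; have [d d0 hd] := fc _ (cfl l lh) e' e'0.
  have d20 : 0 < d / 2 by rewrite divr_gt0.
  have [k k0 hk] := semigroup_near0 hS (Z s) d20.
  exists (Num.min k (d / 2)); first by rewrite lt_min k0.
  move=> l'; rewrite /= in_itv /= => l'h; rewrite lt_min => /andP[lk ld].
  rewrite distrC; apply: hd; first exact: cfl.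
  suff hh a b : 0 <= a <= b -> b <= h -> `|b - a| < k -> `|b - a| < d / 2 ->
      dinf S T (flat_ext Z (s + a)) (flat_ext Z (s + b)) < d.
    have /andP[l0 lh'] := lh; have /andP[l'0 l'h'] := l'h.
    have [ll'|/ltW l'l] := leP l l'; first by apply: hh => //; rewrite l0.
    by rewrite dinf_sym; apply: hh; rewrite ?l'0// distrC.
  move=> /andP[a0 ab] bh; rewrite ger0_norm ?subr_ge0// => bak bad.
  have E : s + b - (s + a) = b - a by rewrite opprD addrACA subrr add0r.
  apply: le_lt_trans (flat_ext_dinf (e := d / 2) Z0 _ _ _ _) _.
  - by rewrite lerDl a0 lerD2l.
  - by rewrite (le_trans _ (ltW hT))// lerD2l.
  - exact: ltW.
  - move=> r; rewrite E => /andP[r0 rb]; apply/ltW/hk; rewrite r0.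
    exact: le_lt_trans bak.
  - by rewrite E [ltRHS](splitr d) ltrD2r.
move=> l /andP[l0 lh] kap kap0.
have lh' : 0 <= l <= h by rewrite l0 ltW.
have slT : s + l < T by rewrite (lt_trans _ hT)// ltrD2l.
have := dtc (flat_ext Z (s + l)) (conj (cfl l lh') slT).
move=> /cvgrPdist_lt /(_ _ kap0); rewrite near_withinE => -[d /= d0 hd].
exists d => // k /andP[k0 kd].
have := hd k; rewrite /= sub0r normrN gtr0_norm// => /(_ kd k0).
rewrite -/(Dt _) /dpath_t_quot flat_ext_ext; last 2 first.
- by rewrite Z0 lerDl.
- by rewrite lerDl ltW.
rewrite -/(ptime _) -[ptime _]/(s + l) -addrA -/(phi l) -/(phi (l + k)) => h1.
set D := Dt (flat_ext Z (s + l)) in h1.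
have hD : `|D - c| <= e by apply: hc; rewrite l0.
have -> : phi (l + k) - phi l - c * k =
    k * (D - c) - k * (D - k^-1 * (phi (l + k) - phi l)).
  by field; rewrite gt_eqF.
apply: le_trans (ler_normB _ _) _; rewrite !normrM (gtr0_norm k0) -mulrDr.
by rewrite [leLHS]mulrC ler_wpM2r ?(ltW k0)// lerD// ltW.
Qed.

(** The step approximations of [Y] keep its current value at their final time,
    which lets each step add the increment of [Y] as a single jump. *)
Definition step_close (Y : R -> H) (rho : R) Z : Prop :=
  [/\ cadlag_paths T Z, Z (ptime Z) = Y (ptime Z) &
      forall r, 0 <= r <= ptime Z -> `|Y r - Z r| <= rho].

Definition step_next (Y : R -> H) Z t : hpath H :=
  vbump (flat_ext Z t) (Y t - Y (ptime Z)).

Section one_step.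
Context (Y : R -> H) (rho : R) (Z : hpath H) (h : R).
Hypothesis hZ : step_close Y rho Z.
Hypothesis h0 : 0 <= h.
Hypothesis hT : ptime Z + h <= T.
Hypothesis hY : forall r, ptime Z <= r <= ptime Z + h -> `|Y r - Y (ptime Z)| <= rho.
Local Notation s := (ptime Z).

Lemma step_time_ge0 : 0 <= s.
Proof. by case: hZ => -[[/andP[]]]. Qed.

Lemma flat_ext_close l : 0 <= l <= h ->
  cadlag_paths T (flat_ext Z (s + l)) /\
  forall r, 0 <= r <= s + l -> `|Y r - flat_ext Z (s + l) r| <= rho.
Proof.
move=> /andP[l0 lh]; have [cZ Zs ZY] := hZ; split.
  apply: cadlag_flat_ext => //.
  by rewrite lerDl l0 (le_trans _ hT)// lerD2l.
move=> r rl; rewrite flat_extE//; have /andP[r0 rl'] := rl.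
case: ltP => rs; first by apply: ZY; rewrite r0 ltW.
by rewrite Zs; apply: hY; rewrite rs (le_trans rl')// lerD2l.
Qed.

Lemma vbump_close th : 0 <= th <= 1 ->
  let Z' := vbump (flat_ext Z (s + h)) (th *: (Y (s + h) - Y s)) in
  cadlag_paths T Z' /\ forall r, 0 <= r <= s + h -> `|Y r - Z' r| <= rho.
Proof.
move=> /andP[th0 th1] Z'; have hh : 0 <= h <= h by rewrite h0 lexx.
have [cf fY] := flat_ext_close hh; split; first exact: cadlag_vbump.
move=> r rh; rewrite /Z' vbumpE// -[ptime _]/(s + h); case: ltP => rs.
  exact: fY.
have -> : r = s + h by apply/eqP; rewrite eq_le rs; case/andP: rh => _ ->.
have sh0 : 0 <= s + h by rewrite addr_ge0 ?step_time_ge0.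
have [_ Zs _] := hZ.
rewrite flat_extE ?sh0 ?lexx// ltNge lerDl h0 /= Zs.
rewrite opprD addrA -{1}(scale1r (Y (s + h) - Y s)) -scalerBl normrZ.
apply: le_trans (_ : `|Y (s + h) - Y s| <= _); last first.
  by apply: hY; rewrite lerDl h0 lexx.
rewrite ler_piMl// ger0_norm ?subr_ge0//.
by rewrite gerBl.
Qed.

Lemma step_next_close : step_close Y rho (step_next Y Z (s + h)).
Proof.
have h1 : 0 <= (1 : R) <= 1 by rewrite ler01 lexx.
have [] := vbump_close h1; rewrite scale1r => cZ' ZY'; split => //.
have [_ Zs _] := hZ; have sh0 : 0 <= s + h by rewrite addr_ge0 ?step_time_ge0.
suff : step_next Y Z (s + h) (s + h) = Y (s + h) by [].
have sh : 0 <= s + h <= ptime (flat_ext Z (s + h)) by rewrite sh0 /= lexx.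
rewrite /step_next vbumpE// -[ptime (flat_ext _ _)]/(s + h) ltxx.
rewrite flat_extE ?sh0 ?lexx// ltNge lerDl h0 Zs.
by rewrite addrC subrK.
Qed.

Lemma step_increment c p e e' : s + h < T ->
  (forall Z', cadlag_paths T Z' -> s <= ptime Z' < s + h ->
     (forall r, 0 <= r <= ptime Z' -> `|Y r - Z' r| <= rho) -> `|Dt Z' - c| <= e) ->
  (forall Z', cadlag_paths T Z' -> ptime Z' = s + h ->
     (forall r, 0 <= r <= s + h -> `|Y r - Z' r| <= rho) -> `|Dx Z' - p| <= e') ->
  `|f (step_next Y Z (s + h)) - f Z - (c * h + ip p (Y (s + h) - Y s))|
    <= e * h + e' * `|Y (s + h) - Y s|.
Proof.
move=> hT' hDt hDx; have [cZ _ _] := hZ.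
have -> : f (step_next Y Z (s + h)) - f Z - (c * h + ip p (Y (s + h) - Y s)) =
    (f (flat_ext Z (s + h)) - f Z - c * h) +
    (f (step_next Y Z (s + h)) - f (flat_ext Z (s + h)) - ip p (Y (s + h) - Y s)).
  by ring.
apply: le_trans (ler_normD _ _) _; rewrite lerD//.
  apply: flat_ext_increment => // l /andP[l0 lh].
  have lh' : 0 <= l <= h by rewrite l0 ltW.
  have [cf fY] := flat_ext_close lh'; apply: hDt => //.
  suff : s <= s + l < s + h by [].
  by rewrite lerDl l0 ltrD2l.
have hh : 0 <= h <= h by rewrite h0 lexx.
apply: vbump_increment; first by case: (flat_ext_close hh).
by move=> th th01; have [cv vY] := vbump_close th01; exact: hDx.
Qed.

End one_step.

End increments.

(** * Gronwall-type iteration *)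

Lemma geometric_small {R : realType} (x e : R) : 0 < e -> exists n, x / 2 ^+ n <= e.
Proof.
move=> e0; have : (fun n => x * (2^-1 : R) ^+ n) @ \oo --> x * 0.
  apply: cvgM; first exact: cvg_cst.
  apply: (@cvg_expr R (2^-1 : R)).
  by rewrite ger0_norm ?invr_ge0// invf_lt1// ltr1n.
rewrite mulr0 => /cvgrPdist_le /(_ _ e0) [N _ /(_ N (leqnn _))] /=.
rewrite sub0r normrN => h; exists N; rewrite -exprVn.
exact: le_trans (ler_norm _) h.
Qed.

(** A bound that improves from [K] to [C + K / 2] improves down to the fixed
    point [2 * C]. With [C = 0] this gives uniqueness of mild solutions, with
    [C > 0] their growth bound. *)
Lemma halving {R : realType} (D : set R) (f w : R -> R) (C : R) : 0 <= C ->
  (forall r, 0 <= w r) ->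
  (exists2 K, 0 <= K & forall r, D r -> f r <= K * w r) ->
  (forall K, 0 <= K -> (forall r, D r -> f r <= K * w r) ->
     forall r, D r -> f r <= (C + K / 2) * w r) ->
  forall r, D r -> f r <= 2 * C * w r.
Proof.
move=> C0 w0 [K K0 hK] step r Dr.
have h n : 0 <= 2 * C + K / 2 ^+ n /\
    forall r, D r -> f r <= (2 * C + K / 2 ^+ n) * w r.
  elim: n => [|n [IH0 IH]].
    rewrite expr0 divr1; split; first by rewrite addr_ge0// mulr_ge0.
    move=> s Ds; apply: le_trans (hK _ Ds) _.
    by rewrite ler_wpM2r// lerDr mulr_ge0.
  split; first by rewrite addr_ge0 ?mulr_ge0// divr_ge0// exprn_ge0.
  move=> s Ds; apply: le_trans (step _ IH0 IH s Ds) _.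
  rewrite le_eqVlt; apply/orP; left; apply/eqP; congr (_ * _).
  by rewrite exprS; field; rewrite expf_neq0.
apply: le_add_eps => e e0.
have [n hn] := geometric_small (K * w r) e0.
apply: le_trans ((h n).2 r Dr) _; rewrite mulrDl lerD2l.
by rewrite mulrAC.
Qed.

Lemma Rint_exp_le {R : realType} (a b c k : R) : a <= b -> 0 <= c -> 0 < k ->
  \int[lebesgue_measure]_(r in `[a, b]) (c * expR (k * r)) <= c / k * expR (k * b).
Proof.
rewrite le_eqVlt => /predU1P[<- c0 k0|ab c0 k0].
  by rewrite Rint_point mulr_ge0 ?expR_ge0// divr_ge0// ltW.
pose G (r : R) := c / k * expR (k * r).
have dG (x : R) : is_derive x (1 : R) G (c * expR (k * x)).
  have d1 : is_derive x (1 : R) (fun r : R => k * r) k.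
    have -> : (fun r : R => k * r) = k \*: id by [].
    by apply: is_derive_eq; rewrite -[RHS]mulr1.
  have d2 := is_derive1_comp (is_derive_expR (k * x)) d1.
  have -> : G = (c / k) \*: (expR \o (fun r : R => k * r)) by [].
  apply: is_derive_eq; rewrite /GRing.scale /=.
  by field; rewrite gt_eqF.
have cexp : continuous (fun r : R => c * expR (k * r)).
  move=> x; apply: cvgM; first exact: cvg_cst.
  apply: (cvg_comp (fun r => k * r)); last exact: continuous_expR.
  by apply: cvgM; [exact: cvg_cst|exact: cvg_id].
have cG : continuous G.
  move=> x; apply: cvgM; first exact: cvg_cst.
  apply: (cvg_comp (fun r => k * r)); last exact: continuous_expR.
  by apply: cvgM; [exact: cvg_cst|exact: cvg_id].
rewrite /Rintegral (continuous_FTC2 (F := G) ab).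
- by rewrite /= gerBl mulr_ge0 ?expR_ge0// divr_ge0// ltW.
- by apply: continuous_subspaceT.
- split.
  + by move=> x _; exact: ex_derive.
  + by apply: cvg_at_right_filter; exact: cG.
  + by apply: cvg_at_left_filter; exact: cG.
- by move=> x _; rewrite derive1E; exact: derive_val.
Qed.

Lemma exp_bounded_mfun {R : realType} (a b c k : R) : 0 <= k ->
  bounded_mfun a b (fun r => c * expR (k * r)).
Proof.
move=> k0; split.
  apply: measurable_funTS; apply: continuous_measurable_fun => x.
  apply: cvgM; first exact: cvg_cst.
  apply: (cvg_comp (fun r => k * r)); last exact: continuous_expR.
  by apply: cvgM; [exact: cvg_cst|exact: cvg_id].
exists (`|c| * expR (k * b)) => r /andP[_ rb].
by rewrite normrM (ger0_norm (expR_ge0 _)) ler_wpM2l// ler_expR ler_wpM2l.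
Qed.

(** * Mild solutions *)

Section mild.
Context {R : realType} {H : completeNormedModType R} {U : metricType R}.
Context (ip : {dot H for idfun}).
Hypothesis ip_norm : forall x : H, ip x x = `|x| ^+ 2.
Hypothesis H_separable : exists2 Q : set H, countable Q & dense Q.
Context (S : R -> {linear H -> H}).
Hypothesis hS : contraction_semigroup S.
Context (T : R).
Hypothesis T0 : 0 <= T.
Context (F : hpath H -> U -> H) (q : hpath H -> U -> R).
Hypothesis hFq : coef_continuous T F q.
Context (L : R).
Hypothesis L0 : 0 < L.
Hypothesis coefL : forall g g' u, cont_paths T g -> cont_paths T g' ->
  [/\ `|F g u| ^+ 2 <= L ^+ 2 * (1 + pnorm g ^+ 2),
      `|F g u - F g' u| <= L * dinf S T g g',
      `|q g u - q g' u| <= L * dinf S T g g'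
    & `|q g u| <= L * (1 + pnorm g)].
Implicit Types (g : hpath H) (X Y : R -> H) (u : R -> U) (r s t : R).
Local Notation mu := (@lebesgue_measure R).

Lemma pnorm_ge0 g : bounded_path g -> 0 <= pnorm g.
Proof.
move=> [g0 [M gM]]; apply: le_trans (normr_ge0 (g 0)) _.
by apply: (le_supnorm gM); rewrite lexx.
Qed.

Lemma drift_le g x : cont_paths T g -> `|F g x| <= L * (1 + pnorm g).
Proof.
move=> cg; have [h _ _ _] := coefL x cg cg.
have p0 := pnorm_ge0 (cont_bounded_path cg).
rewrite -(ler_pXn2r (n := 2)) ?nnegrE//; last first.
  by rewrite mulr_ge0 ?(ltW L0)// addr_ge0.
apply: le_trans h _; rewrite exprMn ler_wpM2l ?exprn_ge0 ?(ltW L0)//.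
by rewrite sqrrD expr1n mul1r -addrA lerD2l lerDr mulrn_wge0.
Qed.

Lemma path_time_bounds t s r : 0 <= t -> s <= T -> t <= r <= s -> 0 <= r <= T.
Proof. by move=> t0 sT /andP[tr rs]; rewrite (le_trans t0 tr) (le_trans rs). Qed.

Lemma time_le_drift X M r x : {within `[0, T], continuous X} -> 0 <= r <= T ->
  (forall s, 0 <= s <= r -> `|X s| <= M) ->
  `|F (mkpath r X) x| <= L * (1 + M) /\ `|q (mkpath r X) x| <= L * (1 + M).
Proof.
move=> cX rT hM; have cg := mkpath_cont cX rT.
have pM : pnorm (mkpath r X) <= M.
  apply: pnorm_le => /=; first by case/andP: rT.
  by move=> s sr; rewrite sr; exact: hM.
split; first apply: le_trans (drift_le _ cg) _.
  by rewrite ler_wpM2l ?(ltW L0)// lerD2l.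
have [_ _ _ h] := coefL x cg cg; apply: le_trans h _.
by rewrite ler_wpM2l ?(ltW L0)// lerD2l.
Qed.

Lemma cont_bounded X : {within `[0, T], continuous X} ->
  exists2 M, 0 <= M & forall s, 0 <= s <= T -> `|X s| <= M.
Proof.
move=> cX; have [|_ [M hM]] := mkpath_bounded cX (t := T); first by rewrite T0 lexx.
exists `|M| => // s sT; apply: le_trans (ler_norm _); rewrite -(mkpathE X sT).
exact: hM.
Qed.

(** The metric space of controls need not be separable, so that joint
    measurability in time and control may fail; freezing the path on short
    intervals leaves a composition with the measurable control. *)
Lemma drift_bounded_borel X u a b : {within `[0, T], continuous X} ->
  borel_measurable `[a, b] u -> 0 <= a -> b <= T ->
  bounded_borel a b (fun r => F (mkpath r X) (u r)).
Proof.
move=> cX bu a0 bT; split; last first.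
  have [M M0 hM] := cont_bounded cX.
  exists (L * (1 + M)) => r rab; have rT := path_time_bounds a0 bT rab.
  apply: (proj1 (time_le_drift _ cX rT _)) => s /andP[s0 sr]; apply: hM.
  by rewrite s0 (le_trans sr)//; case/andP: rT.
apply: (borel_diag (G := fun rho r => F (mkpath rho X) (u r))).
  move=> rho rhoab; have cg := mkpath_cont cX (path_time_bounds a0 bT rhoab).
  exact: (borel_comp (measurable_itv _) bu (hFq cg).1).
move=> r rab e e0; have rT := path_time_bounds a0 bT rab.
have eL : 0 < e / L by rewrite divr_gt0.
have [d d0 hd] := dinf_path_cont hS T0 cX rT eL.
exists d => // rho; rewrite /= in_itv /= => rhoab rr.
have rhoT := path_time_bounds a0 bT rhoab.
have [_ h _ _] := coefL (u r) (mkpath_cont cX rhoT) (mkpath_cont cX rT).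
by apply: le_lt_trans h _; rewrite mulrC -ltr_pdivlMr// dinf_sym hd.
Qed.

Lemma running_bounded_mfun X u a b : {within `[0, T], continuous X} ->
  borel_measurable `[a, b] u -> 0 <= a -> b <= T ->
  bounded_mfun a b (fun r => q (mkpath r X) (u r)).
Proof.
move=> cX bu a0 bT; split; last first.
  have [M M0 hM] := cont_bounded cX.
  exists (L * (1 + M)) => r rab; have rT := path_time_bounds a0 bT rab.
  apply: (proj2 (time_le_drift _ cX rT _)) => s /andP[s0 sr]; apply: hM.
  by rewrite s0 (le_trans sr)//; case/andP: rT.
apply: borel_real; first exact: measurable_itv.
apply: (@borel_diag _ R a b (fun rho r => q (mkpath rho X) (u r))).
  move=> rho rhoab; have cg := mkpath_cont cX (path_time_bounds a0 bT rhoab).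
  exact: (borel_comp (measurable_itv _) bu (hFq cg).2).
move=> r rab e e0; have rT := path_time_bounds a0 bT rab.
have eL : 0 < e / L by rewrite divr_gt0.
have [d d0 hd] := dinf_path_cont hS T0 cX rT eL.
exists d => // rho; rewrite /= in_itv /= => rhoab rr.
have rhoT := path_time_bounds a0 bT rhoab.
have [_ _ h _] := coefL (u r) (mkpath_cont cX rhoT) (mkpath_cont cX rT).
by apply: le_lt_trans h _; rewrite mulrC -ltr_pdivlMr// dinf_sym hd.
Qed.

(** Near [s] the values of [W] are compared with the orbit of [W s0] for a time
    [s0] slightly before [s]; this avoids any continuity of [S] in operator
    norm. *)
Lemma quasi_orbit_cont t (W : R -> H) M : 0 <= M ->
  (forall s s', t <= s <= s' -> s' <= T -> `|W s' - S (s' - s) (W s)| <= M * (s' - s)) ->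
  {within `[t, T], continuous W}.
Proof.
move=> M0 hW; apply/within_contP => s /=; rewrite in_itv /= => /andP[ts sT] e e0.
pose eta := e / (8 * (M + 1)).
have eta0 : 0 < eta by rewrite divr_gt0// mulr_gt0// ltr_wpDl.
have Meta : M * eta <= e / 8.
  rewrite /eta mulrA ler_pdivrMr ?mulr_gt0 ?ltr_wpDl//.
  by rewrite (_ : e / 8 * (8 * (M + 1)) = M * e + e); [rewrite lerDl ltW|field].
pose s0 := Num.max t (s - eta).
have [ts0 es0] : t <= s0 /\ s - eta <= s0 by split; rewrite le_max lexx ?orbT.
have s0s : s0 <= s by rewrite ge_max ts gerBl ltW.
have ss0 : 0 <= s - s0 by rewrite subr_ge0.
have e40 : 0 < e / 8 by rewrite divr_gt0.
have [d d0 hd] := orbit_cont hS (W s0) ss0 e40.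
exists (Num.min d eta); first by rewrite lt_min d0.
move=> r; rewrite /= in_itv /= lt_min => /andP[tr rT] /andP[rd reta].
have s0r : s0 <= r.
  rewrite ge_max tr /=; move: reta; rewrite ltr_norml => /andP[+ _]; lra.
have rs0 : r - s0 <= 2 * eta.
  by move: reta; rewrite ltr_norml => /andP[_]; move: es0; lra.
have h1 : `|W s - S (s - s0) (W s0)| <= e / 8.
  apply: le_trans (hW s0 s _ sT) _; first by rewrite ts0.
  apply: le_trans Meta; rewrite ler_wpM2l//; move: es0; lra.
have h2 : `|W r - S (r - s0) (W s0)| <= 2 * (e / 8).
  apply: le_trans (hW s0 r _ rT) _; first by rewrite ts0.
  apply: le_trans (_ : M * (2 * eta) <= _); first by rewrite ler_wpM2l.
  by rewrite mulrCA ler_wpM2l.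
have h3 : `|S (r - s0) (W s0) - S (s - s0) (W s0)| < e / 8.
  by apply: hd; rewrite ?subr_ge0// opprB addrA subrK.
have -> : W r - W s = (W r - S (r - s0) (W s0)) +
   ((S (r - s0) (W s0) - S (s - s0) (W s0)) - (W s - S (s - s0) (W s0))).
  by rewrite opprB addrA [X in _ = X + _]addrA !subrK addrA subrK.
apply: le_lt_trans (ler_normD _ _) _.
have := ler_normB (S (r - s0) (W s0) - S (s - s0) (W s0)) (W s - S (s - s0) (W s0)).
by move: h1 h2 h3; lra.
Qed.

(** The semigroup applied to the integral up to [s] moves the kernel from
    [S (s - r)] to [S (s' - r)]. *)
Lemma variation_of_constants t x f (s s' : R) :
  t <= s <= s' -> bounded_borel t s' f ->
  let W s := S (s - t) x + bint t s (fun r => S (s - r) (f r)) in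
  W s' = S (s' - s) (W s) + bint s s' (fun r => S (s' - r) (f r)).
Proof.
move=> /andP[ts ss'] bf /=; have bs := bounded_borelS (lexx t) ss' bf.
rewrite [S (s' - s) (_ + _)]linearD.
have -> : S (s' - s) (S (s - t) x) = S (s' - t) x.
  by rewrite -(semigroupD hS x (s := s' - s)) ?subr_ge0// addrA subrK.
rewrite -addrA; congr (_ + _).
rewrite (bint_split ip_norm H_separable (c := s)); last 2 first.
- by rewrite ts.
- exact: convolution_bounded_borel.
congr (_ + _); rewrite -(bint_comp ip_norm H_separable).
- apply: (bint_eq ip_norm H_separable) => [r /andP[tr rs]|].
    by rewrite -(semigroupD hS (f r) (s := s' - s)) ?subr_ge0// addrA subrK.
  exact: convolution_bounded_borel.
- by move=> z; apply: (semigroup_le hS); rewrite subr_ge0.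
- exact: convolution_bounded_borel.
Qed.

(** Mild solutions are the continuous fixed points of this map. *)
Definition picard g u X s : H := if s < ptime g then g s else
  S (s - ptime g) (g (ptime g)) +
  bint (ptime g) s (fun r => S (s - r) (F (mkpath r X) (u r))).

Lemma picard_cont g u X : cont_paths T g -> controls T (ptime g) u ->
  {within `[0, T], continuous X} -> {within `[0, T], continuous (picard g u X)}.
Proof.
move=> [[/andP[t0 tT] _] cg] bu cX; set t := ptime g in t0 tT cg bu *.
have bF := drift_bounded_borel cX bu t0 (lexx T).
have -> : `[0, T]%classic = `[0, t]%classic `|` `[t, T]%classic :> set R.
  apply/seteqP; split => r /=; rewrite !in_itv /=.
    by case: (leP r t) => [rt /andP[-> _]|/ltW rt /andP[_ ->]]; [left|right; rewrite rt].
  case=> /andP[h1 h2]; first by rewrite h1 (le_trans h2).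
  by rewrite h2 (le_trans t0).
apply: withinU_continuous; [exact: interval_closed|exact: interval_closed| |].
  apply: within_eq cg => r; rewrite /= in_itv /= => /andP[r0 rt].
  rewrite /picard -/t; case: (ltP r t) => // tr.
  have -> : r = t by apply/eqP; rewrite eq_le rt.
  rewrite subrr (semigroup0 hS) (bint_point ip_norm H_separable) ?addr0//.
  apply: convolution_bounded_borel => //.
  exact: bounded_borelS tT bF.
pose W s := S (s - t) (g t) + bint t s (fun r => S (s - r) (F (mkpath r X) (u r))).
have cW : {within `[t, T], continuous W}.
  have [M0 hM0] := bF.2.
  apply: (@quasi_orbit_cont t W `|M0| (normr_ge0 _)) => s s' tss' s'T.
  have /andP[ts ss'] := tss'.
  have bF' := bounded_borelS (lexx t) s'T bF.
  rewrite /W (variation_of_constants (g t) tss' bF') addrC addKr.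
  apply: (bint_norm_le_cst ip_norm H_separable ss').
    by apply: convolution_bounded_borel => //; exact: bounded_borelS bF'.
  move=> r /andP[sr rs']; apply: le_trans (semigroup_le hS _ _) _.
    by rewrite subr_ge0.
  apply: le_trans (hM0 r _) (ler_norm _).
  by rewrite (le_trans ts sr) (le_trans rs').
apply: within_eq cW => r; rewrite /= in_itv /= => /andP[tr _].
by rewrite /picard -/t ltNge tr.
Qed.


Lemma mildP g u X : cont_paths T g -> controls T (ptime g) u ->
  is_mild_solution S T F g u X <-> ({within `[0, T], continuous X} /\
    forall s, 0 <= s <= T -> X s = picard g u X s).
Proof.
move=> [[/andP[t0 tT] _] _] bu; split.
  move=> [cX Xg hX]; split => // s /andP[s0 sT]; rewrite /picard.
  case: ltP => st; first by rewrite Xg// s0.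
  by have [] := hX s; rewrite ?st.
move=> [cX hX]; split => //.
  move=> s /andP[s0 st]; rewrite hX ?s0 ?(le_trans (ltW st))//.
  by rewrite /picard st.
move=> s /andP[ts sT]; split.
  apply: (bochner_integrableP ip_norm H_separable).
  apply: convolution_bounded_borel => //.
  exact: bounded_borelS sT (drift_bounded_borel cX bu t0 (lexx T)).
by rewrite hX ?(le_trans t0 ts)// /picard ltNge ts.
Qed.

(** The weight [expR (2 * L * r)] makes one Picard step a contraction of ratio
    [1 / 2]: the integral gains a factor [1 / (2 * L)]. *)
Lemma picard_contraction g u X Y K : cont_paths T g -> controls T (ptime g) u ->
  {within `[0, T], continuous X} -> {within `[0, T], continuous Y} -> 0 <= K ->
  (forall r, 0 <= r <= T -> `|X r - Y r| <= K * expR (2 * L * r)) ->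
  forall s, 0 <= s <= T ->
    `|picard g u X s - picard g u Y s| <= K / 2 * expR (2 * L * s).
Proof.
move=> [[/andP[t0 tT] _] _] bu cX cY K0 hXY s /andP[s0 sT].
rewrite /picard; case: ltP => st.
  by rewrite subrr normr0 mulr_ge0 ?expR_ge0// divr_ge0.
have bX := bounded_borelS (lexx (ptime g)) sT (drift_bounded_borel cX bu t0 (lexx T)).
have bY := bounded_borelS (lexx (ptime g)) sT (drift_bounded_borel cY bu t0 (lexx T)).
rewrite opprD addrACA subrr add0r.
have L20 : 0 < 2 * L by rewrite mulr_gt0.
apply: le_trans (_ : _ <= \int[mu]_(r in `[ptime g, s]) (L * K * expR (2 * L * r))) _;
    last first.
  apply: le_trans (Rint_exp_le st _ L20) _; first by rewrite mulr_ge0// ltW.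
  rewrite le_eqVlt; apply/orP; left; apply/eqP; congr (_ * _).
  by field; rewrite gt_eqF.
apply: (bintB_le ip_norm H_separable); try exact: convolution_bounded_borel.
  by apply: exp_bounded_mfun; exact: ltW.
move=> r trs; have rT := path_time_bounds t0 sT trs.
have /andP[tr rs] := trs; have /andP[r0 _] := rT.
rewrite -linearB (le_trans (semigroup_le hS _ _)) ?subr_ge0//.
have [_ h _ _] := coefL (u r) (mkpath_cont cX rT) (mkpath_cont cY rT).
apply: le_trans h _; rewrite -mulrA ler_wpM2l ?(ltW L0)//.
apply: dinf_same_time => // r' /= r'r; rewrite r'r.
have /andP[r'0 r'r'] := r'r.
apply: le_trans (hXY r' _) _; first by rewrite r'0 (le_trans r'r')//; case/andP: rT.
by rewrite ler_wpM2l// ler_expR ler_wpM2l// ltW.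
Qed.

Lemma mild_unique g u X Y : cont_paths T g -> controls T (ptime g) u ->
  is_mild_solution S T F g u X -> is_mild_solution S T F g u Y ->
  forall s, 0 <= s <= T -> X s = Y s.
Proof.
move=> cg bu /(mildP _ cg bu)[cX hX] /(mildP _ cg bu)[cY hY] s sT.
apply/eqP; rewrite -subr_eq0 -normr_le0.
apply: (@le_trans _ _ (2 * 0 * expR (2 * L * s))); last by rewrite mulr0 mul0r.
apply: (@halving _ `[0, T]%classic (fun s => `|X s - Y s|)
  (fun s => expR (2 * L * s)) 0 (lexx 0) (fun _ => expR_ge0 _)); last first.
- by rewrite /= in_itv.
- move=> K K0 hK r; rewrite /= in_itv /= => rT; rewrite add0r hX// hY//.
  by apply: picard_contraction => // r' r'T; apply: hK.
have [M M0 hM] := cont_bounded cX; have [N N0 hN] := cont_bounded cY.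
exists (M + N); first exact: addr_ge0.
move=> r; rewrite /= in_itv /= => rT; apply: le_trans (ler_normB _ _) _.
apply: le_trans (lerD (hM _ rT) (hN _ rT)) _.
rewrite ler_peMr ?addr_ge0// -expR0 ler_expR mulr_ge0 ?mulr_ge0 ?(ltW L0)//.
by case/andP: rT.
Qed.

Lemma uniform_limit_cont (W : nat -> R -> H) (X : R -> H) (a b M : R) : 0 <= M ->
  (forall n, {within `[a, b], continuous (W n)}) ->
  (forall n s, a <= s <= b -> `|W n s - X s| <= M / 2 ^+ n) ->
  {within `[a, b], continuous X}.
Proof.
move=> M0 cW hW; apply/within_contP => s Ds e e0.
have sab : a <= s <= b by move: Ds; rewrite /= in_itv.
have e40 : 0 < e / 4 by rewrite divr_gt0.
have [n hn] := geometric_small M e40.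
have /within_contP /(_ s Ds _ e40) [d d0 hd] := cW n.
exists d => // r Dr /(hd r Dr) h1.
have rab : a <= r <= b by move: Dr; rewrite /= in_itv.
have h2 := le_trans (hW n s sab) hn; have h3 := le_trans (hW n r rab) hn.
have -> : X r - X s = (W n s - X s) + ((W n r - W n s) - (W n r - X r)).
  by rewrite opprB (addrC (W n r - W n s)) subrKA (addrC (W n s - X s)) subrKA.
have := ler_normD (W n s - X s) ((W n r - W n s) - (W n r - X r)).
have := ler_normB (W n r - W n s) (W n r - X r).
by move: h1 h2 h3; lra.
Qed.

(** Picard iteration; the geometric decay of the successive differences makes the
    convergence uniform on [[0, T]]. *)
Lemma mild_exists g u : cont_paths T g -> controls T (ptime g) u ->
  exists X, is_mild_solution S T F g u X.
Proof.
move=> cg bu; have [[/andP[t0 tT] _] cg'] := cg; pose w r := expR (2 * L * r).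
have L20 : 0 <= 2 * L by rewrite mulr_ge0// ltW.
have w1 r : 0 <= r -> 1 <= w r.
  by move=> r0; rewrite -expR0 ler_expR mulr_ge0.
have wT r : r <= T -> w r <= w T.
  by move=> rT; rewrite ler_expR ler_wpM2l.
have c0 : {within `[0, T], continuous (fun=> 0 : H)}.
  by apply: continuous_subspaceT => x; exact: cvg_cst.
pose W n := iter n (picard g u) (fun=> 0).
have cW n : {within `[0, T], continuous (W n)}.
  by elim: n => [|n IH] //; exact: picard_cont.
have [K K0 hK] := cont_bounded (cW 1%N).
have dW n s : 0 <= s <= T -> `|W n.+1 s - W n s| <= K / 2 ^+ n * w s.
  elim: n s => [|n IH] s sT.
    rewrite expr0 divr1 [W 0%N s]/= subr0 (le_trans (hK _ sT))// ler_peMr//.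
    by apply: w1; case/andP: sT.
  rewrite exprSr invfM mulrA.
  apply: (picard_contraction cg bu (cW n.+1) (cW n) _ IH) => //.
  by rewrite divr_ge0// exprn_ge0.
have ddW s : 0 <= s <= T -> forall n m, (n <= m)%N ->
    `|W n s - W m s| <= 2 * K * w s / 2 ^+ n.
  move=> sT n m nm; have w0 : 0 <= w s by exact: expR_ge0.
  have h k : `|W n s - W (n + k)%N s| <= 2 * K * w s / 2 ^+ n * (1 - 2^-1 ^+ k).
    elim: k => [|k IH]; first by rewrite addn0 expr0 !subrr normr0 mulr0.
    have dk := dW (n + k)%N _ sT; rewrite distrC -addnS in dk.
    apply: le_trans (ler_distD (W (n + k)%N s) _ _) _.
    apply: le_trans (lerD IH dk) _.
    rewrite le_eqVlt; apply/orP; left; apply/eqP.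
    by rewrite exprD !exprVn exprSr; field; rewrite !expf_neq0.
  rewrite -(subnKC nm); apply: le_trans (h _) _.
  rewrite ler_piMr// ?gerBl ?exprn_ge0 ?invr_ge0//.
  by rewrite divr_ge0 ?mulr_ge0// exprn_ge0.
have cvW s : 0 <= s <= T -> cvg (W n s @[n --> \oo]).
  move=> sT; apply: (cauchy_seq_cvg (ddW s sT)).
  rewrite -(mulr0 (2 * K * w s)); apply: cvgM; first exact: cvg_cst.
  rewrite (_ : (fun n => _) = (fun n => (2^-1 : R) ^+ n)).
    by apply: cvg_expr; rewrite ger0_norm ?invr_ge0// invf_lt1// ltr1n.
  by apply/funext => n; rewrite exprVn.
pose X s : H := lim (W n s @[n --> \oo]).
have WX n s : 0 <= s <= T -> `|W n s - X s| <= 2 * K * w s / 2 ^+ n.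
  move=> sT; have cv : `|W n s - W m s| @[m --> \oo] --> `|W n s - X s|.
    by apply: cvg_norm; apply: cvgB; [exact: cvg_cst|exact: cvW].
  apply: (cvgr_to_le cv); exists n => // m /= nm; exact: ddW.
have WX' n s : 0 <= s <= T -> `|W n s - X s| <= 2 * K * w T / 2 ^+ n.
  move=> sT; apply: le_trans (WX n s sT) _.
  rewrite ler_wpM2r ?invr_ge0 ?exprn_ge0// ler_wpM2l ?mulr_ge0// wT//.
  by case/andP: sT.
have w0 s : 0 <= w s by exact: expR_ge0.
have cX : {within `[0, T], continuous X}.
  by apply: (uniform_limit_cont _ cW WX'); rewrite !mulr_ge0.
exists X; apply/(mildP _ cg bu); split => // s sT.
apply/eqP; rewrite -subr_eq0 -normr_le0; apply: le_add_eps => e e0; rewrite add0r.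
have [n hn] := geometric_small (2 * (2 * K * w s)) e0.
apply: le_trans hn; rewrite -(subrK (W n.+1 s) (X s)) -addrA.
apply: le_trans (ler_normD _ _) _.
have h1 : `|X s - W n.+1 s| <= 2 * K * w s / 2 ^+ n.
  rewrite distrC; apply: le_trans (WX _ _ sT) _.
  rewrite ler_wpM2l ?mulr_ge0// lef_pV2 ?posrE ?exprn_gt0//.
  by rewrite ler_eXn2l ?ltr1n.
have h2 : `|W n.+1 s - picard g u X s| <= 2 * K / 2 ^+ n / 2 * w s.
  apply: (picard_contraction cg bu (cW n) cX) => //.
    by rewrite divr_ge0 ?mulr_ge0 ?exprn_ge0.
  by move=> r rT; rewrite mulrAC; exact: WX.
apply: le_trans (lerD h1 h2) _; set a := 2 * K * w s / 2 ^+ n.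
have a0 : 0 <= a by rewrite divr_ge0 ?exprn_ge0// !mulr_ge0.
have -> : 2 * K / 2 ^+ n / 2 * w s = a / 2 by rewrite /a; field; rewrite expf_neq0.
have -> : 2 * (2 * K * w s) / 2 ^+ n = 2 * a by rewrite /a; field; rewrite expf_neq0.
by rewrite mulr_natl [leRHS]mulr2n lerD2l ler_pdivrMr// ler_peMr// ler1n.
Qed.

Lemma mild_solutionP g u : cont_paths T g -> controls T (ptime g) u ->
  is_mild_solution S T F g u (mild_solution S T F g u).
Proof.
move=> cg bu; have [X hX] := mild_exists cg bu.
exact: (xgetPex _ (ex_intro _ X hX)).
Qed.

Definition growth g : R := 2 * (1 + pnorm g) * expR (2 * L * T).

Lemma growth_ge0 g : cont_paths T g -> 0 <= growth g.
Proof.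
move=> cg; have p0 := pnorm_ge0 (cont_bounded_path cg).
by rewrite !mulr_ge0 ?expR_ge0 ?addr_ge0.
Qed.

(** The bound depends on [g] only, which is the source of all uniformity over the
    controls. *)
Lemma mild_growth g u X : cont_paths T g -> controls T (ptime g) u ->
  is_mild_solution S T F g u X -> forall s, 0 <= s <= T -> 1 + `|X s| <= growth g.
Proof.
move=> cg bu /(mildP _ cg bu)[cX hX] s sT.
have [[/andP[t0 tT] _] _] := cg.
have bg := cont_bounded_path cg; have p0 := pnorm_ge0 bg.
have L20 : 0 < 2 * L by rewrite mulr_gt0.
have gp r : 0 <= r <= ptime g -> `|g r| <= pnorm g.
  by move=> rg; have [_ [M hM]] := bg; exact: (le_supnorm hM rg).
apply: (@le_trans _ _ (2 * (1 + pnorm g) * expR (2 * L * s))); last first.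
  rewrite ler_wpM2l ?mulr_ge0 ?addr_ge0// ler_expR ler_wpM2l ?(ltW L20)//.
  by case/andP: sT.
apply: (@halving _ `[0, T]%classic (fun s => 1 + `|X s|)
  (fun s => expR (2 * L * s)) (1 + pnorm g)); last by rewrite /= in_itv.
- by rewrite addr_ge0.
- by move=> r; exact: expR_ge0.
- have [M M0 hM] := cont_bounded cX.
  exists (1 + M); first exact: addr_ge0.
  move=> r; rewrite /= in_itv /= => rT; apply: le_trans (lerD (lexx 1) (hM _ rT)) _.
  rewrite ler_peMr ?addr_ge0// -expR0 ler_expR mulr_ge0 ?mulr_ge0 ?(ltW L0)//.
  by case/andP: rT.
move=> K K0 hK r; rewrite /= in_itv /= => rT; have /andP[r0 rT'] := rT.
have e1 : 1 <= expR (2 * L * r) by rewrite -[leLHS]expR0 ler_expR mulr_ge0 ?(ltW L20).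
rewrite mulrDl; rewrite hX// /picard; case: ltP => rt.
  rewrite ler_wpDr ?mulr_ge0 ?expR_ge0 ?divr_ge0//.
  rewrite (le_trans (_ : _ <= 1 + pnorm g)) ?ler_peMr ?addr_ge0//.
  by rewrite lerD2l gp// r0 ltW.
have bF := bounded_borelS (lexx (ptime g)) rT' (drift_bounded_borel cX bu t0 (lexx T)).
apply: (@le_trans _ _ (1 + pnorm g + \int[mu]_(r in `[ptime g, r])
    (L * K * expR (2 * L * r)))).
  rewrite -addrA lerD2l (le_trans (ler_normD _ _))// lerD//.
    by rewrite (le_trans (semigroup_le hS _ _)) ?subr_ge0// gp// t0 lexx.
  apply: (bint_norm_le ip_norm H_separable).
  - exact: convolution_bounded_borel.
  - by apply: exp_bounded_mfun; exact: ltW.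
  - move=> r' tr'; have /andP[tr'' r'r] := tr'.
    rewrite (le_trans (semigroup_le hS _ _)) ?subr_ge0//.
    have r'T := path_time_bounds t0 rT' tr'.
    have M' : forall s', 0 <= s' <= r' -> `|X s'| <= K * expR (2 * L * r') - 1.
      move=> s' /andP[s'0 s'r']; rewrite lerBrDl.
      apply: le_trans (hK s' _) _.
        by rewrite /= in_itv /= s'0 (le_trans s'r')//; case/andP: r'T.
      by rewrite ler_wpM2l// ler_expR ler_wpM2l// ltW.
    have [h _] := time_le_drift (u r') cX r'T M'.
    by rewrite -mulrA; apply: le_trans h _; rewrite addrC subrK.
rewrite lerD//; first by rewrite ler_peMr ?addr_ge0.
apply: le_trans (Rint_exp_le rt _ L20) _; first by rewrite mulr_ge0// ltW.
rewrite le_eqVlt; apply/orP; left; apply/eqP; congr (_ * _).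
by field; rewrite gt_eqF.
Qed.

Lemma mild_drift_le g u X : cont_paths T g -> controls T (ptime g) u ->
  is_mild_solution S T F g u X -> forall r x, 0 <= r <= T ->
  `|F (mkpath r X) x| <= L * growth g /\ `|q (mkpath r X) x| <= L * growth g.
Proof.
move=> cg bu mX r x rT; have [cX _ _] := mX.
have := time_le_drift x cX rT (M := growth g - 1).
rewrite (_ : 1 + (growth g - 1) = growth g); last by rewrite addrC subrK.
apply => s /andP[s0 sr]; rewrite lerBrDl.
by apply: (mild_growth cg bu mX); rewrite s0 (le_trans sr)//; case/andP: rT.
Qed.

Lemma mild_step g u X (s s' : R) : cont_paths T g -> controls T (ptime g) u ->
  is_mild_solution S T F g u X -> ptime g <= s <= s' -> s' <= T ->
  X s' = S (s' - s) (X s) +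
    bint s s' (fun r => S (s' - r) (F (mkpath r X) (u r))).
Proof.
move=> cg bu /(mildP _ cg bu)[cX hX] tss' s'T; have /andP[ts ss'] := tss'.
have [[/andP[t0 tT] _] _] := cg.
have bF := bounded_borelS (lexx (ptime g)) s'T (drift_bounded_borel cX bu t0 (lexx T)).
have E r : ptime g <= r <= T -> X r = S (r - ptime g) (g (ptime g)) +
    bint (ptime g) r (fun r' => S (r - r') (F (mkpath r' X) (u r'))).
  move=> /andP[tr rT]; rewrite hX ?(le_trans t0 tr)//.
  by rewrite /picard ltNge tr.
have ts' : ptime g <= s' <= T by rewrite (le_trans ts ss').
have tsT : ptime g <= s <= T by rewrite ts (le_trans ss').
rewrite (E s' ts') (E s tsT).
exact: (variation_of_constants (g (ptime g)) tss' bF).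
Qed.

Lemma mild_before g u X : cont_paths T g -> is_mild_solution S T F g u X ->
  controls T (ptime g) u -> mkpath (ptime g) X = g.
Proof.
move=> cg mX bu; have [[/andP[t0 tT] g0] _] := cg; apply: mkpath_eq => // s.
have [_ Xg _] := mX; move=> /andP[s0]; rewrite le_eqVlt => /predU1P[->|st]; last first.
  by apply: Xg; rewrite s0.
move: mX => /(mildP _ cg bu)[cX ->]; last by rewrite t0.
rewrite /picard ltxx subrr (semigroup0 hS) (bint_point ip_norm H_separable) ?addr0//.
apply: convolution_bounded_borel => //.
exact: bounded_borelS tT (drift_bounded_borel cX bu t0 (lexx T)).
Qed.

Lemma mild_start g u X : cont_paths T g -> is_mild_solution S T F g u X ->
  controls T (ptime g) u -> X (ptime g) = g (ptime g).
Proof.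
move=> cg mX bu; have [[/andP[t0 tT] _] _] := cg.
have /(congr1 (fun h : hpath H => h (ptime g))) := mild_before cg mX bu.
by rewrite mkpathE// t0 lexx.
Qed.

(** By contractivity the distance from [g] is controlled by the integral of the
    drift alone. *)
Lemma mild_dinf g u X s : cont_paths T g -> controls T (ptime g) u ->
  is_mild_solution S T F g u X -> ptime g <= s <= T ->
  dinf S T g (mkpath s X) <= (1 + L * growth g) * (s - ptime g).
Proof.
move=> cg bu mX /andP[ts sT]; have [cX _ _] := mX.
have [[/andP[t0 tT] _] _] := cg.
have Lg0 : 0 <= L * growth g by rewrite mulr_ge0 ?(ltW L0) ?growth_ge0.
rewrite -{1}(mild_before cg mX bu) mulrDl mul1r.
apply: dinf_two_times => //.
- by rewrite t0.
- by rewrite mulr_ge0// subr_ge0.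
move=> r /andP[tr rs]; have rT := le_trans rs sT.
have bF := bounded_borelS tr sT (drift_bounded_borel cX bu t0 (lexx T)).
rewrite distrC (mild_step (s := ptime g) cg bu mX _ rT) ?lexx//.
rewrite addrC addKr.
apply: le_trans (bint_norm_le_cst ip_norm H_separable (M := L * growth g) tr _ _) _.
- apply: convolution_bounded_borel => //.
  exact: bounded_borelS rT (drift_bounded_borel cX bu t0 (lexx T)).
- move=> r' /andP[tr' r'r]; rewrite (le_trans (semigroup_le hS _ _)) ?subr_ge0//.
  have r'T : 0 <= r' <= T by rewrite (le_trans t0 tr') (le_trans r'r).
  by have [] := mild_drift_le cg bu mX (u r') r'T.
- by rewrite ler_wpM2l// lerB.
Qed.

Lemma mild_restart g u X s : cont_paths T g -> controls T (ptime g) u ->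
  is_mild_solution S T F g u X -> ptime g <= s <= T ->
  is_mild_solution S T F (mkpath s X) u X.
Proof.
move=> cg bu mX /andP[ts sT]; have [cX _ _] := mX.
have [[/andP[t0 tT] _] _] := cg; have s0 := le_trans t0 ts.
have cs : cont_paths T (mkpath s X) by apply: mkpath_cont => //; rewrite s0.
have bs : controls T s u.
  apply: borel_subset bu; first exact: measurable_itv.
  by apply: subset_itv; rewrite bnd_simp.
apply/(mildP _ cs bs); split => // r /andP[r0 rT]; rewrite /picard -[ptime _]/s.
case: ltP => rs; first by rewrite mkpathE// r0 ltW.
by rewrite (mild_step cg bu mX (s := s)) ?ts// mkpathE// s0 lexx.
Qed.

Definition concat_control s (u v : R -> U) r : U := if r <= s then u r else v r.

Lemma concat_controlP t s u v : t <= s <= T -> controls T t u -> controls T s v ->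
  controls T t (concat_control s u v).
Proof.
move=> /andP[ts sT] bu bv; rewrite /controls /=.
have -> : `[t, T]%classic = `[t, s]%classic `|` `]s, T]%classic :> set R.
  apply/seteqP; split => r /=; rewrite !in_itv /=.
    by case: (leP r s) => rs /andP[-> ->]; [left|right].
  case=> /andP[h1 h2]; first by rewrite h1 (le_trans h2).
  by rewrite h2 (le_trans ts (ltW h1)).
apply: borel_setU.
  apply: (@borel_eq _ _ _ u).
    by move=> r; rewrite inE /= in_itv /= /concat_control => /andP[_ ->].
  apply: borel_subset bu; first exact: measurable_itv.
  by apply: subset_itv; rewrite bnd_simp.
apply: (@borel_eq _ _ _ v).
  by move=> r; rewrite inE /= in_itv /= /concat_control ltNge => /andP[/negbTE ->].
apply: borel_subset bv; first exact: measurable_itv.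
by apply: subset_itv; rewrite bnd_simp.
Qed.

(** The two integrals over [[t, s]] and [[s, r]] recombine; at the switching time
    [s] the integrands differ, on a null set. *)
Lemma mild_concat g u v X Y s : cont_paths T g -> controls T (ptime g) u ->
  is_mild_solution S T F g u X -> ptime g <= s <= T -> controls T s v ->
  is_mild_solution S T F (mkpath s X) v Y ->
  is_mild_solution S T F g (concat_control s u v) Y /\
  forall r, 0 <= r <= s -> Y r = X r.
Proof.
move=> cg bu mX /andP[ts sT] bv mY; have [cX _ _] := mX; have [cY _ _] := mY.
have [[/andP[t0 tT] _] _] := cg; have s0 := le_trans t0 ts.
have cs : cont_paths T (mkpath s X) by apply: mkpath_cont => //; rewrite s0.
have YX r : 0 <= r <= s -> Y r = X r.
  by move=> rs; have := mild_before cs mY bv => /(congr1 (fun g => g r)); rewrite !mkpathE.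
split => //; have bw : controls T (ptime g) (concat_control s u v).
  by apply: concat_controlP; rewrite ?ts.
have bFw := drift_bounded_borel cY bw t0 (lexx T).
apply/(mildP _ cg bw); split => // r /andP[r0 rT]; rewrite /picard.
have [_ Xg _] := mX.
case: ltP => rt; first by rewrite YX ?Xg ?r0 ?(le_trans (ltW rt)).
have eqXY r' : ptime g <= r' <= s ->
    F (mkpath r' X) (u r') = F (mkpath r' Y) (concat_control s u v r').
  move=> /andP[tr' r's]; rewrite /concat_control r's; congr (F _ _).
  apply: mkpath_congr => z /andP[z0 zr']; rewrite YX// z0.
  exact: le_trans r's.
have stepX z z' : z <= s -> s <= z' ->
    bint (ptime g) z (fun r => S (z' - r) (F (mkpath r X) (u r))) =
    bint (ptime g) z (fun r => S (z' - r) (F (mkpath r Y) (concat_control s u v r))).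
  move=> zs sz'; apply: (bint_eq ip_norm H_separable).
    move=> r' /andP[tr' r'z]; rewrite eqXY// tr'; exact: le_trans zs.
  apply: convolution_bounded_borel => //; first exact: le_trans sz'.
  exact: bounded_borelS (le_trans zs sT) (drift_bounded_borel cX bu t0 (lexx T)).
have [rs|sr] := leP r s.
  have tr : ptime g <= ptime g <= r by rewrite lexx.
  rewrite YX ?r0// [LHS](mild_step cg bu mX tr rT) (mild_start cg mX bu).
  congr (_ + _); apply: (bint_eq ip_norm H_separable).
    move=> r' /andP[tr' r'z]; rewrite eqXY// tr'; exact: le_trans rs.
  apply: convolution_bounded_borel => //.
  exact: bounded_borelS rT (drift_bounded_borel cX bu t0 (lexx T)).
have sr' := ltW sr.
have ssr : s <= s <= r by rewrite lexx.
have tts : ptime g <= ptime g <= s by rewrite lexx.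
rewrite [LHS](mild_step cs bv mY ssr rT) YX ?s0 ?lexx//.
rewrite [X s](mild_step cg bu mX tts sT) (mild_start cg mX bu).
have bFr := bounded_borelS (lexx (ptime g)) rT bFw.
have eqs : bint (ptime g) s (fun r => S (s - r) (F (mkpath r X) (u r))) =
    bint (ptime g) s (fun r => S (s - r) (F (mkpath r Y) (concat_control s u v r))).
  exact: stepX.
rewrite eqs; have eqs' :
    bint s r (fun r' => S (r - r') (F (mkpath r' Y) (v r'))) =
    bint s r (fun r' => S (r - r') (F (mkpath r' Y) (concat_control s u v r'))).
  apply: (bint_eq_oc ip_norm H_separable).
  - apply: convolution_bounded_borel => //.
    exact: bounded_borelS rT (drift_bounded_borel cY bv s0 (lexx T)).
  - apply: convolution_bounded_borel => //.
    exact: bounded_borelS ts (lexx r) bFr.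
  - by move=> r' /andP[sr'' _]; rewrite /concat_control leNgt sr''.
rewrite eqs'; symmetry.
apply: (variation_of_constants (g (ptime g)) (s := s)) => //.
by rewrite ts.
Qed.

(** * The dynamic programming principle *)

Context (phi : hpath H -> R).
Hypothesis phiL : forall z, cont_paths_at T T z -> `|phi z| <= L * (1 + pnorm z).
Hypothesis U_nonempty : [set: U] !=set0.

Lemma costE g u X : cont_paths T g -> controls T (ptime g) u ->
  is_mild_solution S T F g u X ->
  cost S T F q phi g u =
  \int[mu]_(r in `[ptime g, T]) q (mkpath r X) (u r) + phi (mkpath T X).
Proof.
move=> cg bu mX; have [[/andP[t0 tT] _] _] := cg.
have E := mild_unique cg bu (mild_solutionP cg bu) mX.
have Er r : r <= T -> mkpath r (mild_solution S T F g u) = mkpath r X.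
  move=> rT; apply: mkpath_congr => s /andP[s0 sr]; apply: E.
  by rewrite s0 (le_trans sr).
rewrite /cost Er//; congr (_ + _); apply: Rint_eq => r /andP[_ rT].
by rewrite Er.
Qed.

Lemma cost_split g u X s : cont_paths T g -> controls T (ptime g) u ->
  is_mild_solution S T F g u X -> ptime g <= s <= T ->
  cost S T F q phi g u = \int[mu]_(r in `[ptime g, s]) q (mkpath r X) (u r) +
    cost S T F q phi (mkpath s X) u.
Proof.
move=> cg bu mX tsT; have [[/andP[t0 tT] _] _] := cg; have [cX _ _] := mX.
have /andP[ts sT] := tsT; have s0 := le_trans t0 ts.
have cs : cont_paths T (mkpath s X) by apply: mkpath_cont => //; rewrite s0.
have bs : controls T s u.
  apply: borel_subset bu; first exact: measurable_itv.
  by apply: subset_itv; rewrite bnd_simp.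
rewrite (costE cg bu mX) (costE cs bs (mild_restart cg bu mX tsT)) addrA.
congr (_ + _); apply: Rint_split => //.
exact: running_bounded_mfun.
Qed.

Lemma cost_ge g u : cont_paths T g -> controls T (ptime g) u ->
  - (L * growth g * (T - ptime g) + L * growth g) <= cost S T F q phi g u.
Proof.
move=> cg bu; have mX := mild_solutionP cg bu; have [cX _ _] := mX.
have [[/andP[t0 tT] _] _] := cg.
set X := mild_solution _ _ _ _ _ in mX cX *.
rewrite (costE cg bu mX) opprD lerD//.
  apply: lerNnormlW; apply: Rint_norm_le_cst => //.
    exact: running_bounded_mfun.
  move=> r /andP[tr rT]; have r0T : 0 <= r <= T by rewrite (le_trans t0 tr).
  by have [] := mild_drift_le cg bu mX (u r) r0T.
apply: lerNnormlW; have TT : 0 <= T <= T by rewrite T0 lexx.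
have cT : cont_paths_at T T (mkpath T X) by split => //; exact: mkpath_cont.
apply: le_trans (phiL cT) _; rewrite ler_wpM2l ?(ltW L0)// -lerBrDl.
apply: pnorm_le => // s sT; rewrite mkpathE// lerBrDl.
exact: (mild_growth cg bu mX).
Qed.

Lemma costs_has_inf g : cont_paths T g ->
  has_inf [set cost S T F q phi g u | u in controls T (ptime g)].
Proof.
move=> cg; split.
  have [x _] := U_nonempty; exists (cost S T F q phi g (fun=> x)), (fun=> x) => //.
  exact: borel_cst.
exists (- (L * growth g * (T - ptime g) + L * growth g)).
by move=> _ [u bu <-]; exact: cost_ge.
Qed.

Lemma value_le_cost g u : cont_paths T g -> controls T (ptime g) u ->
  value S T F q phi g <= cost S T F q phi g u.
Proof.
move=> cg bu; apply: ge_inf; first by case: (costs_has_inf cg).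
by exists u.
Qed.

(** Dynamic programming: every control on [[t, s]] can be continued by any
    admissible one after [s]. *)
Lemma dynamic_programming_le g u X s : cont_paths T g -> controls T (ptime g) u ->
  is_mild_solution S T F g u X -> ptime g <= s <= T ->
  value S T F q phi g <= \int[mu]_(r in `[ptime g, s]) q (mkpath r X) (u r) +
    value S T F q phi (mkpath s X).
Proof.
move=> cg bu mX tsT; have [[/andP[t0 tT] _] _] := cg; have [cX _ _] := mX.
have /andP[ts sT] := tsT; have s0 := le_trans t0 ts.
have cs : cont_paths T (mkpath s X) by apply: mkpath_cont => //; rewrite s0.
rewrite -lerBlDl; apply: lb_le_inf; first by case: (costs_has_inf cs).
move=> _ [v bv <-]; rewrite lerBlDl.
have mY := mild_solutionP cs bv; set Y := mild_solution _ _ _ _ v in mY.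
have [cY _ _] := mY.
have [mW YX] := mild_concat cg bu mX tsT bv mY.
have bw := concat_controlP tsT bu bv; set w := concat_control s u v in mW bw.
have bsw : controls T s w.
  apply: borel_subset bw; first exact: measurable_itv.
  by apply: subset_itv; rewrite bnd_simp.
apply: le_trans (value_le_cost cg bw) _.
rewrite (cost_split cg bw mW tsT).
have sYX : mkpath s Y = mkpath s X by apply: mkpath_congr.
have -> : \int[mu]_(r in `[ptime g, s]) q (mkpath r Y) (w r) =
    \int[mu]_(r in `[ptime g, s]) q (mkpath r X) (u r).
  apply: Rint_eq => r /andP[tr rs]; rewrite /w /concat_control rs.
  congr (q _ _); apply: mkpath_congr => z /andP[z0 zr]; apply: YX.
  by rewrite z0 (le_trans zr).
have mY' : is_mild_solution S T F (mkpath s X) w Y.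
  by rewrite -sYX; exact: mild_restart mW tsT.
rewrite sYX lerD2l (costE cs bsw mY') (costE cs bv mY) lerD2r.
rewrite [leLHS](_ : _ = \int[mu]_(r in `[s, T]) q (mkpath r Y) (v r))//.
apply: Rint_eq_oc; try exact: running_bounded_mfun.
by move=> r /andP[sr _]; rewrite /w /concat_control leNgt sr.
Qed.

(** Conversely, after time [s] a nearly optimal control is still admissible. *)
Lemma dynamic_programming_ge g s e : cont_paths T g -> ptime g <= s <= T -> 0 < e ->
  exists u X, [/\ controls T (ptime g) u, is_mild_solution S T F g u X &
  \int[mu]_(r in `[ptime g, s]) q (mkpath r X) (u r) +
    value S T F q phi (mkpath s X) <= value S T F q phi g + e].
Proof.
move=> cg tsT e0; have [[/andP[t0 tT] _] _] := cg.
have /andP[ts sT] := tsT; have s0 := le_trans t0 ts.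
have [_ [u bu <-] hu] := inf_adherent e0 (costs_has_inf cg).
have mX := mild_solutionP cg bu; set X := mild_solution _ _ _ _ _ in mX.
have [cX _ _] := mX.
have cs : cont_paths T (mkpath s X) by apply: mkpath_cont => //; rewrite s0.
have bs : controls T s u.
  apply: borel_subset bu; first exact: measurable_itv.
  by apply: subset_itv; rewrite bnd_simp.
exists u, X; split => //; apply: le_trans (ltW hu).
by rewrite (cost_split cg bu mX tsT) lerD2l; exact: value_le_cost.
Qed.

Lemma value_terminal g : cont_paths_at T T g -> value S T F q phi g = phi g.
Proof.
move=> [cg gT]; have {}gT : ptime g = T by exact: gT.
have c u : controls T (ptime g) u -> cost S T F q phi g u = phi g.
  move=> bu; have mX := mild_solutionP cg bu.
  have E := mild_before cg mX bu; rewrite gT in E.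
  by rewrite (costE cg bu mX) gT Rint_point add0r E.
rewrite /value; suff -> : [set cost S T F q phi g u | u in controls T (ptime g)] =
    [set phi g] by exact: inf1.
apply/seteqP; split=> [_ [u bu <-]|_ ->]; first exact: c.
have [x _] := U_nonempty; exists (fun=> x); first exact: borel_cst.
by apply: c; exact: borel_cst.
Qed.

(** * First-order expansion of the value along mild solutions *)

Context (domA : set H) (A : H -> H).
Hypothesis AS : generates domA A S.
Context (f : hpath H -> R).
Hypothesis fC1 : C1_cadlag S ip T f.
Hypothesis Dx_dom : forall g, cont_paths T g -> adjoint_dom ip domA A (dpath_x ip f g).
Hypothesis adj_cont : dinf_continuous S T (cont_paths T)
  (fun g => adjoint ip domA A (dpath_x ip f g)).
Implicit Types (Z : hpath H) (h k e : R) (p x y : H).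
Local Notation Dx := (dpath_x ip f).
Local Notation Dt := (dpath_t f).
Local Notation adj := (adjoint ip domA A).


Lemma average_cont X e : {within `[0, T], continuous X} -> 0 < e ->
  {within `[0, T], continuous (fun s => average S e (X s))}.
Proof.
move=> /within_contP cX e0; apply/within_contP => s Ds k k0.
have [d d0 hd] := cX s Ds k k0; exists d => // r Dr /(hd r Dr).
by rewrite -(averageB ip_norm H_separable hS); apply: le_lt_trans; exact: average_le.
Qed.

Lemma average_uniform X e : {within `[0, T], continuous X} -> 0 < e ->
  exists2 d, 0 < d & forall k, 0 < k < d ->
  forall s, 0 <= s <= T -> `|average S k (X s) - X s| <= e.
Proof.
move=> /within_contP cX e0; have e30 : 0 < e / 3 by rewrite divr_gt0.
apply: uniform_on_segment => s sT.
have Ds : `[0, T]%classic s by rewrite /= in_itv.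
have [d1 d10 h1] := cX s Ds _ e30.
have [d2 d20 h2] := average_near0 ip_norm H_separable hS (X s) e30.
exists (Num.min d1 d2); first by rewrite lt_min d10.
move=> s' k s'T; rewrite !lt_min => /andP[sd1 _] /andP[k0 /andP[_ kd2]].
have n1 : `|X s' - X s| < e / 3 by apply: h1 => //; rewrite /= in_itv.
have n2 : `|average S k (X s) - X s| <= e / 3 by apply: h2; rewrite k0.
have n3 : `|average S k (X s' - X s)| <= e / 3.
  exact: le_trans (average_le ip_norm H_separable hS _ k0) (ltW n1).
have -> : average S k (X s') - X s' =
    average S k (X s' - X s) + ((average S k (X s) - X s) - (X s' - X s)).
  by rewrite (averageB ip_norm H_separable hS) opprB !subrKA.
rewrite (le_trans (ler_normD _ _))//.
rewrite (_ : e = e / 3 + (e / 3 + e / 3)); last by field.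
by rewrite lerD// (le_trans (ler_normB _ _))// lerD// ltW.
Qed.

Lemma close_bounded Y rho Z : {within `[0, T], continuous Y} ->
  cadlag_paths T Z -> (forall r, 0 <= r <= ptime Z -> `|Y r - Z r| <= rho) ->
  bounded_path Z.
Proof.
move=> cY [[/andP[Z0 ZT] _] _] YZ; split => //.
have [M M0 hM] := cont_bounded cY; exists (M + rho) => s /andP[s0 sZ].
rewrite -(subKr (Y s) (Z s)) (le_trans (ler_normB _ _))// lerD//.
  by rewrite hM// s0 (le_trans sZ).
by rewrite YZ// s0.
Qed.

Lemma close_dinf Y rho Z : cadlag_paths T Z ->
  (forall r, 0 <= r <= ptime Z -> `|Y r - Z r| <= rho) ->
  dinf S T (mkpath (ptime Z) Y) Z <= rho.
Proof.
move=> [[/andP[Z0 ZT] _] _] YZ; apply: dinf_same_time => // s sZ.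
by rewrite mkpathE// YZ.
Qed.

(** The restrictions of [Y] form a compact family, around which the spatial
    derivative is uniformly continuous with respect to all discontinuous paths. *)
Lemma dpath_x_uniform Y e : {within `[0, T], continuous Y} -> 0 < e ->
  exists2 d, 0 < d & forall k, 0 < k < d -> forall s, 0 <= s <= T ->
  forall Z, cadlag_paths T Z -> bounded_path Z -> dinf S T (mkpath s Y) Z <= k ->
  `|Dx Z - Dx (mkpath s Y)| <= e.
Proof.
move=> cY e0; have e20 : 0 < e / 2 by rewrite divr_gt0.
have [_ _ _ _ cDx] := fC1.
apply: (uniform_on_segment (P := fun k s => forall Z, cadlag_paths T Z ->
  bounded_path Z -> dinf S T (mkpath s Y) Z <= k -> `|Dx Z - Dx (mkpath s Y)| <= e)).
move=> s sT; have cs := cont_cadlag (mkpath_cont cY sT).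
have [d d0 hd] := cDx _ cs _ e20; have d20 : 0 < d / 2 by rewrite divr_gt0.
have [d' d'0 hd'] := dinf_path_cont hS T0 cY sT d20.
exists (Num.min d' (d / 2)); first by rewrite lt_min d'0.
move=> s' k s'T; rewrite !lt_min => /andP[ss' _] /andP[k0 /andP[_ kd]] Z cZ bZ dZ.
have c' := cont_cadlag (mkpath_cont cY s'T).
have n1 := hd' _ s'T ss'.
have n2 : `|Dx (mkpath s Y) - Dx (mkpath s' Y)| < e / 2.
  by apply: hd => //; apply: lt_le_trans n1 _; rewrite ler_pdivrMr// ler_pMr// ler1n.
have n3 : `|Dx (mkpath s Y) - Dx Z| < e / 2.
  apply: hd => //; apply: le_lt_trans (dinf_triangle hS T0 _ _ _) _.
  - exact: (mkpath_bounded cY sT).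
  - exact: (mkpath_bounded cY s'T).
  - exact: bZ.
  by rewrite [ltRHS](splitr d) ltrD// (le_lt_trans dZ).
rewrite (splitr e) (le_trans (ler_distD (Dx (mkpath s Y)) _ _))//.
by rewrite lerD// ltW// distrC.
Qed.

(** Along a Lipschitz path [Y], the increments of [f] are compared with those of
    its step approximations, whose mesh then goes to [0]. Only [Y] itself, not
    its approximations, need satisfy the first-order estimate [hPsi]. *)
Lemma lipschitz_expansion Y t D C c e e1 rho0 h1 (Psi : R -> R -> R) :
  {within `[0, T], continuous Y} -> 0 <= t -> 0 < D -> t + D < T -> 0 <= C ->
  (forall s s', t <= s <= s' -> s' <= t + D -> `|Y s' - Y s| <= C * (s' - s)) ->
  0 < rho0 -> 0 < h1 ->
  (forall Z, cadlag_paths T Z -> bounded_path Z -> t <= ptime Z <= t + D ->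
     (forall r, 0 <= r <= ptime Z -> `|Y r - Z r| <= rho0) -> `|Dt Z - c| <= e) ->
  (forall s, Psi s s = 0) ->
  (forall s s', t <= s <= s' -> s' <= t + D -> Psi t s' = Psi t s + Psi s s') ->
  (forall s h, t <= s -> 0 < h < h1 -> s + h <= t + D ->
     `|c * h + ip (Dx (mkpath (s + h) Y)) (Y (s + h) - Y s) - Psi s (s + h)|
       <= e1 * h) ->
  `|f (mkpath (t + D) Y) - f (mkpath t Y) - Psi t (t + D)| <= (e + e1) * D.
Proof.
move=> cY t0 D0 tDT C0 lipY rho00 h10 hDt Psi0 PsiD hPsi.
have tDT' : 0 <= t + D <= T by rewrite (ltW tDT) addr_ge0// ltW.
apply: le_add_eps => k k0; have k20 : 0 < k / 2 by rewrite divr_gt0.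
(* The total variation of [Y] is at most [C * D]. *)
pose e2 := k / 2 / (D * (C + 1)).
have C10 : 0 < C + 1 by rewrite ltr_wpDl.
have e20 : 0 < e2 by rewrite divr_gt0// mulr_gt0.
have [cf _ _ _ _] := fC1.
have cend := cont_cadlag (mkpath_cont cY tDT').
have [d1 d10 hd1] := cf _ cend _ k20.
have [d2 d20 hd2] := dpath_x_uniform cY e20.
pose rho := Num.min rho0 (Num.min (d1 / 2) (d2 / 2)).
have rhogt0 : 0 < rho by rewrite !lt_min rho00 !divr_gt0.
have [rho_0 rho_1 rho_2] : [/\ rho <= rho0, rho <= d1 / 2 & rho <= d2 / 2].
  by split; rewrite !ge_min lexx ?orbT.
have half (x : R) : 0 < x -> x / 2 < x.
  by move=> x0; rewrite ltr_pdivrMr// ltr_pMr// ltr1n.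
pose m := Num.min h1 (rho / (C + 1)).
have m0 : 0 < m by rewrite lt_min h10 divr_gt0.
have mD0 : 0 < m / D by rewrite divr_gt0.
have [N _ /(_ N (leqnn _)) /= hN] := near_infty_natSinv_lt (PosNum mD0).
pose h := D / N.+1%:R.
have h0 : 0 < h by rewrite divr_gt0.
have hm : h < m by rewrite /h mulrC -ltr_pdivlMr.
have hh1 : h < h1 by apply: lt_le_trans hm _; rewrite ge_min lexx.
have Ch : C * h <= rho.
  have : h < rho / (C + 1) by apply: lt_le_trans hm _; rewrite ge_min lexx orbT.
  rewrite ltr_pdivlMr// mulrC => /ltW; apply: le_trans.
  by rewrite ler_wpM2r ?(ltW h0)// lerDl.
have Nh : N.+1%:R * h = D by rewrite /h mulrC divfK.
pose Z := fix Z i := if i is j.+1 then step_next Y (Z j) (t + j%:R * h + h)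
  else mkpath t Y.
have tT : 0 <= t <= T by rewrite t0 (le_trans _ (ltW tDT))// lerDl ltW.
have inv i : (i <= N.+1)%N -> [/\ ptime (Z i) = t + i%:R * h, step_close T Y rho (Z i) &
    `|f (Z i) - f (mkpath t Y) - Psi t (t + i%:R * h)| <=
      (e + e1 + e2 * C) * (i%:R * h)].
  elim: i => [_|i IH iN].
    rewrite mul0r addr0; split => //=; last by rewrite Psi0 !subrr normr0 mulr0.
    split; first exact: cont_cadlag (mkpath_cont cY tT).
      by rewrite mkpathE//= t0 lexx.
    by move=> r /= rt; rewrite rt subrr normr0 ltW.
  have [pZ cZ hZ] := IH (ltnW iN); set s := t + i%:R * h in pZ hZ.
  have ts : t <= s by rewrite lerDl mulr_ge0 ?ler0n// ltW.
  have siE : t + i.+1%:R * h = s + h by rewrite -natr1 mulrDl mul1r addrA.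
  have shD : s + h <= t + D.
    by rewrite -siE lerD2l -Nh ler_wpM2r ?(ltW h0)// ler_nat.
  have sh : t <= s <= s + h by rewrite ts lerDl ltW.
  have shT : ptime (Z i) + h < T by rewrite pZ (le_lt_trans shD).
  have lipZ r : ptime (Z i) <= r <= ptime (Z i) + h -> `|Y r - Y (ptime (Z i))| <= rho.
    rewrite pZ => /andP[sr rsh]; apply: le_trans (lipY s r _ _) _.
    - by rewrite ts.
    - exact: le_trans shD.
    - by apply: le_trans Ch; rewrite ler_wpM2l// lerBlDl.
  have ZE : Z i.+1 = step_next Y (Z i) (ptime (Z i) + h) by rewrite pZ.
  have c' : cadlag_paths T (mkpath (s + h) Y).
    apply/cont_cadlag/(mkpath_cont cY); rewrite (le_trans shD (ltW tDT)) andbT.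
    by rewrite addr_ge0 ?(ltW h0)// (le_trans t0).
  split; first by rewrite ZE siE -pZ.
    by rewrite ZE; exact: step_next_close cZ (ltW h0) (ltW shT) lipZ.
  have := step_increment ip_norm hS T0 fC1 cZ (ltW h0) (ltW shT) lipZ (c := c)
    (p := Dx (mkpath (s + h) Y)) (e := e) (e' := e2) shT.
  rewrite -ZE pZ => hstep; rewrite siE.
  have {}hstep : `|f (Z i.+1) - f (Z i) -
      (c * h + ip (Dx (mkpath (s + h) Y)) (Y (s + h) - Y s))| <=
      e * h + e2 * (C * h).
    apply: le_trans (hstep _ _) _.
    - move=> Z' cZ' /andP[sZ' Z'sh] YZ'; apply: hDt => //.
      + exact: close_bounded YZ'.
      + by rewrite (le_trans ts sZ') (le_trans (ltW Z'sh)).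
      + by move=> r /YZ'/le_trans; apply.
    - move=> Z' cZ' pZ' YZ'; rewrite -pZ' in YZ' *.
      apply: (hd2 rho) => //.
      + by rewrite rhogt0 (le_lt_trans rho_2)// half.
      + by have [[]] := cZ'.
      + exact: close_bounded YZ'.
      + exact: close_dinf.
    - rewrite lerD2l ler_wpM2l ?(ltW e20)//.
      by apply: le_trans (lipY _ _ sh shD) _; rewrite addrC addKr.
  have hps : 0 < h < h1 by rewrite h0.
  have hst := hPsi s h ts hps shD.
  rewrite (PsiD _ _ sh shD).
  have -> : f (Z i.+1) - f (mkpath t Y) - (Psi t s + Psi s (s + h)) =
     (f (Z i) - f (mkpath t Y) - Psi t s) +
     ((f (Z i.+1) - f (Z i) - (c * h + ip (Dx (mkpath (s + h) Y)) (Y (s + h) - Y s)))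
     + (c * h + ip (Dx (mkpath (s + h) Y)) (Y (s + h) - Y s) - Psi s (s + h))).
    by ring.
  apply: le_trans (ler_normD _ _) _; apply: le_trans (lerD hZ (ler_normD _ _)) _.
  apply: le_trans (lerD (lexx _) (lerD hstep hst)) _.
  rewrite le_eqVlt; apply/orP; left; apply/eqP.
  by rewrite -natr1; ring.
have [pZ cZ hZ] := inv _ (leqnn _); rewrite Nh in pZ hZ.
have [cdZ _ YZ] := cZ.
have hend : `|f (mkpath (t + D) Y) - f (Z N.+1)| <= k / 2.
  apply/ltW/hd1 => //; rewrite -pZ; apply: le_lt_trans (close_dinf cdZ YZ) _.
  by rewrite (le_lt_trans rho_1)// half.
have -> : f (mkpath (t + D) Y) - f (mkpath t Y) - Psi t (t + D) =
  (f (mkpath (t + D) Y) - f (Z N.+1)) +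
  (f (Z N.+1) - f (mkpath t Y) - Psi t (t + D)) by ring.
apply: le_trans (ler_normD _ _) _; apply: le_trans (lerD hend hZ) _.
have e2C : e2 * C * D <= k / 2.
  rewrite /e2 -mulrA mulrC mulrA ler_pdivrMr ?mulr_gt0// mulrC ler_wpM2l ?(ltW k20)//.
  by rewrite mulrC ler_wpM2l ?(ltW D0)// lerDl.
by rewrite mulrDl [in leRHS](splitr k); rewrite addrC -[leLHS]addrA lerD2l lerD2r.
Qed.

(** The adjoint acts on the derivative [p'] at the end of the step, which is taken
    at a continuous path and hence lies in its domain; replacing [p'] and its
    image by [p] and [adj p] only afterwards costs small errors. Errors caused by
    the semigroup are estimated by [adjoint_increment_le], against [adj p]. *)
Lemma averaged_increment g u X p p' y k h s (eta M : R) : cont_paths T g ->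
  controls T (ptime g) u -> is_mild_solution S T F g u X ->
  (forall r (v : U), 0 <= r <= T -> `|F (mkpath r X) v| <= M) -> 0 <= M ->
  ptime g <= s -> s + h <= T -> 0 < k <= eta -> 0 <= h <= eta -> eta <= 1 ->
  adjoint_dom ip domA A p -> adjoint_dom ip domA A p' ->
  `|p' - p| <= eta -> `|adj p' - adj p| <= eta ->
  (forall r, 0 <= r <= h -> `|S r (average S k (X s)) - y| <= eta) ->
  `|ip p' (average S k (X (s + h)) - average S k (X s)) -
    (h * ip y (adj p) + \int[mu]_(r in `[s, s + h]) ip (F (mkpath r X) (u r)) p)|
  <= h * (eta * (`|adj p| + 1 + `|y| + M + 2 * M * `|adj p|)).
Proof.
move=> cg bu mX FM M0 ts shT /andP[k0 keta] /andP[h0 heta] eta1 dp dp' pp' aa' hy.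
have [[/andP[t0 tT] _] _] := cg; have [cX _ _] := mX.
have eta0 : 0 <= eta := le_trans h0 heta.
have ssh : s <= s + h by rewrite lerDl.
have bF : bounded_borel s (s + h) (fun r => F (mkpath r X) (u r)).
  apply: (bounded_borelS ts shT); exact: drift_bounded_borel.
have bSF : bounded_borel s (s + h) (fun r => S (s + h - r) (F (mkpath r X) (u r))).
  exact: convolution_bounded_borel.
have rT r : s <= r <= s + h -> 0 <= r <= T.
  move=> /andP[sr rsh]; rewrite (le_trans rsh shT) andbT.
  by rewrite (le_trans t0)// (le_trans ts).
set J := bint s (s + h) (fun r => S (s + h - r) (F (mkpath r X) (u r))).
set a := adj p; set a' := adj p'; set x := average S k (X s).
have shE : s + h - s = h by rewrite addrC addKr.
have step : X (s + h) = S h (X s) + J.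
  rewrite [LHS](mild_step cg bu mX _ shT (s := s)) ?ts ?lerDl// ?shE//.
have J_le : `|J| <= M * h.
  rewrite (_ : M * h = M * (s + h - s)); last by rewrite shE.
  apply: (bint_norm_le_cst ip_norm H_separable) => // r sr.
  rewrite (le_trans (semigroup_le hS _ _)) ?FM ?rT// subr_ge0.
  by case/andP: sr.
have incr : average S k (X (s + h)) - x = (S h x - x) + average S k J.
  rewrite step (averageD ip_norm H_separable hS).
  by rewrite -(averageC ip_norm H_separable hS k _ h0) addrAC.
rewrite incr [ip p' _]ipC ipDl (adjoint_increment ip_norm H_separable hS AS x dp' h0).
rewrite -/a' -/a; set I := \int[mu]_(r in _) _.
have OI : `|orbit_int S h x - h *: y| <= h * eta.
  exact: orbit_int_near hy.
have n1 : `|ip (orbit_int S h x - h *: y) a'| <= h * eta * (`|a| + 1).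
  apply: le_trans (ip_le ip_norm _ _) _; apply: ler_pM => //.
  rewrite -(subrK a a') addrC (le_trans (ler_normD _ _))// lerD2l.
  exact: le_trans aa' eta1.
have n2 : `|h * ip y (a' - a)| <= h * eta * `|y|.
  rewrite normrM ger0_norm// -mulrA ler_wpM2l// (le_trans (ip_le ip_norm _ _))//.
  by rewrite mulrC ler_wpM2r.
have n3 : `|ip (average S k J) (p' - p)| <= h * eta * M.
  apply: le_trans (ip_le ip_norm _ _) _.
  rewrite (_ : h * eta * M = (M * h) * eta); last by ring.
  apply: ler_pM => //.
  exact: le_trans (average_le ip_norm H_separable hS _ k0) J_le.
have n4 : `|ip (average S k J - J) p| <= h * eta * (M * `|a|).
  apply: le_trans (adjoint_average_le ip_norm H_separable hS AS J dp k0) _.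
  rewrite (_ : h * eta * (M * `|a|) = eta * (M * h * `|a|)); last by ring.
  by rewrite ler_pM ?mulr_ge0 ?(ltW k0)// ler_wpM2r.
have n5 : `|ip J p - I| <= h * eta * (M * `|a|).
  have [b1 b2] := (bounded_borel_ip ip_norm p bSF, bounded_borel_ip ip_norm p bF).
  rewrite /J (bint_ip ip_norm H_separable p bSF) /I -(RintB b1 b2).
  rewrite (_ : h * eta * (M * `|a|) = eta * (M * `|a|) * (s + h - s)); last first.
    by rewrite shE; ring.
  apply: Rint_norm_le_cst => //; first exact: bounded_mfunB.
  move=> r sr; have /andP[sr' rsh] := sr; have r0 : 0 <= s + h - r by rewrite subr_ge0.
  rewrite -ipBl (le_trans (adjoint_increment_le ip_norm H_separable hS AS _ dp r0))//.
  rewrite ler_pM ?mulr_ge0//; last by rewrite ler_wpM2r// FM// rT.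
  by apply: le_trans heta; rewrite -[leRHS]shE lerB.
have -> : ip (orbit_int S h x) a' + ip (average S k J) p' - (h * ip y a + I) =
   ip (orbit_int S h x - h *: y) a' + (h * ip y (a' - a) + (ip (average S k J) (p' - p)
   + (ip (average S k J - J) p + (ip J p - I)))).
  by rewrite !ipBl !ipBr (ipZl _ h y a'); ring.
rewrite (le_trans (ler_normD _ _))// (_ : h * (eta * _) = h * eta * (`|a| + 1) +
   (h * eta * `|y| + (h * eta * M + (h * eta * (M * `|a|) + h * eta * (M * `|a|)))));
   last by ring.
rewrite lerD// (le_trans (ler_normD _ _))// lerD// (le_trans (ler_normD _ _))//.
by rewrite lerD// (le_trans (ler_normD _ _))// lerD.
Qed.

Lemma orbit_average_near y e : 0 < e -> exists2 d, 0 < d &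
  forall k r, 0 < k < d -> 0 <= r < d -> `|S r (average S k y) - y| <= e.
Proof.
move=> e0; have [d d0 hd] := semigroup_near0 hS y e0.
exists (d / 2); first by rewrite divr_gt0.
move=> k r /andP[k0 kd] /andP[r0 rd]; rewrite (averageC ip_norm H_separable hS)//.
apply: (average_near ip_norm H_separable hS) => // r' /andP[r'0 r'k].
rewrite -(semigroupD hS)//; apply/ltW/hd; rewrite addr_ge0//=.
by rewrite (splitr d) ltrD// (le_lt_trans r'k).
Qed.

(** First-order expansion of [f] along the mild solutions issued from [g], with a
    remainder that is uniform in the control. *)
Lemma first_order_expansion g eta : cont_paths T g -> ptime g < T -> 0 < eta ->
  exists2 d, 0 < d & forall D, 0 < D < d -> ptime g + D < T /\
  forall u X, controls T (ptime g) u -> is_mild_solution S T F g u X ->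
  `|f (mkpath (ptime g + D) X) - f g -
    (D * (Dt g + ip (g (ptime g)) (adj (Dx g))) +
     \int[mu]_(r in `[ptime g, ptime g + D]) ip (F (mkpath r X) (u r)) (Dx g))|
  <= eta * D.
Proof.
move=> cg tT eta_gt0; have [[/andP[t0 _] _] _] := cg.
set t := ptime g in t0 tT *; set p := Dx g; set a := adj p; set y := g t.
pose G := growth g; have G0 : 0 <= G by exact: growth_ge0.
pose M := L * G; have M0 : 0 <= M by rewrite mulr_ge0 ?(ltW L0).
(* The constant of [averaged_increment], which does not depend on the control. *)
pose K := `|a| + 1 + `|y| + M + 2 * M * `|a|.
have K0 : 0 <= K.
  have Ma0 : 0 <= 2 * M * `|a| by rewrite mulr_ge0// mulr_ge0.
  by rewrite !addr_ge0.
have K10 : 0 < K + 1 by rewrite ltr_wpDl.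
pose eta1 := Num.min 1 (eta / (K + 1)).
have eta10 : 0 < eta1 by rewrite lt_min ltr01 divr_gt0.
have eta11 : eta1 <= 1 by rewrite ge_min lexx.
have etaK : eta1 + eta1 * K <= eta.
  have : eta1 <= eta / (K + 1) by rewrite ge_min lexx orbT.
  by rewrite ler_pdivlMr// mulrDr mulr1 addrC.
have [cf _ cDt _ cDx] := fC1; have cadg := cont_cadlag cg.
have [d1 d10 hd1] := cDt g (conj cadg tT) _ eta10.
have [d2 d20 hd2] := cDx g cadg _ eta10.
have [d3 d30 hd3] := adj_cont cg eta10.
pose d := Num.min d1 (Num.min d2 d3).
have d0 : 0 < d by rewrite !lt_min d10 d20.
have [dd1 dd2 dd3] : [/\ d <= d1, d <= d2 & d <= d3].
  by split; rewrite !ge_min lexx ?orbT.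
have eta120 : 0 < eta1 / 2 by rewrite divr_gt0.
have [nu nu0 hnu] := orbit_average_near y eta120.
have M10 : 0 < M + 1 by rewrite ltr_wpDl.
pose delta := Num.min (T - t) (Num.min (d / 4 / (M + 1))
  (Num.min (nu / 2) (eta1 / 2 / (M + 1)))).
have delta0 : 0 < delta by rewrite !lt_min subr_gt0 tT !divr_gt0.
exists delta => // D /andP[D0]; rewrite !lt_min => /and4P[DT Dd Dnu Deta].
have tDT : t + D < T by rewrite addrC -ltrBrDr.
have {}Dd : (1 + M) * D <= d / 4.
  by move: Dd; rewrite ltr_pdivlMr// mulrC (addrC M) => /ltW.
have {}Deta : M * D <= eta1 / 2.
  move: Deta; rewrite ltr_pdivlMr// mulrC => /ltW; apply: le_trans.
  by rewrite ler_wpM2r ?(ltW D0)// lerDl.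
split => // u X bu mX; have [cX _ _] := mX.
have FM r (v : U) : 0 <= r <= T -> `|F (mkpath r X) v| <= M.
  by move=> rT; have [] := mild_drift_le cg bu mX v rT.
have XG s : 0 <= s <= T -> `|X s| <= G.
  by move=> sT; apply: le_trans (mild_growth cg bu mX sT); rewrite lerDr.
have gE : mkpath t X = g := mild_before cg mX bu.
have tT' : 0 <= t <= T by rewrite t0 ltW.
have tDT' : 0 <= t + D <= T by rewrite (ltW tDT) addr_ge0// ltW.
apply: le_add_eps => kap kap0; have kap20 : 0 < kap / 2 by rewrite divr_gt0.
have [dA dA0 hdA] := cf _ (cont_cadlag (mkpath_cont cX tDT')) _ kap20.
have [dB dB0 hdB] := cf _ cadg _ kap20.
(* The averaging must not move the paths by more than the moduli of [f] at both
   ends of the interval, nor out of the ball of radius [d] around [g]. *)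
pose E := Num.min (d / 4) (Num.min (dA / 2) (dB / 2)).
have E0 : 0 < E by rewrite !lt_min !divr_gt0.
have [Ed EA EB] : [/\ E <= d / 4, E <= dA / 2 & E <= dB / 2].
  by split; rewrite !ge_min lexx ?orbT.
have half (x : R) : 0 < x -> x / 2 < x.
  by move=> x0; rewrite ltr_pdivrMr// ltr_pMr// ltr1n.
have [d4 d40 hd4] := average_uniform cX E0.
pose m := Num.min d4 (Num.min nu eta1).
have m0 : 0 < m by rewrite lt_min d40 lt_min nu0 eta10.
pose k := m / 2; have k0 : 0 < k by rewrite divr_gt0.
have km : k < m by exact: half.
have [kd4 knu keta] : [/\ k < d4, k < nu & k < eta1].
  have := lexx m; rewrite {2}/m le_min => /andP[md4].
  by rewrite le_min => /andP[mnu meta]; split; exact: lt_le_trans km _.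
pose Y s := average S k (X s).
have cY : {within `[0, T], continuous Y} by exact: average_cont.
have YX s : 0 <= s <= T -> `|X s - Y s| <= E.
  by move=> sT; rewrite distrC; apply: hd4; rewrite ?k0.
have dXY s : 0 <= s <= T -> dinf S T (mkpath s X) (mkpath s Y) <= E.
  move=> sT; apply: (dinf_same_time hS T0) => //=; first by case/andP: sT.
  move=> r rs; rewrite rs; apply: YX; case/andP: rs => -> rs.
  by rewrite (le_trans rs)//; case/andP: sT.
have near_g s Z : t <= s <= t + D -> ptime Z = s -> cadlag_paths T Z ->
    (forall r, 0 <= r <= s -> `|Y r - Z r| <= d / 4) -> dinf S T g Z < d.
  move=> /andP[ts sD] Zs cZ YZ; have sT : 0 <= s <= T.
    by rewrite (le_trans t0 ts) (le_trans sD (ltW tDT)).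
  have tsT : t <= s <= T by rewrite ts; case/andP: sT.
  have bXs := mkpath_bounded cX sT; have bYs := mkpath_bounded cY sT.
  have bg := cont_bounded_path cg.
  have YZ' r : 0 <= r <= ptime Z -> `|Y r - Z r| <= d / 4 by rewrite Zs; exact: YZ.
  have bZ := close_bounded cY cZ YZ'.
  have n1 : dinf S T g (mkpath s X) <= d / 4.
    apply: le_trans (mild_dinf cg bu mX tsT) _; apply: le_trans Dd.
    by rewrite ler_wpM2l ?addr_ge0// lerBlDl.
  have n2 := le_trans (dXY s sT) Ed.
  have n3 := close_dinf cZ YZ'; rewrite Zs in n3.
  apply: le_lt_trans (dinf_triangle hS T0 bg bXs bZ) _.
  apply: le_lt_trans (lerD n1 (dinf_triangle hS T0 bXs bYs bZ)) _.
  apply: le_lt_trans (lerD (lexx _) (lerD n2 n3)) _.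
  by rewrite [ltRHS](_ : d = d / 4 + (d / 4 + d / 4) + d / 4); [rewrite ltrDl divr_gt0|field].
pose Psi s s' := (s' - s) * (Dt g + ip y a) +
  \int[mu]_(r in `[s, s']) ip (F (mkpath r X) (u r)) p.
have tD : t <= t + D by rewrite lerDl ltW.
have bFt : bounded_borel t (t + D) (fun r => F (mkpath r X) (u r)).
  apply: (bounded_borelS (lexx t) (ltW tDT)); exact: drift_bounded_borel.
have step s s' : t <= s <= s' -> s' <= t + D -> `|Y s' - Y s| <= (2 * G / k + M) * (s' - s).
  move=> /andP[ts ss'] s'D; have s'T := le_trans s'D (ltW tDT).
  have h0 : 0 <= s' - s by rewrite subr_ge0.
  have sT : 0 <= s <= T by rewrite (le_trans t0 ts) (le_trans ss').
  set J := bint s s' (fun r => S (s' - r) (F (mkpath r X) (u r))).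
  have -> : Y s' - Y s = average S k (S (s' - s) (X s) - X s) + average S k J.
    rewrite -(averageD ip_norm H_separable hS) -(averageB ip_norm H_separable hS).
    have tss' : t <= s <= s' by rewrite ts.
    by rewrite (mild_step cg bu mX tss' s'T) addrAC.
  have J_le : `|J| <= M * (s' - s).
    apply: (bint_norm_le_cst ip_norm H_separable) => //.
      apply: convolution_bounded_borel => //; exact: bounded_borelS bFt.
    move=> r /andP[sr rs']; rewrite (le_trans (semigroup_le hS _ _)) ?subr_ge0//.
    by apply: FM; rewrite (le_trans t0 (le_trans ts sr)) (le_trans rs').
  rewrite mulrDl (le_trans (ler_normD _ _))// lerD//.
    apply: le_trans (average_increment ip_norm H_separable hS _ k0 h0) _.
    rewrite (_ : 2 * G / k * (s' - s) = 2 * (s' - s) / k * G); last by ring.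
    by rewrite ler_wpM2l ?XG// divr_ge0 ?mulr_ge0// ltW.
  exact: le_trans (average_le ip_norm H_separable hS _ k0) J_le.
have near_y s r : t <= s <= t + D -> 0 <= r < nu / 2 -> `|S r (Y s) - y| <= eta1.
  move=> /andP[ts sD] /andP[r0 rnu]; have sT := le_trans sD (ltW tDT).
  have st0 : 0 <= s - t by rewrite subr_ge0.
  set J := bint t s (fun r => S (s - r) (F (mkpath r X) (u r))).
  have J_le : `|J| <= M * (s - t).
    apply: (bint_norm_le_cst ip_norm H_separable) => //.
      apply: convolution_bounded_borel => //; exact: bounded_borelS bFt.
    move=> r' /andP[tr rs]; rewrite (le_trans (semigroup_le hS _ _)) ?subr_ge0//.
    by apply: FM; rewrite (le_trans t0 tr) (le_trans rs).
  have Xt : X t = y := mild_start cg mX bu.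
  have -> : S r (Y s) - y = (S (r + (s - t)) (average S k y) - y) + S r (average S k J).
    have -> : Y s = S (s - t) (average S k y) + average S k J.
      rewrite (averageC ip_norm H_separable hS)// -(averageD ip_norm H_separable hS).
      have tts : t <= t <= s by rewrite lexx.
      by rewrite -Xt /Y (mild_step cg bu mX tts sT).
    by rewrite [S r (_ + _)]linearD -(semigroupD hS (average S k y) (s := r))// addrAC.
  rewrite (splitr eta1) (le_trans (ler_normD _ _))// lerD//.
    apply: hnu; first by rewrite k0.
    rewrite addr_ge0//= (splitr nu) ltrD// (le_lt_trans _ Dnu)//.
    by rewrite lerBlDl.
  apply: le_trans (semigroup_le hS _ r0) _.
  apply: le_trans (average_le ip_norm H_separable hS _ k0) _.
  apply: le_trans J_le _; apply: le_trans Deta; rewrite ler_wpM2l//.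
  by rewrite lerBlDl.
have d40' : 0 < d / 4 by rewrite divr_gt0.
have main : `|f (mkpath (t + D) Y) - f (mkpath t Y) - Psi t (t + D)| <=
    (eta1 + eta1 * K) * D.
  apply: (lipschitz_expansion cY t0 D0 tDT (C := 2 * G / k + M) (c := Dt g)
    (rho0 := d / 4) (h1 := Num.min (nu / 2) eta1)) => //.
  - by apply: addr_ge0 => //; apply: divr_ge0 (ltW k0); exact: mulr_ge0.
  - by rewrite lt_min divr_gt0.
  - move=> Z cZ bZ tZ YZ; rewrite distrC; apply/ltW/hd1.
      split => //; rewrite /=; case/andP: tZ => _ Zt; exact: le_lt_trans tDT.
    exact: lt_le_trans (near_g _ _ tZ erefl cZ YZ) dd1.
  - by move=> s; rewrite /Psi subrr mul0r Rint_point addr0.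
  - move=> s s' /andP[ts ss'] s'D; rewrite /Psi.
    rewrite (@Rint_split _ t s' s) ?ts//; first by ring.
    by apply: bounded_borel_ip => //; exact: bounded_borelS bFt.
  - move=> s h ts /andP[h0]; rewrite lt_min => /andP[hnu' heta] shD.
    have shT : s + h <= T := le_trans shD (ltW tDT).
    have sh : t <= s + h <= t + D by rewrite shD (le_trans ts)// lerDl ltW.
    have shT' : 0 <= s + h <= T by rewrite shT andbT (le_trans t0)//; case/andP: sh.
    have cYh := mkpath_cont cY shT'.
    have dYh : dinf S T g (mkpath (s + h) Y) < d.
      apply: (near_g (s + h)) => //; first exact: cont_cadlag.
      by move=> r rsh; rewrite mkpathE// subrr normr0 ltW.
    rewrite (_ : Dt g * h + _ - _ = ip (Dx (mkpath (s + h) Y)) (Y (s + h) - Y s) -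
       (h * ip y a + \int[mu]_(r in `[s, s + h]) ip (F (mkpath r X) (u r)) p)); last first.
      by rewrite /Psi (_ : s + h - s = h) ?addrK// 1?addrC ?addKr//; ring.
    rewrite [leRHS](_ : _ = h * (eta1 * K)); last by rewrite mulrC.
    apply: (averaged_increment cg bu mX FM M0 ts shT) => //.
    + by rewrite k0 ltW.
    + by rewrite !ltW.
    + exact: Dx_dom.
    + exact: Dx_dom.
    + rewrite distrC; apply/ltW/hd2; first exact: cont_cadlag.
      exact: lt_le_trans dYh dd2.
    + rewrite distrC; apply/ltW/hd3 => //.
      exact: lt_le_trans dYh dd3.
    + move=> r /andP[r0 rh]; apply: near_y.
        by rewrite ts (le_trans _ shD)// lerDl ltW.
      by rewrite r0 (le_lt_trans rh).
have hA : `|f (mkpath (t + D) X) - f (mkpath (t + D) Y)| <= kap / 2.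
  apply/ltW/hdA; first exact: cont_cadlag (mkpath_cont cY tDT').
  by rewrite (le_lt_trans (dXY _ tDT'))// (le_lt_trans EA)// half.
have hB : `|f g - f (mkpath t Y)| <= kap / 2.
  apply/ltW/hdB; first exact: cont_cadlag (mkpath_cont cY tT').
  by rewrite -gE (le_lt_trans (dXY _ tT'))// (le_lt_trans EB)// half.
have PsiE : Psi t (t + D) = D * (Dt g + ip y a) +
    \int[mu]_(r in `[t, t + D]) ip (F (mkpath r X) (u r)) p.
  by rewrite /Psi (addrC t D) addrK.
rewrite -PsiE.
have -> : f (mkpath (t + D) X) - f g - Psi t (t + D) =
   (f (mkpath (t + D) Y) - f (mkpath t Y) - Psi t (t + D)) +
   ((f (mkpath (t + D) X) - f (mkpath (t + D) Y)) - (f g - f (mkpath t Y))) by ring.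
apply: le_trans (ler_normD _ _) _; apply: le_trans (lerD main (ler_normB _ _)) _.
apply: le_trans (lerD (lexx _) (lerD hA hB)) _; rewrite -splitr lerD2r.
by rewrite ler_wpM2r ?(ltW D0).
Qed.

(** * The Hamilton-Jacobi-Bellman equation *)

Lemma hamiltonian_term_le g p v : cont_paths T g ->
  `|ip p (F g v) + q g v| <= (`|p| + 1) * (L * (1 + pnorm g)).
Proof.
move=> cg; apply: le_trans (ler_normD _ _) _; rewrite mulrDl mul1r lerD//.
  apply: le_trans (ip_le ip_norm _ _) _; rewrite ler_wpM2l//.
  exact: (drift_le v cg).
by have [_ _ _] := coefL v cg cg.
Qed.

Lemma hamiltonian_term_lipschitz g g' p v : cont_paths T g -> cont_paths T g' ->
  `|(ip (F g' v) p + q g' v) - (ip p (F g v) + q g v)| <=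
  (`|p| + 1) * L * dinf S T g g'.
Proof.
move=> cg cg'; have [_ h1 h2 _] := coefL v cg cg'.
rewrite (ipC ip p) opprD addrACA -ipBl (le_trans (ler_normD _ _))//.
rewrite -mulrA mulrDl mul1r lerD//; last by rewrite distrC.
apply: le_trans (ip_le ip_norm _ _) _; rewrite mulrC ler_wpM2l//.
by rewrite distrC.
Qed.

Lemma hamiltonian_has_inf g p : cont_paths T g ->
  has_inf [set ip p (F g v) + q g v | v in [set: U]].
Proof.
move=> cg; split; first by have [v _] := U_nonempty; exists (ip p (F g v) + q g v), v.
exists (- ((`|p| + 1) * (L * (1 + pnorm g)))) => _ [v _ <-].
by apply: lerNnormlW; exact: hamiltonian_term_le.
Qed.

(** Both inequalities compare the dynamic programming principle on a short
    interval with the first-order expansion of the value, for a constant control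
    and for a nearly optimal one. *)
Lemma hjb_equation g : cont_paths T g -> ptime g < T ->
  (forall g', cont_paths T g' -> f g' = value S T F q phi g') ->
  Dt g + ip (adj (Dx g)) (g (ptime g)) + hamiltonian ip F q g (Dx g) = 0.
Proof.
move=> cg tT fV; have [[/andP[t0 _] _] _] := cg.
set p := Dx g; set t := ptime g in t0 tT *.
rewrite [ip (adj p) _]ipC; set Q := Dt g + ip (g t) (adj p).
pose C := (`|p| + 1) * L * (1 + L * growth g).
have C0 : 0 <= C.
  apply: mulr_ge0; first by rewrite mulr_ge0 ?(ltW L0)// addr_ge0.
  by rewrite addr_ge0// mulr_ge0 ?(ltW L0)//; exact: growth_ge0.
have C10 : 0 < C + 1 by rewrite ltr_wpDl.
have near_ham D u X : 0 < D -> t + D < T -> controls T t u ->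
    is_mild_solution S T F g u X -> forall r, t <= r <= t + D ->
    `|(ip (F (mkpath r X) (u r)) p + q (mkpath r X) (u r)) -
      (ip p (F g (u r)) + q g (u r))| <= C * D.
  move=> D0 tDT bu mX r /andP[tr rD]; have [cX _ _] := mX.
  have rT := le_trans rD (ltW tDT).
  have cr : cont_paths T (mkpath r X) by apply: mkpath_cont => //; rewrite (le_trans t0 tr).
  apply: le_trans (hamiltonian_term_lipschitz p (u r) cg cr) _.
  rewrite /C -[leRHS]mulrA ler_wpM2l//; first by rewrite mulr_ge0 ?(ltW L0)// addr_ge0.
  have trT : t <= r <= T by rewrite tr.
  apply: le_trans (mild_dinf cg bu mX trT) _; rewrite ler_wpM2l//.
    by rewrite addr_ge0// mulr_ge0 ?(ltW L0)//; exact: growth_ge0.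
  by rewrite lerBlDl.
have small eta : 0 < eta -> exists2 D, 0 < D /\ t + D < T &
    C * D <= eta /\ forall u X, controls T t u -> is_mild_solution S T F g u X ->
    `|value S T F q phi (mkpath (t + D) X) - value S T F q phi g -
      (D * Q + \int[mu]_(r in `[t, t + D]) ip (F (mkpath r X) (u r)) p)| <= eta * D.
  move=> eta0; have [d d0 hd] := first_order_expansion cg tT eta0.
  pose m := Num.min d (eta / (C + 1)); have m0 : 0 < m by rewrite lt_min d0 divr_gt0.
  have [md me] : m <= d /\ m <= eta / (C + 1) by split; rewrite ge_min lexx ?orbT.
  pose D := m / 2; have D0 : 0 < D by rewrite divr_gt0.
  have Dm : D < m by rewrite ltr_pdivrMr// ltr_pMr// ltr1n.
  have [] := hd D; first by rewrite D0 (lt_le_trans Dm).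
  move=> tDT hX; exists D => //; split.
    have : D <= eta / (C + 1) := le_trans (ltW Dm) me.
    by rewrite ler_pdivlMr// mulrC; apply: le_trans; rewrite ler_wpM2r ?(ltW D0)// lerDl.
  move=> u X bu mX; have [cX _ _] := mX; have := hX u X bu mX.
  rewrite fV; last by apply: mkpath_cont => //; rewrite (ltW tDT) addr_ge0// ltW.
  by rewrite fV.
have split_int D u X : 0 < D -> t + D < T -> controls T t u ->
    is_mild_solution S T F g u X ->
    [/\ bounded_mfun t (t + D) (fun r => ip (F (mkpath r X) (u r)) p),
        bounded_mfun t (t + D) (fun r => q (mkpath r X) (u r)) &
        bounded_mfun t (t + D) (fun r => ip (F (mkpath r X) (u r)) p + q (mkpath r X) (u r))].
  move=> D0 tDT bu mX; have [cX _ _] := mX.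
  have b1 : bounded_mfun t (t + D) (fun r => ip (F (mkpath r X) (u r)) p).
    apply: bounded_borel_ip => //; apply: (bounded_borelS (lexx t) (ltW tDT)).
    exact: drift_bounded_borel.
  have b2 : bounded_mfun t (t + D) (fun r => q (mkpath r X) (u r)).
    by apply: (bounded_mfunS (lexx t) (ltW tDT)); exact: running_bounded_mfun.
  by split => //; exact: bounded_mfunD.
have tDb D : 0 < D -> t <= t + D by move=> D0; rewrite lerDl ltW.
have lenD D : t + D - t = D by rewrite addrC addKr.
apply/eqP; rewrite eq_le; apply/andP; split; last first.
  rewrite addrC -lerBlDr sub0r; apply: lb_le_inf.
    by case: (hamiltonian_has_inf p cg).
  move=> _ [v _ <-]; rewrite lerNl -subr_ge0 opprK addrC; apply: le_add_eps => e e0.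
  have e20 : 0 < e / 2 by rewrite divr_gt0.
  have [D [D0 tDT] [CD hX]] := small _ e20.
  have bu : controls T t (fun=> v) by exact: borel_cst.
  have mX := mild_solutionP cg bu; set X := mild_solution _ _ _ _ _ in mX.
  have [b1 b2 b3] := split_int D _ X D0 tDT bu mX.
  have tDT' : t <= t + D <= T by rewrite tDb// ltW.
  have dp := dynamic_programming_le cg bu mX tDT'.
  have := hX _ _ bu mX; rewrite ler_norml => /andP[_ hV].
  have hI : \int[mu]_(r in `[t, t + D]) (ip (F (mkpath r X) v) p + q (mkpath r X) v) <=
      (ip p (F g v) + q g v + C * D) * D.
    rewrite -{3}(lenD D) -Rint_cst ?tDb//; apply: Rint_le => //.
      exact: bounded_mfun_cst.
    move=> r tr; have := near_ham D _ X D0 tDT bu mX r tr.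
    by rewrite ler_norml => /andP[_]; rewrite lerBlDl.
  rewrite (RintD b1 b2) in hI.
  rewrite -(ler_pM2r D0) mul0r; move: dp hV hI.
  set I1 := \int[mu]_(r in _) ip _ _; set I2 := \int[mu]_(r in _) q _ _.
  set V1 := value _ _ _ _ _ (mkpath _ _); set V0 := value _ _ _ _ _ g.
  set h := ip p _ + _ => dp hV hI.
  have CDD : C * D * D <= e / 2 * D by rewrite ler_wpM2r ?(ltW D0).
  have sum1 : 0 <= V1 - V0 + I2 by rewrite addrAC subr_ge0 addrC.
  rewrite [leRHS](_ : _ = (h + C * D) * D - C * D * D + D * Q + e / 2 * D + e / 2 * D);
    last by field.
  clear -dp hV hI CDD sum1; lra.
rewrite -lerBrDl sub0r; apply: le_add_eps => e e0.
have e30 : 0 < e / 3 by rewrite divr_gt0.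
have [D [D0 tDT] [CD hX]] := small _ e30.
have tDT' : t <= t + D <= T by rewrite tDb// ltW.
have eD0 : 0 < e / 3 * D by rewrite mulr_gt0.
have [u [X [bu mX dp]]] := dynamic_programming_ge cg tDT' eD0.
have [b1 b2 b3] := split_int D u X D0 tDT bu mX.
have := hX _ _ bu mX; rewrite ler_norml => /andP[hV _].
set h := hamiltonian _ _ _ _ _.
have hI : (h - C * D) * D <=
    \int[mu]_(r in `[t, t + D]) (ip (F (mkpath r X) (u r)) p + q (mkpath r X) (u r)).
  rewrite (_ : _ * D = \int[mu]_(r in `[t, t + D]) (h - C * D)); last first.
    by rewrite Rint_cst ?tDb// lenD.
  apply: Rint_le => //; first exact: bounded_mfun_cst.
  move=> r tr; have := near_ham D u X D0 tDT bu mX r tr.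
  rewrite ler_norml => /andP[+ _]; rewrite lerBrDl; apply: le_trans.
  rewrite lerD2r; apply: ge_inf; first by case: (hamiltonian_has_inf p cg).
  by exists (u r).
rewrite (RintD b1 b2) in hI.
rewrite -(ler_pM2r D0); move: dp hV hI.
set I1 := \int[mu]_(r in _) ip _ _; set I2 := \int[mu]_(r in _) q _ _.
set V1 := value _ _ _ _ _ (mkpath _ _); set V0 := value _ _ _ _ _ g.
move=> dp hV hI.
have CDD : C * D * D <= e / 3 * D by rewrite ler_wpM2r ?(ltW D0).
have -> : h * D = (h - C * D) * D + C * D * D by ring.
have -> : (- Q + e) * D = - (D * Q) + e / 3 * D + e / 3 * D + e / 3 * D by field.
clear -dp hV hI CDD; lra.
Qed.

End mild.

Theorem theorem3p2 (R : realType) (H : completeNormedModType R)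
  (ip : {dot H for idfun}) (U : metricType R) (T : R)
  (domA : set H) (A : H -> H) (S : R -> {linear H -> H})
  (F : hpath H -> U -> H) (q : hpath H -> U -> R) (phi : hpath H -> R)
  (Vhat : hpath H -> R)
  (ip_norm : forall x : H, ip x x = `|x| ^+ 2)
  (H_separable : exists2 Q : set H, countable Q & dense Q)
  (U_nonempty : [set: U] !=set0)
  (T_gt0 : 0 < T)
  (A_generates_S : generates domA A S)
  (hyp_a : contraction_semigroup S)
  (hyp_b : coef_continuous T F q)
  (hyp_c : coef_bounds S T F q phi)
  (Vhat_C1 : C1_cadlag S ip T Vhat)
  (Vhat_V : forall g, cont_paths T g -> Vhat g = value S T F q phi g)
  (dxV_dom : forall g, cont_paths T g ->
    adjoint_dom ip domA A (dpath_x ip Vhat g))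
  (AdxV_cont : dinf_continuous S T (cont_paths T)
    (fun g => adjoint ip domA A (dpath_x ip Vhat g))) :
  (forall t g, 0 <= t < T -> cont_paths_at T t g ->
    dpath_t Vhat g
    + ip (adjoint ip domA A (dpath_x ip Vhat g)) (g t)
    + hamiltonian ip F q g (dpath_x ip Vhat g) = 0) /\
  (forall g, cont_paths_at T T g -> value S T F q phi g = phi g).
Proof.
case: hyp_c => L L0 [coefL terminal_lipschitz]; have T0 := ltW T_gt0.
have phiL z : cont_paths_at T T z -> `|phi z| <= L * (1 + pnorm z).
  by move=> hz; case: (terminal_lipschitz z z hz hz).
split=> [t g /andP[_ tT] [cg gt]|g hg]; last first.
  exact: (value_terminal ip_norm H_separable hyp_a T0 hyp_b L0 coefL phi
    U_nonempty hg).
have {}gt : ptime g = t by exact: gt.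
rewrite -gt in tT *.
exact: (hjb_equation ip_norm H_separable hyp_a T0 hyp_b L0 coefL phiL U_nonempty
  A_generates_S Vhat_C1 dxV_dom AdxV_cont cg tT Vhat_V).
Qed.
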